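(* Let $k>0$ be an even integer. For $y>0$, \[ \mathcal{M}_k(y)=\alpha\sqrt y\sum_{d,s\in\mathbb N}Q(d)\,\frac{J_{k-1}(4\pi s\sqrt y/d)}{s}, \] where $Q(d)\asymp \mu^2(d)/d^2$. Moreover, as $y\to\infty$, \[ \mathcal{M}_k(y)=y^{1/4}\Big((-1)^{k/2-1}\sqrt{2/\pi}\,\alpha\Big)\sum_{d,s\in\mathbb N}\frac{Q(d)\sqrt d}{s^{3/2}}\cos\Big(\frac{4\pi s\sqrt y}{d}-\frac{3\pi}{4}\Big)+O(1), \] and the series $\sum_{d,s\in\mathbb N}\frac{Q(d)\sqrt d}{s^{3/2}}\cos\big(\frac{4\pi s\sqrt y}{d}-\frac{3\pi}{4}\big)$ is absolutely convergent and uniformly bounded in $y$.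
   Context: $Q(d):=\mu^2(d)\prod_{p\mid d}\frac{p^2}{p^4-2p^2-p+1}$, where $\mu$ is the Möbius function. $J_\nu$ is the Bessel function of the first kind. For $y>0$, \[\mathcal{M}_k(y)=\frac{\alpha(-1)^{k/2-1}}{k-1}\sum_{1\le r\le 2\sqrt y}\nu(r)\sqrt{4y-r^2}\,U_{k-2}\Big(\frac{r}{2\sqrt y}\Big)+\frac{\beta}{k-1}\sqrt y-\gamma\,\delta_{k=2}\,y,\] where $U_n(\cos\theta)=\sin((n+1)\theta)/\sin\theta$ is the Chebyshev polynomial, $\delta_{k=2}$ is $1$ if $k=2$ and $0$ otherwise, $\alpha=2\pi\prod_p\frac{1-p-2p^2+p^4}{p^4-2p^2+p}$, $\beta=2\pi\prod_p\frac{-1+p^2+p^3}{p(-1+p+p^2)}$, $\gamma=12\prod_p\frac{p(1+p)}{-1+p+p^2}$ (products over all primes), and $\nu(r)=\prod_{p\mid r}\big(1+\frac{p^2}{p^4-2p^2-p+1}\big)$.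
   Formalization: The leading constant in the asymptotic formula is corrected from (-1)^{k/2-1} sqrt(2/pi) alpha to (-1)^{k/2-1} sqrt(2/pi) alpha / sqrt(4 pi); with the printed constant the O(1) claim is false. *)

(* Defs.v *)
(* Stdlib reals and Coquelicot for the analysis; MathComp only for
   [prime], [primes], parity and big operators. *)
From Stdlib Require Import Reals ZArith Lra.
From mathcomp Require Import all_boot.
From Coquelicot Require Import Coquelicot.
Set Implicit Arguments.
Unset Strict Implicit.
Unset Printing Implicit Defensive.

Local Open Scope R_scope.

Definition mobius (d : nat) : Z :=
  if (0 < d)%N && all (fun p => ~~ (p ^ 2 %| d)%N) (primes d)
  then ((-1) ^ Z.of_nat (size (primes d)))%Z
  else 0%Z.

Definition local_weight (p : nat) : R :=
  INR p ^ 2 / (INR p ^ 4 - 2 * INR p ^ 2 - INR p + 1).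

Definition Qf (d : nat) : R :=
  IZR (mobius d) ^ 2 * \big[Rmult/1]_(p <- primes d) local_weight p.

Definition nuf (r : nat) : R :=
  \big[Rmult/1]_(p <- primes r) (1 + local_weight p).

(* [Lim_seq] is total; the three products below do converge, since their
   factors are 1 + O(1 / p^2). *)
Definition prime_product (F : R -> R) : R :=
  real (Lim_seq (fun N => \big[Rmult/1]_(0 <= p < N | prime p) F (INR p))).

Definition alphaC : R :=
  2 * PI * prime_product (fun p =>
    (1 - p - 2 * p ^ 2 + p ^ 4) / (p ^ 4 - 2 * p ^ 2 + p)).

Definition betaC : R :=
  2 * PI * prime_product (fun p =>
    (-1 + p ^ 2 + p ^ 3) / (p * (-1 + p + p ^ 2))).

Definition gammaC : R :=
  12 * prime_product (fun p => (p * (1 + p)) / (-1 + p + p ^ 2)).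

Fixpoint chebyshevU (n : nat) (x : R) {struct n} : R :=
  match n with
  | 0%N => 1
  | n1.+1 => match n1 with
             | 0%N => 2 * x
             | n2.+1 => 2 * x * chebyshevU n1 x - chebyshevU n2 x
             end
  end.

Lemma chebyshevU_cos (n : nat) (t : R) :
  sin t <> 0 -> chebyshevU n (cos t) = sin (INR n.+1 * t) / sin t.
Proof.
move=> st0.
suff [-> _] : chebyshevU n (cos t) = sin (INR n.+1 * t) / sin t /\
              chebyshevU n.+1 (cos t) = sin (INR n.+2 * t) / sin t by [].
elim: n => [|n [IH1 IH2]].
  split; first by rewrite /= Rmult_1_l; field.
  rewrite [INR 2]/= (_ : (1 + 1) * t = 2 * t); last by ring.
  by rewrite sin_2a /=; field.
split=> //.
have -> : chebyshevU n.+2 (cos t) =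
    2 * cos t * chebyshevU n.+1 (cos t) - chebyshevU n (cos t) by [].
rewrite IH1 IH2.
have -> : INR n.+3 * t = INR n.+2 * t + t by rewrite (S_INR n.+2); ring.
have -> : INR n.+1 * t = INR n.+2 * t - t by rewrite (S_INR n.+1); ring.
rewrite sin_plus sin_minus; field => //.
Qed.

(* Bessel function of the first kind, of natural order [n]. *)
Definition besselJ (n : nat) (x : R) : R :=
  Series (fun m => (-1) ^ m / (INR (fact m) * INR (fact (m + n)))
                   * (x / 2) ^ (2 * m + n)).

Definition floor_nat (x : R) : nat := Z.to_nat (Int_part x).

Definition murmur (k : nat) (y : R) : R :=
  alphaC * (-1) ^ (k./2 - 1) / (INR k - 1) *
    \big[Rplus/0]_(1 <= r < (floor_nat (2 * sqrt y)).+1)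
      (nuf r * sqrt (4 * y - INR r ^ 2) * chebyshevU (k - 2) (INR r / (2 * sqrt y)))
  + betaC / (INR k - 1) * sqrt y
  - gammaC * (if k == 2%N then 1 else 0) * y.

(* Double series over the positive integers. [dsum] is the iterated sum; it is
   the unambiguous value of the double series under [abs_dsummable]. *)
Definition abs_dsummable (a : nat -> nat -> R) : Prop :=
  exists B : R, forall M N : nat,
    \big[Rplus/0]_(1 <= d < M) \big[Rplus/0]_(1 <= s < N) Rabs (a d s) <= B.

Definition dsum (a : nat -> nat -> R) : R :=
  Series (fun i => Series (fun j => a i.+1 j.+1)).

Definition bessel_term (k : nat) (y : R) (d s : nat) : R :=
  Qf d * (besselJ (k - 1) (4 * PI * INR s * sqrt y / INR d) / INR s).

Definition osc_term (y : R) (d s : nat) : R :=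
  Qf d * sqrt (INR d) / Rpower (INR s) (3 / 2)
  * cos (4 * PI * INR s * sqrt y / INR d - 3 * PI / 4).

(* Substituting J_(k-1)(z) = (-1)^(k/2-1) sqrt(2 / (PI z)) cos(z - 3 PI / 4)
   + O(z^(-3/2)) at z = 4 PI s sqrt(y) / d into the Bessel series gives
     sqrt y * sqrt (2 / (PI z)) / s
       = y^(1/4) * (sqrt (2 / PI) / sqrt (4 PI)) * sqrt d / s^(3/2).
   The source prints sqrt (2 / PI) alone, losing the factor 1 / sqrt (4 PI).
   With that constant the expansion fails: murmur would differ from the right
   side by y^(1/4) times a nonzero multiple of dsum (osc_term y), which is a
   nonzero almost periodic function of sqrt y and so does not tend to 0. *)
Definition osc_const (k : nat) : R :=
  (-1) ^ (k./2 - 1) * (sqrt (2 / PI) / sqrt (4 * PI)) * alphaC.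

(* Main.v *)
Require Import Defs.
From HB Require Import structures.
From Stdlib Require Import Reals ZArith Lra Lia.
From mathcomp Require Import all_boot zify.
From Coquelicot Require Import Coquelicot.
Set Implicit Arguments.
Unset Strict Implicit.
Unset Printing Implicit Defensive.
Local Open Scope R_scope.

(** For odd [n = k - 1 = 2 j + 1] the exact formula is a weighted sum over [d] of
    the Schlomilch series [S(x) = sum_s J_n(s x) / s] at [x = 4 pi sqrt y / d].
    Integrating once in [x] and inserting
    [J_n(z) = +-(2 / pi) int_0^(pi/2) cos(n t) sin(z cos t) dt] reduces [S] to the
    uniformly convergent Fourier series [sum_s cos(s u) / s^2], a periodic parabola;
    each kink of the parabola, at [u = 2 pi m], yields after differentiation the
    term [sin(n acos(2 pi m / x))]. Writing [r = d m] and using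
    [sum_(d | r) Q(d) = nu(r)] produces the Chebyshev sum. The remaining constants
    [sum Q(d)] and [sum Q(d) / d] are Euler products, and [gamma] also uses
    [zeta(2) = pi^2 / 6].

    The asymptotic formula replaces [J_n] by its leading term. For [J_1] the
    substitution [u = sqrt 2 sin(t / 2)] and the Fresnel integrals give an error
    [O(z^(-3/2))], and the three-term recurrence carries it to all odd orders.
    As the error is also [O(z^(-1/2))], with [v = d / sqrt y] its total contribution
    is [sqrt y * sum_d d^(-2) min(v^(1/2), v^(3/2)) = O(1)]. *)

(** * Series and integrals *)

(** Inserting the integral for [J_n] directly into the Schlomilch series would produce the sawtooth
    [sum_s sin(s u) / s], whose convergence is not uniform near [u = 0], and [u = x cos t] reaches 0
    at [t = pi / 2] for every [x]. The integration in [x] gains a factor [1 / s], which lets sum and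
    integral commute. The price is that the closed form can be differentiated only off the kinks
    [x = 2 pi m]; continuity of [S] supplies these points. Hence the decay [z^(-1/2)] of [J_n] is
    needed already for the exact formula: it gives the absolute convergence and the continuity of
    [S].

    In the asymptotic part, the recurrence between odd orders passes through even ones, for which a
    bound [O(z^(-1/2))] suffices; so [J_0] is bounded but not expanded. For [J_1] the endpoint
    [t = pi / 2] produces terms of size [1 / z], too large for the error, which must cancel exactly.
    The Fresnel limits are found from the square of the complex integral, which leaves a sign to be
    fixed separately. *)

Lemma ex_derive_cont (f : R -> R) (x : R) : ex_derive f x -> continuous f x.
Proof. by move=> h; apply: (ex_derive_continuous (K := R_AbsRing) (V := R_NormedModule)). Qed.

Lemma ex_RInt_cont (f : R -> R) (a b : R) :
  (forall x, continuous f x) -> ex_RInt f a b.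
Proof. by move=> h; apply: (ex_RInt_continuous (V := R_CompleteNormedModule)) => x _; apply: h. Qed.

(* Coquelicot lemmas leave equations in the carrier of a normed module. *)
Ltac toR := match goal with |- @eq _ ?a ?b => change (@eq R a b) end;
  repeat match goal with |- context [@RInt ?V ?f ?a ?b] =>
    let v := fresh "v" in pose (v := (@RInt V f a b : R)); change (@RInt V f a b) with v; clearbody v end.
Ltac cts := apply: ex_derive_cont; auto_derive.
Ltac exint := apply: ex_RInt_cont => ?; cts.

Lemma Series_tail_le (a M : nat -> R) (N : nat) :
  (forall n, Rabs (a n) <= M n) -> ex_series M ->
  Rabs (Series a - sum_n a N) <= Series M - sum_n M N.
Proof.
move=> ha hM.
have hra : ex_series (fun n => Rabs (a n)).
  by apply: ex_series_le hM => n; rewrite /norm /= /abs /= Rabs_Rabsolu.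
have hea : ex_series a by apply: ex_series_Rabs.
rewrite !sum_n_Reals.
rewrite (Series_incr_n a N.+1); [|lia|by []].
rewrite (Series_incr_n M N.+1); [|lia|by []].
rewrite [Init.Nat.pred _]/=.
have -> : forall u v : R, u + v - u = v by move=> u v; ring.
have -> : forall u v : R, u + v - u = v by move=> u v; ring.
have h1 : ex_series (fun k => Rabs (a (N.+1 + k)%coq_nat)).
  by have := iffLR (ex_series_incr_n (fun n => Rabs (a n)) N.+1) hra.
apply: Rle_trans; first exact: (Series_Rabs _ h1).
apply: Series_le => [n|]; first by split; [exact: Rabs_pos|exact: ha].
by have := iffLR (ex_series_incr_n M N.+1) hM.
Qed.

(** Weierstrass M-test: the tail is bounded by the tail of [M], whatever [x]. *)
Lemma Series_uniform (f : nat -> R -> R) (M : nat -> R) :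
  (forall n x, Rabs (f n x) <= M n) -> ex_series M ->
  filterlim (fun N => (fun x => sum_n (fun n => f n x) N) : fct_UniformSpace R R_UniformSpace)
    eventually (locally (fun x => Series (fun n => f n x))).
Proof.
move=> hf hM.
apply/filterlim_locally => eps.
have /filterlim_locally /(_ eps) [N hN] := Series_correct M hM.
exists N => n hn x.
have := hN n hn.
rewrite /ball /= /AbsRing_ball /= /abs /minus /plus /opp /=.
have := Series_tail_le n (fun m => hf m x) hM.
rewrite -Rabs_Ropp.
have -> : - (Series (f^~ x) - sum_n (f^~ x) n) = sum_n (f^~ x) n + - Series (f^~ x) by ring.
move=> h1 h2; apply: Rle_lt_trans h1 _.
have h3 (u v e : R) : - e < u + - v -> v - u < e by lra.
by case: (Rabs_def2 _ _ h2) => _; apply: h3.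
Qed.

Lemma continuous_Series (f : nat -> R -> R) (M : nat -> R) (x : R) :
  (forall n x, Rabs (f n x) <= M n) -> ex_series M ->
  (forall n x, continuous (f n) x) ->
  continuous (fun x => Series (fun n => f n x)) x.
Proof.
move=> hf hM hc.
apply: (@filterlim_switch_1 nat R R_UniformSpace eventually eventually_filter (locally x) _ _ _
  (fun N => sum_n (fun n => f n x) N) _
  (Series_uniform hf hM)).
- move=> N; elim: N => [|N IH].
    have -> : sum_n (f^~ x) 0 = f 0%N x by rewrite sum_O.
    apply: filterlim_ext (hc 0%N x) => y; by rewrite sum_O.
  have -> : sum_n (f^~ x) N.+1 = sum_n (f^~ x) N + f N.+1 x by rewrite sum_Sn.
  apply: (filterlim_ext (fun y => sum_n (f^~ y) N + f N.+1 y)).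
    by move=> y; rewrite sum_Sn.
  apply: (@continuous_plus _ R_AbsRing R_NormedModule (fun y => sum_n (f^~ y) N) (f N.+1) x).
    exact: IH.
  exact: hc.
- apply: Series_correct.
  apply: ex_series_le hM => n; exact: hf.
Qed.

Lemma is_series_RInt (f : nat -> R -> R) (M : nat -> R) (a b : R) :
  (forall n x, Rabs (f n x) <= M n) -> ex_series M ->
  (forall n x, continuous (f n) x) ->
  is_series (fun n => RInt (f n) a b) (RInt (fun x => Series (fun n => f n x)) a b).
Proof.
move=> hf hM hc.
have hsum : forall N, is_RInt (fun x => sum_n (fun n => f n x) N) a b
    (sum_n (fun n => RInt (f n) a b) N).
  have h1 n : is_RInt (f n) a b (RInt (f n) a b).
    by apply: RInt_correct; apply: ex_RInt_cont.
  elim=> [|N IH].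
    rewrite sum_O; apply: is_RInt_ext (h1 0%N) => x _; by rewrite sum_O.
  rewrite sum_Sn; apply: (is_RInt_ext (fun x => plus (sum_n (f^~ x) N) (f N.+1 x))).
    by move=> x _; rewrite sum_Sn.
  exact: is_RInt_plus.
have [If [h1 h2]] := @filterlim_RInt nat R_CompleteNormedModule _ a b eventually eventually_filter _ _ hsum (Series_uniform hf hM).
by rewrite (is_RInt_unique _ _ _ _ h2).
Qed.

Lemma RInt_by_parts (F f g dg : R -> R) (a b : R) :
  (forall x, Rmin a b <= x <= Rmax a b -> is_derive F x (f x)) ->
  (forall x, Rmin a b <= x <= Rmax a b -> continuous f x) ->
  (forall x, Rmin a b <= x <= Rmax a b -> is_derive g x (dg x)) ->
  (forall x, Rmin a b <= x <= Rmax a b -> continuous dg x) ->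
  RInt (fun x => g x * f x) a b
    = g b * F b - g a * F a - RInt (fun x => dg x * F x) a b.
Proof.
move=> hF hf hg hdg.
have cF x : Rmin a b <= x <= Rmax a b -> continuous F x.
  by move=> hx; apply: ex_derive_cont; exists (f x); apply: hF.
have cg x : Rmin a b <= x <= Rmax a b -> continuous g x.
  by move=> hx; apply: ex_derive_cont; exists (dg x); apply: hg.
have e1 : ex_RInt (fun x => g x * f x) a b.
  apply: (ex_RInt_continuous (V := R_CompleteNormedModule)) => x hx.
  by apply: (continuous_mult (K := R_AbsRing)); auto.
have e2 : ex_RInt (fun x => dg x * F x) a b.
  apply: (ex_RInt_continuous (V := R_CompleteNormedModule)) => x hx.
  by apply: (continuous_mult (K := R_AbsRing)); auto.
have h : is_RInt (fun x => dg x * F x + g x * f x) a b (minus (g b * F b) (g a * F a)).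
  apply: (is_RInt_derive (V := R_CompleteNormedModule) (fun x => g x * F x)) => x hx.
    have -> : dg x * F x + g x * f x = plus (mult (dg x) (F x)) (mult (g x) (f x)) by [].
    apply: (is_derive_mult (K := R_AbsRing) g F x (dg x) (f x)); auto.
    by move=> n m; rewrite /mult /= Rmult_comm.
  apply: (continuous_plus (K := R_AbsRing) (V := R_NormedModule)); apply: (continuous_mult (K := R_AbsRing)); auto.
have h2 := is_RInt_unique _ _ _ _ h.
have h3 := RInt_plus _ _ _ _ e2 e1.
move: h2 h3; rewrite /minus /plus /opp /= => -> h3.
by move: h3; lra.
Qed.

Lemma continuous_bounded (f : R -> R) (a b : R) :
  a <= b -> (forall x, a <= x <= b -> continuous f x) ->
  exists M, 0 <= M /\ forall x, a <= x <= b -> Rabs (f x) <= M.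
Proof.
move=> hab hc.
have hc' c : a <= c <= b -> continuity_pt (fun x => Rabs (f x)) c.
  move=> h; apply: (continuity_pt_comp f Rabs).
    by apply/continuity_pt_filterlim; apply: hc.
  exact: Rcontinuity_abs.
have [x0 [h1 h2]] := continuity_ab_maj _ _ _ hab hc'.
exists (Rabs (f x0)); split; first exact: Rabs_pos.
by move=> x hx; apply: h1.
Qed.

Lemma RInt_FTC (F f : R -> R) (a b : R) :
  (forall x, Rmin a b <= x <= Rmax a b -> is_derive F x (f x)) ->
  (forall x, Rmin a b <= x <= Rmax a b -> continuous f x) ->
  RInt f a b = F b - F a.
Proof.
move=> h1 h2; apply: is_RInt_unique.
exact: (is_RInt_derive (V := R_CompleteNormedModule) F f a b h1 h2).
Qed.

HB.instance Definition _ := Monoid.isComLaw.Build R 0 Rplus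
  (fun x y z => esym (Rplus_assoc x y z)) Rplus_comm Rplus_0_l.
HB.instance Definition _ := Monoid.isComLaw.Build R 1 Rmult
  (fun x y z => esym (Rmult_assoc x y z)) Rmult_comm Rmult_1_l.
HB.instance Definition _ := Monoid.isMulLaw.Build R 0 Rmult Rmult_0_l Rmult_0_r.
HB.instance Definition _ := Monoid.isAddLaw.Build R Rmult Rplus
  Rmult_plus_distr_r Rmult_plus_distr_l.

Lemma sum_n_big (a : nat -> R) (N : nat) : sum_n a N = \big[Rplus/0]_(i < N.+1) a i.
Proof.
elim: N => [|N IH]; first by rewrite sum_O big_ord_recl big_ord0 /= Rplus_0_r.
by rewrite sum_Sn IH [in RHS]big_ord_recr.
Qed.

Lemma ex_series_bounded (a : nat -> R) (B : R) :
  (forall n, 0 <= a n) -> (forall N, sum_n a N <= B) ->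
  ex_series a /\ Series a <= B.
Proof.
move=> ha hB.
have [l hl] : ex_finite_lim_seq (sum_n a).
  apply: (ex_finite_lim_seq_incr _ B) => // n.
  by rewrite sum_Sn /plus /=; have := ha n.+1; lra.
have hs : is_series a l by [].
split; first by exists l.
rewrite (is_series_unique _ _ hs).
have := is_lim_seq_le _ _ _ _ hB hl (is_lim_seq_const B).
by [].
Qed.

(** A telescoping majorant replaces the integral test; the explicit bound [B - h 0] also supplies
    the constant in [kernel_error]. *)
Lemma ex_series_telescope (a h : nat -> R) (B : R) :
  (forall n, 0 <= a n <= h n.+1 - h n) -> (forall n, h n <= B) ->
  ex_series a /\ Series a <= B - h 0%N.
Proof.
move=> ha hB; apply: ex_series_bounded => [n|N]; first by case: (ha n).
have : sum_n a N <= h N.+1 - h 0%N.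
  elim: N => [|N IH]; first by rewrite sum_O; case: (ha 0%N).
  rewrite sum_Sn /plus /=; case: (ha N.+1); lra.
by have := hB N.+1; lra.
Qed.

Lemma INRS_gt0 (n : nat) : 0 < INR n.+1.
Proof. by apply: lt_0_INR; lia. Qed.

Lemma ex_series_inv_sqr : ex_series (fun i => / INR i.+1 ^ 2).
Proof.
(* [2 / x - 2 / (x + 1)] dominates [1 / x ^ 2] because [2 x >= x + 1]. *)
apply: (proj1 (@ex_series_telescope _ (fun i => - (2 / INR i.+1)) 0 _ _)) => n.
  have h := INRS_gt0 n; rewrite (S_INR n.+1).
  split; first by apply: Rlt_le; apply: Rinv_0_lt_compat; nra.
  have hx : 1 <= INR n.+1 by rewrite S_INR; have := pos_INR n; lra.
  move: (INR n.+1) hx {h} => x hx.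
  have -> : - (2 / (x + 1)) - - (2 / x) = / x ^ 2 * (2 * x / (x + 1)) by field; lra.
  have : 0 < / x ^ 2 by apply: Rinv_0_lt_compat; nra.
  have : 1 <= 2 * x / (x + 1).
    by apply: (Rmult_le_reg_r (x + 1)); [lra|]; field_simplify; lra.
  nra.
have : 0 < 2 / INR n.+1 by apply: Rdiv_lt_0_compat; [lra|apply: INRS_gt0].
lra.
Qed.

(** Recovers the exceptional points of two identities: [u = 0] for the parabola and the kinks for
    the Schlomilch series. *)
Lemma continuous_eq_of_dense (f g : R -> R) (x : R) :
  continuous f x -> continuous g x ->
  (forall e, 0 < e -> exists t, Rabs (t - x) < e /\ f t = g t) -> f x = g x.
Proof.
move=> hf hg h.
case: (Req_dec (f x) (g x)) => // hne.
have he : 0 < Rabs (f x - g x) / 2.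
  have : 0 < Rabs (f x - g x) by apply: Rabs_pos_lt; lra.
  lra.
have [d1 h1] := proj1 (filterlim_locally _ _) hf (mkposreal _ he).
have [d2 h2] := proj1 (filterlim_locally _ _) hg (mkposreal _ he).
have [t [ht e]] := h (Rmin d1 d2) (Rmin_stable_in_posreal d1 d2).
have b1 : ball x d1 t by apply: Rlt_le_trans ht (Rmin_l _ _).
have b2 : ball x d2 t by apply: Rlt_le_trans ht (Rmin_r _ _).
have := h1 t b1; have := h2 t b2.
rewrite /ball /= /AbsRing_ball /= /abs /minus /plus /opp /= e => A B.
exfalso; move: A B; rewrite -(Rabs_Ropp (g t + - f x)) => A B.
have := Rabs_triang (g t + - g x) (- (g t + - f x)).
have -> : g t + - g x + - (g t + - f x) = f x - g x by ring.
lra.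
Qed.

Lemma mvt_bound (f df : R -> R) (a b K : R) : a <= b ->
  (forall x, a <= x <= b -> is_derive f x (df x)) ->
  (forall x, a <= x <= b -> Rabs (df x) <= K) ->
  Rabs (f b - f a) <= K * (b - a).
Proof.
move=> hab hd hK.
case: (MVT_gen f a b df); rewrite (Rmin_left _ _ hab) (Rmax_right _ _ hab).
- by move=> x hx; apply: hd; lra.
- move=> x hx; apply/continuity_pt_filterlim.
  by apply: ex_derive_cont; exists (df x); apply: hd.
move=> c [hc ->]; rewrite Rabs_mult (Rabs_right (b - a)); last lra.
by have := hK c hc; nra.
Qed.

(** * The Fourier series of the periodic parabola *)

(** This is [PI ^ 2] times the second Bernoulli polynomial at the fractional part of
    [u / (2 PI)]. *)
Definition bern (u : R) : R := Series (fun i => cos (INR i.+1 * u) / INR i.+1 ^ 2).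

Lemma bern_term_le (i : nat) (u : R) :
  Rabs (cos (INR i.+1 * u) / INR i.+1 ^ 2) <= / INR i.+1 ^ 2.
Proof.
have h : 0 < / INR i.+1 ^ 2.
  by apply: Rinv_0_lt_compat; apply: pow_lt; apply: INRS_gt0.
rewrite Rabs_mult (Rabs_right (/ _)); last lra.
have : Rabs (cos (INR i.+1 * u)) <= 1 by apply: Rabs_le; apply: COS_bound.
nra.
Qed.

Lemma bern_term_continuous (i : nat) (u : R) :
  continuous (fun u => cos (INR i.+1 * u) / INR i.+1 ^ 2) u.
Proof. by move: (INR i.+1) => c; cts. Qed.

Lemma bern_continuous (u : R) : continuous bern u.
Proof.
exact: (@continuous_Series (fun i u => cos (INR i.+1 * u) / INR i.+1 ^ 2) _ u
  bern_term_le ex_series_inv_sqr bern_term_continuous).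
Qed.

Lemma dirichlet_kernel (N : nat) (u : R) :
  2 * sin (u / 2) * (sum_n (fun i => cos (INR i.+1 * u)) N + / 2)
    = sin ((INR N.+1 + / 2) * u).
Proof.
elim: N => [|N IH].
  rewrite sum_O /=.
  have -> : 1 * u = 2 * (u / 2) by field.
  have -> : (1 + / 2) * u = 2 * (u / 2) + u / 2 by field.
  rewrite sin_plus sin_2a cos_2a_sin; move: (cos _) (sin2_cos2 (u / 2)); rewrite /Rsqr => c.
  move: (sin _) => s hs.
  have -> : 2 * s * c * c = 2 * s * (1 - s * s) by rewrite -hs; ring.
  field.
have -> : sum_n (fun i => cos (INR i.+1 * u)) N.+1 =
   sum_n (fun i => cos (INR i.+1 * u)) N + cos (INR N.+2 * u) by rewrite sum_Sn.
have -> : (INR N.+2 + / 2) * u = INR N.+2 * u + u / 2 by field.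
have h : (INR N.+1 + / 2) * u = INR N.+2 * u - u / 2 by rewrite (S_INR N.+1); field.
move: IH; rewrite h sin_plus sin_minus; lra.
Qed.

(* Let [r N] be the derivative of the [N]-th partial sum minus the parabola, and
   [L N = N + 3/2]. By the Dirichlet kernel, the derivative of
   [r N t - cos (L N * t) / (2 * L N * sin (t / 2))] is of size [1 / L N]. *)
Lemma bern_half_period (u : R) : 0 < u <= PI -> bern u = bern PI + (u - PI) ^ 2 / 4.
Proof.
move=> [u0 uPI].
have PI0 := PI_RGT_0.
set m := sin (u / 2).
have m0 : 0 < m by apply: sin_gt_0; lra.
have sm t : u <= t <= PI -> m <= sin (t / 2).
  by move=> ht; apply: sin_incr_1; lra.
pose F N t := sum_n (fun i => cos (INR i.+1 * t) / INR i.+1 ^ 2) N - (t - PI) ^ 2 / 4.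
pose r N t := - sum_n (fun i => sin (INR i.+1 * t) / INR i.+1) N - (t - PI) / 2.
pose L N := INR N.+1 + / 2.
have L0 N : 0 < L N by rewrite /L; have := INRS_gt0 N; lra.
have dF N t : is_derive (F N) t (r N t).
  rewrite /F /r.
  apply: is_derive_minus.
    have -> : forall a, - a = opp a by [].
    rewrite (_ : opp _ = sum_n (fun i => - (sin (INR i.+1 * t) / INR i.+1)) N).
      apply: is_derive_sum_n => k _.
      have := INRS_gt0 k; move: (INR k.+1) => c c0; auto_derive => //; field; lra.
    elim: N => [|N IH]; first by rewrite !sum_O.
    by rewrite !sum_Sn -IH /opp /plus /=; ring.
  by auto_derive; [|field].
have dr N t : u <= t <= PI -> is_derive (r N) t (- (sin (L N * t) / (2 * sin (t / 2)))).
  move=> ht; have hs : 0 < sin (t / 2) by have := sm t ht; lra.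
  have -> : - (sin (L N * t) / (2 * sin (t / 2))) =
     minus (opp (sum_n (fun i => cos (INR i.+1 * t)) N)) (/ 2).
    rewrite /L -dirichlet_kernel /minus /plus /opp /=; move: (sum_n _ N) => c.
    rewrite /L; field; lra.
  apply: is_derive_minus.
    apply: is_derive_opp; apply: is_derive_sum_n => k _.
    have := INRS_gt0 k; move: (INR k.+1) => c c0; auto_derive => //; field; lra.
  by auto_derive; [|field].
have rPI N : r N PI = 0.
  rewrite /r (_ : sum_n _ N = 0); first lra.
  elim: N => [|N IH]; [rewrite sum_O|rewrite sum_Sn IH /plus /=];
    rewrite sin_eq_0_1 /=; try (by exists (Z.of_nat 1); rewrite -INR_IZR_INZ);
    first by lra.
  - by rewrite /Rdiv !Rmult_0_l Rplus_0_l.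
  - by exists (Z.of_nat N.+2); rewrite -INR_IZR_INZ.
(* [m] is the minimum of [sin (t / 2)] on [[u, PI]], so [K / L N] will bound the derivative of the
   corrected remainder [P]. *)
pose K := / (4 * (m * m)).
have K0 : 0 < K by apply: Rinv_0_lt_compat; nra.
(* Since [r N PI = 0], the value [r N t] is recovered from the variation of [P] on [[t, PI]], which
   costs [K * PI], and from the corrections at [t] and at [PI], which cost [/ m / 2] each, all
   divided by [L N]. *)
have rb N t : u <= t <= PI -> Rabs (r N t) <= (K * PI + / m) / L N.
  move=> ht.
  pose P t := r N t - cos (L N * t) / (2 * L N * sin (t / 2)).
  have dP v : t <= v <= PI ->
     is_derive P v (cos (L N * v) * cos (v / 2) / (4 * L N * (sin (v / 2) * sin (v / 2)))).
    move=> hv.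
    have hs : 0 < sin (v / 2) by have := sm v; lra.
    have h1 := dr N v; have hL := L0 N.
    apply: (is_derive_ext (fun t => minus (r N t) (cos (L N * t) / (2 * L N * sin (t / 2))))) => //.
    rewrite (_ : cos _ * _ / _ = minus (- (sin (L N * v) / (2 * sin (v / 2))))
      (- (sin (L N * v) / (2 * sin (v / 2))) -
      cos (L N * v) * cos (v / 2) / (4 * L N * (sin (v / 2) * sin (v / 2))))); last first.
      by rewrite /minus /plus /opp /=; ring.
    apply: is_derive_minus; first by apply: h1; lra.
    move: (L N) hL => l hl; auto_derive; first by apply: Rmult_integral_contrapositive_currified; lra.
    by rewrite /Rdiv; field; lra.
  have bP : Rabs (P PI - P t) <= K / L N * (PI - t).
    apply: (mvt_bound _ dP); first lra.
    move=> v hv.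
    have hs : m <= sin (v / 2) by apply: sm; lra.
    have hL := L0 N.
    have h1 : 0 < / (4 * L N * (sin (v / 2) * sin (v / 2))).
      by apply: Rinv_0_lt_compat; apply: Rmult_lt_0_compat; nra.
    have h2 : / (4 * L N * (sin (v / 2) * sin (v / 2))) <= K / L N.
      rewrite /K /Rdiv -Rinv_mult; apply: Rinv_le_contravar; first by apply: Rmult_lt_0_compat; nra.
      have : m * m <= sin (v / 2) * sin (v / 2) by nra.
      nra.
    rewrite /Rdiv !Rabs_mult (Rabs_right (/ _)); last lra.
    have c1 : Rabs (cos (L N * v)) <= 1 by apply: Rabs_le; apply: COS_bound.
    have c2 : Rabs (cos (v / 2)) <= 1 by apply: Rabs_le; apply: COS_bound.
    have := Rabs_pos (cos (L N * v)); have := Rabs_pos (cos (v / 2)) => p2 p1.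
    have : Rabs (cos (L N * v)) * Rabs (cos (v / 2)) <= 1 by nra.
    by rewrite /Rdiv in h2; nra.
  have hc v : u <= v <= PI -> Rabs (cos (L N * v) / (2 * L N * sin (v / 2))) <= / m / 2 / L N.
    move=> hv; have hs := sm v hv; have hL := L0 N.
    have h1 : 0 < / (2 * L N * sin (v / 2)) by apply: Rinv_0_lt_compat; apply: Rmult_lt_0_compat; lra.
    rewrite Rabs_mult (Rabs_right (/ _)); last lra.
    have c1 : Rabs (cos (L N * v)) <= 1 by apply: Rabs_le; apply: COS_bound.
    have h2 : / (2 * L N * sin (v / 2)) <= / m / 2 / L N.
      rewrite /Rdiv -!Rinv_mult; apply: Rinv_le_contravar; nra.
    have := Rabs_pos (cos (L N * v)); nra.
  have e1 : r N t = - (P PI - P t) + cos (L N * t) / (2 * L N * sin (t / 2))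
     + - (cos (L N * PI) / (2 * L N * sin (PI / 2))).
    by rewrite /P rPI; ring.
  rewrite e1.
  have hu := hc t ht; have hp := hc PI (conj uPI (Rle_refl _)).
  have tr := Rabs_triang (- (P PI - P t) + cos (L N * t) / (2 * L N * sin (t / 2)))
     (- (cos (L N * PI) / (2 * L N * sin (PI / 2)))).
  have tr2 := Rabs_triang (- (P PI - P t)) (cos (L N * t) / (2 * L N * sin (t / 2))).
  rewrite !Rabs_Ropp in tr tr2.
  have : K / L N * (PI - t) <= K / L N * PI.
    have : 0 < K / L N by apply: Rdiv_lt_0_compat.
    nra.
  have -> : (K * PI + / m) / L N = K / L N * PI + / m / 2 / L N + / m / 2 / L N.
    by have := L0 N; have := m0; move=> ? ?; field; lra.
  lra.
have Fb N : Rabs (F N PI - F N u) <= (K * PI + / m) / L N * PI.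
  have h := mvt_bound uPI (fun x _ => dF N x) (rb N).
  apply: Rle_trans h _.
  have : 0 < (K * PI + / m) / L N.
    apply: Rdiv_lt_0_compat => //; have := Rinv_0_lt_compat _ m0; nra.
  nra.
(* The sequence has two limits: the one obtained termwise, and 0 because the derivative of [F N] is
   [O(1 / L N)] on [[u, PI]]. *)
have lim1 : is_lim_seq (fun N => F N PI - F N u) (bern PI - (PI - PI) ^ 2 / 4 - (bern u - (u - PI) ^ 2 / 4)).
  have hs t : is_lim_seq (sum_n (fun i => cos (INR i.+1 * t) / INR i.+1 ^ 2)) (bern t).
    apply: (Series_correct (fun i => cos (INR i.+1 * t) / INR i.+1 ^ 2)).
    by apply: ex_series_le ex_series_inv_sqr => n; apply: bern_term_le.
  rewrite /F; apply: is_lim_seq_minus'; apply: is_lim_seq_minus' => //; exact: is_lim_seq_const.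
have lim2 : is_lim_seq (fun N => F N PI - F N u) 0.
  apply/is_lim_seq_abs_0.
  apply: (is_lim_seq_le_le (fun _ => 0) _ (fun N => (K * PI + / m) * PI * / L N)).
  - move=> N; split; first exact: Rabs_pos.
    by have := Fb N; rewrite /Rdiv; lra.
  - exact: is_lim_seq_const.
  - rewrite (_ : Finite 0 = Rbar_mult ((K * PI + / m) * PI) (Rbar_inv p_infty)); last first.
      by rewrite /= Rmult_0_r.
    apply: is_lim_seq_scal_l; apply: is_lim_seq_inv => //.
    rewrite /L; apply: (is_lim_seq_plus _ _ p_infty (/ 2)).
    + exact: (iffLR (is_lim_seq_incr_1 INR p_infty) is_lim_seq_INR).
    + exact: is_lim_seq_const.
    + by [].
have := is_lim_seq_unique _ _ lim1; rewrite (is_lim_seq_unique _ _ lim2) => [] [].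
lra.
Qed.

Lemma sin_INR_PI (n : nat) : sin (INR n * PI) = 0.
Proof. by apply: sin_eq_0_1; exists (Z.of_nat n); rewrite -INR_IZR_INZ. Qed.

(** At [u = 0] the Dirichlet kernel argument would divide by [sin (u / 2) = 0]; continuity fills the
    gap, and it is this endpoint that yields [zeta2]. *)
Lemma bern_half_period0 (u : R) : 0 <= u <= PI -> bern u = bern PI + (u - PI) ^ 2 / 4.
Proof.
move=> [[u0|<-] uPI]; first exact: bern_half_period.
apply: (@continuous_eq_of_dense bern (fun u => bern PI + (u - PI) ^ 2 / 4)).
- exact: bern_continuous.
- by cts.
move=> e e0; exists (Rmin (e / 2) PI).
have PI0 := PI_RGT_0.
have h1 : 0 < Rmin (e / 2) PI by apply: Rmin_pos; lra.
have h2 := Rmin_l (e / 2) PI; have h3 := Rmin_r (e / 2) PI.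
by split; [rewrite Rabs_right; lra|apply: bern_half_period].
Qed.

(* The mean value of [bern] vanishes, which fixes the constant. *)
Lemma bern_PI : bern PI = - (PI ^ 2 / 12).
Proof.
have h := @is_series_RInt (fun i u => cos (INR i.+1 * u) / INR i.+1 ^ 2) _ 0 PI
  bern_term_le ex_series_inv_sqr bern_term_continuous.
have e0 : RInt bern 0 PI = 0.
  rewrite /bern -(is_series_unique _ _ h).
  transitivity (Series (fun _ => 0 * 0)); last by rewrite Series_scal_l; lra.
  apply: Series_ext => n.
  have := sin_INR_PI n.+1; have := INRS_gt0 n; move: (INR n.+1) => c c0 hs.
  rewrite (@RInt_FTC (fun u => sin (c * u) / c ^ 3)) => [|x _|x _].
  - by rewrite hs (Rmult_0_r c) sin_0; field; lra.
  - by auto_derive => //; field; lra.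
  - by cts.
have e1 : RInt bern 0 PI = bern PI * PI + PI ^ 3 / 12.
  rewrite (RInt_ext _ (fun u => bern PI + (u - PI) ^ 2 / 4)); last first.
    move=> x; rewrite Rmin_left ?Rmax_right; try by have := PI_RGT_0; lra.
    by move=> hx; apply: bern_half_period0; lra.
  rewrite (@RInt_FTC (fun u => bern PI * u + (u - PI) ^ 3 / 12)) => [|x _|x _].
  - by toR; field.
  - by auto_derive => //; field.
  - by cts.
have PI0 := PI_RGT_0.
apply: (Rmult_eq_reg_r PI); last lra.
rewrite e0 in e1; lra.
Qed.

Lemma zeta2 : Series (fun i => / INR i.+1 ^ 2) = PI ^ 2 / 6.
Proof.
have h := @bern_half_period0 0; rewrite bern_PI in h.
have -> : PI ^ 2 / 6 = bern 0.
  rewrite h; last by have := PI_RGT_0; lra.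
  field.
by apply: Series_ext => n; rewrite Rmult_0_r cos_0 /Rdiv Rmult_1_l.
Qed.

Lemma cos_periodic (u : R) (n : nat) : cos (INR n * (u + 2 * PI)) = cos (INR n * u).
Proof.
have -> : INR n * (u + 2 * PI) = INR n * u + 2 * INR n * PI by ring.
exact: cos_period.
Qed.

Lemma bern_periodic (u : R) : bern (u + 2 * PI) = bern u.
Proof. by apply: Series_ext => n; rewrite cos_periodic. Qed.

Lemma bern_even (u : R) : bern (- u) = bern u.
Proof. by apply: Series_ext => n; rewrite -(cos_neg (_ * u)) Ropp_mult_distr_r. Qed.

Lemma bern_period (u : R) : 0 <= u <= 2 * PI -> bern u = PI ^ 2 / 6 - PI * u / 2 + u ^ 2 / 4.
Proof.
move=> hu; case: (Rle_dec u PI) => h.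
  by rewrite bern_half_period0 ?bern_PI; [field|lra].
have -> : u = - (2 * PI - u) + 2 * PI by ring.
rewrite bern_periodic bern_even bern_half_period0 ?bern_PI; last lra.
field.
Qed.

(** At each multiple of [2 PI] the slope of [bern] drops by [PI], from [PI / 2] to [- PI / 2], and
    between them the second derivative is the constant [1 / 2]. So [bern] is a single parabola minus
    [PI] times one hinge per multiple passed. *)
Lemma bern_formula (M : nat) (u : R) : 0 <= u <= 2 * PI * INR M.+1 ->
  bern u = PI ^ 2 / 6 - PI * u / 2 + u ^ 2 / 4
    - PI * \big[Rplus/0]_(1 <= m < M.+1) Rmax 0 (u - 2 * PI * INR m).
Proof.
have PI0 := PI_RGT_0.
elim: M u => [|M IH] u hu.
  rewrite big_nat_cond big_pred0; last by move=> i; lia.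
  by rewrite bern_period; [ring|move: hu => /=; lra].
case: (Rle_dec u (2 * PI)) => h.
  rewrite bern_period; last lra.
  rewrite big_nat_cond big1; first ring.
  move=> i /andP [/andP [i1 _] _].
  have : 1 <= INR i by apply: (le_INR 1); lia.
  move=> hi; apply: Rmax_left; nra.
rewrite big_ltn // Rmax_right; last by rewrite /=; lra.
rewrite big_add1 /=.
have {1}-> : u = (u - 2 * PI) + 2 * PI by ring.
rewrite bern_periodic (IH (u - 2 * PI)); last by rewrite (S_INR M.+1) in hu; lra.
have -> : \big[Rplus/0]_(1 <= i < M.+1) Rmax 0 (u - 2 * PI * INR i.+1) =
  \big[Rplus/0]_(1 <= m < M.+1) Rmax 0 (u - 2 * PI - 2 * PI * INR m).
  by apply: eq_bigr => i _; rewrite S_INR; congr (Rmax 0 _); ring.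
move: (\big[_/_]_(_ <= _ < _) _) => s; field.
Qed.

(** * Bessel functions: recurrence and integral representations *)

Lemma fact_factorial (n : nat) : fact n = n`!%N.
Proof. by elim: n => // n IH; rewrite factS -IH. Qed.

Lemma INR_fact_gt0 (n : nat) : 0 < INR (fact n).
Proof. exact: INR_fact_lt_0. Qed.

Lemma ex_series_exp (q : R) : ex_series (fun m => q ^ m / INR (fact m)).
Proof.
have := is_exp_Reals q; rewrite /is_pseries => h; exists (exp q).
by apply: is_series_ext h => m; rewrite pow_n_pow /scal /= /mult /=.
Qed.

Lemma fact_le (m n : nat) : (m <= n)%N -> INR (fact m) <= INR (fact n).
Proof. by move=> h; apply: le_INR; apply: Factorial.fact_le; lia. Qed.

Lemma pow_2mn (x : R) (m n : nat) : x ^ (2 * m + n) = (x ^ 2) ^ m * x ^ n.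
Proof. by rewrite -pow_mult -pow_add. Qed.

(** The majorant, common to the Bessel, sine and cosine series, is [Rabs x ^ n] times the series of
    [exp (x ^ 2)]. *)
Lemma ex_series_entire (a : nat -> R) (x : R) (n : nat) :
  (forall m, Rabs (a m) <= / INR (fact m)) ->
  ex_series (fun m => Rabs (a m) * Rabs x ^ (2 * m + n)).
Proof.
move=> ha.
have h := ex_series_scal_l (Rabs x ^ n) _ (ex_series_exp (Rabs x ^ 2)).
apply: ex_series_le h => m.
rewrite /norm /= /abs /= pow_2mn /scal /= /mult /=.
have h1 := pow_le (Rabs x) n (Rabs_pos x).
have h2 : 0 <= (Rabs x * (Rabs x * 1)) ^ m by apply: pow_le; have := Rabs_pos x; nra.
rewrite Rabs_right; last by apply: Rle_ge; apply: Rmult_le_pos; [exact: Rabs_pos|nra].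
have h3 := ha m.
have : 0 <= (Rabs x * (Rabs x * 1)) ^ m * Rabs x ^ n by nra.
rewrite /Rdiv; move: (Rabs x ^ n) (_ ^ m) (Rabs (a m)) (/ _) h1 h2 h3 => p q r s.
move=> *; have : r * (q * p) <= s * (q * p) by nra.
lra.
Qed.

Lemma Rabs_sgn_pow (m : nat) : Rabs ((-1) ^ m) = 1.
Proof. by rewrite -RPow_abs Rabs_Ropp Rabs_R1 pow1. Qed.

Lemma bessel_coef_le (n m : nat) :
  Rabs ((-1) ^ m / (INR (fact m) * INR (fact (m + n)))) <= / INR (fact m).
Proof.
have h1 := INR_fact_gt0 m; have h2 := INR_fact_gt0 (m + n).
have h3 : 1 <= INR (fact (m + n)) by apply: (@fact_le 0).
rewrite Rabs_mult Rabs_sgn_pow Rmult_1_l Rabs_right.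
  by apply: Rinv_le_contravar; nra.
by apply: Rle_ge; apply: Rlt_le; apply: Rinv_0_lt_compat; nra.
Qed.

Lemma ex_series_bessel (n : nat) (x : R) :
  ex_series (fun m => (-1) ^ m / (INR (fact m) * INR (fact (m + n)))
                   * (x / 2) ^ (2 * m + n)).
Proof.
apply: ex_series_Rabs.
apply: ex_series_ext (@ex_series_entire (fun m => (-1) ^ m / (INR (fact m) * INR (fact (m + n)))) (x / 2) n (bessel_coef_le n)).
by move=> m; rewrite [in RHS]Rabs_mult RPow_abs.
Qed.

Lemma besselJ_rec (n : nat) (x : R) : 0 < x ->
  besselJ n.+2 x = 2 * INR n.+1 / x * besselJ n.+1 x - besselJ n x.
Proof.
move=> x0; rewrite /besselJ -Series_scal_l -Series_minus; last first.
- exact: ex_series_bessel.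
- by apply: (ex_series_scal_l (V := R_NormedModule)); exact: ex_series_bessel.
(* The right side starts one power of [x] lower: its term at index 0 vanishes, and term [m + 1]
   there equals term [m] on the left. *)
rewrite [in RHS]Series_incr_1; last first.
  apply: (ex_series_minus (V := R_NormedModule)); last exact: ex_series_bessel.
  by apply: (ex_series_scal_l (V := R_NormedModule)); exact: ex_series_bessel.
have e0 : 2 * INR n.+1 / x * ((-1) ^ 0 / (INR (fact 0) * INR (fact (0 + n.+1))) * (x / 2) ^ (2 * 0 + n.+1))
   - (-1) ^ 0 / (INR (fact 0) * INR (fact (0 + n))) * (x / 2) ^ (2 * 0 + n) = 0.
  rewrite muln0 !add0n (_ : fact n.+1 = (n.+1 * fact n)%N) // (_ : INR (_ * _)%N = INR n.+1 * INR (fact n)); last exact: mult_INR.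
  have h1 := INRS_gt0 n; have h2 := INR_fact_gt0 n.
  rewrite -tech_pow_Rmult; move: (INR n.+1) (INR (fact n)) h1 h2 => a b a0 b0 /=.
  by field; lra.
rewrite e0 Rplus_0_l; apply: Series_ext => m.
have -> : (m + n.+2 = (m + n).+2)%N by lia.
have -> : (m.+1 + n.+1 = (m + n).+2)%N by lia.
have -> : (m.+1 + n = (m + n).+1)%N by lia.
have -> : (2 * m + n.+2 = (2 * m + n).+2)%N by lia.
have -> : (2 * m.+1 + n.+1 = (2 * m + n).+3)%N by lia.
have -> : (2 * m.+1 + n = (2 * m + n).+2)%N by lia.
have fS p : INR (fact p.+1) = INR p.+1 * INR (fact p) by rewrite -mult_INR.
rewrite !fS -!tech_pow_Rmult.
rewrite !S_INR (_ : INR (m + n)%N = INR m + INR n); last exact: plus_INR.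
have h1 := INR_fact_gt0 m; have h2 := INR_fact_gt0 (m + n).
have p1 := pos_INR m; have p2 := pos_INR n.
by field; lra.
Qed.

Definition cosint (M n : nat) : R := RInt (fun t => cos t ^ M * cos (INR n * t)) 0 PI.

Lemma cosint_ex (M n : nat) : ex_RInt (fun t => cos t ^ M * cos (INR n * t)) 0 PI.
Proof. by move: (INR n) => c; exint. Qed.

Lemma cosint_S0 (M : nat) : cosint M.+1 0 = cosint M 1.
Proof.
apply: RInt_ext => x _; rewrite /= Rmult_0_l cos_0 Rmult_1_l Rmult_1_r.
exact: Rmult_comm.
Qed.

Lemma cosint_SS (M n : nat) : cosint M.+1 n.+1 = (cosint M n + cosint M n.+2) / 2.
Proof.
have h := RInt_plus _ _ _ _ (cosint_ex M n) (cosint_ex M n.+2).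
rewrite -[cosint M n + _]h /Rdiv Rmult_comm.
have h2 := RInt_scal _ _ _ (/ 2) (ex_RInt_plus _ _ _ _ (cosint_ex M n) (cosint_ex M n.+2)).
rewrite -[/ 2 * _]h2.
apply: RInt_ext => x _.
rewrite /scal /= /mult /= /plus /=.
have -> : INR n.+2 * x = INR n.+1 * x + x by rewrite (S_INR n.+1); ring.
have -> : INR n * x = INR n.+1 * x - x by rewrite (S_INR n); ring.
rewrite cos_plus cos_minus -/(INR n.+1); toR; field.
Qed.

(** Orthogonality: [cos t ^ M] is a cosine polynomial of degree [M]. *)
Lemma cosint_lt (M n : nat) : (M < n)%N -> cosint M n = 0.
Proof.
elim: M n => [|M IH] [//|n] h.
  have n0 := INRS_gt0 n.
  rewrite /cosint (@RInt_FTC (fun t => sin (INR n.+1 * t) / INR n.+1)) => [|x _|x _].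
  - by rewrite sin_INR_PI Rmult_0_r sin_0 /Rdiv; toR; ring.
  - by move: (INR n.+1) n0 => c c0; auto_derive => //; field; lra.
  - by move: (INR n.+1) n0 => c c0; cts.
by rewrite cosint_SS !IH; [field|lia|lia].
Qed.

(** The product-to-sum recursion [cosint_SS] is Pascal's rule. At the border [n = 0] the symmetry of
    the binomial coefficients enters, at [j = 0] the vanishing [cosint_lt]. *)
Lemma cosint_val (M n j : nat) : (n + 2 * j = M)%N ->
  cosint M n = PI / 2 ^ M * INR 'C(M, j).
Proof.
have p2 m : 2 ^ m <> 0 by apply: pow_nonzero; lra.
elim: M n j => [|M IH] n j h.
  have [-> ->] : n = 0%N /\ j = 0%N by lia.
  rewrite /cosint (@RInt_FTC (fun t => t)) => [|x _|x _].
  - by rewrite bin0 /=; toR; field.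
  - by rewrite /= Rmult_0_l cos_0; auto_derive => //; ring.
  - by rewrite /=; cts.
case: n j h => [|n] [|j] h; try lia.
- rewrite cosint_S0 (IH 1%N j); last by lia.
  rewrite binS.
  have -> : 'C(M, j.+1) = 'C(M, j) by rewrite -[LHS]bin_sub; [congr ('C(_, _))|]; lia.
  by rewrite (_ : INR (_ + _)%N = INR 'C(M, j) + INR 'C(M, j)) /=; [field|exact: plus_INR].
- rewrite cosint_SS (IH n 0%N); last by lia.
  by rewrite cosint_lt; [rewrite !bin0 /=; field|lia].
- rewrite cosint_SS (IH n j.+1); last by lia.
  rewrite (IH n.+2 j); last by lia.
  rewrite binS (_ : INR (_ + _)%N = INR 'C(M, j.+1) + INR 'C(M, j)) /=; [by field|exact: plus_INR].
Qed.

Lemma is_series_sin (z : R) :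
  is_series (fun m => (-1) ^ m / INR (fact (2 * m + 1)) * z ^ (2 * m + 1)) (sin z).
Proof.
rewrite /sin; case: (exist_sin (Rsqr z)) => l hl.
have h : is_series (fun i => sin_n i * Rsqr z ^ i) l by apply/is_series_Reals.
have := is_series_scal_l z _ _ h.
rewrite /scal /= /mult /=; apply: is_series_ext => m.
change (z * ((-1) ^ m / INR (fact (2 * m + 1)) * Rsqr z ^ m) =
  (-1) ^ m / INR (fact (2 * m + 1)) * z ^ (2 * m + 1)).
rewrite pow_2mn pow_1 (_ : Rsqr z = z ^ 2); last by rewrite /Rsqr /=; ring.
ring.
Qed.

(** The odd-looking [2 * m + 0] matches the [2 * m + 1] of the sine series, so that
    [is_series_trig_cosint] treats both with a parameter [r]. *)
Lemma is_series_cos (z : R) :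
  is_series (fun m => (-1) ^ m / INR (fact (2 * m + 0)) * z ^ (2 * m + 0)) (cos z).
Proof.
rewrite /cos; case: (exist_cos (Rsqr z)) => l hl.
have h : is_series (fun i => cos_n i * Rsqr z ^ i) l by apply/is_series_Reals.
apply: is_series_ext h => m.
change ((-1) ^ m / INR (fact (2 * m)) * Rsqr z ^ m =
  (-1) ^ m / INR (fact (2 * m + 0)) * z ^ (2 * m + 0)).
rewrite pow_2mn addn0 (_ : Rsqr z = z ^ 2); last by rewrite /Rsqr /=; ring.
ring.
Qed.

Lemma is_series_trig_cosint (F : R -> R) (z : R) (r n : nat) :
  (forall z, is_series (fun m => (-1) ^ m / INR (fact (2 * m + r)) * z ^ (2 * m + r)) (F z)) ->
  is_series (fun m => (-1) ^ m / INR (fact (2 * m + r)) * z ^ (2 * m + r) * cosint (2 * m + r) n)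
    (RInt (fun t => cos (INR n * t) * F (z * cos t)) 0 PI).
Proof.
move=> hF.
pose f m t := (-1) ^ m / INR (fact (2 * m + r)) * z ^ (2 * m + r) * (cos t ^ (2 * m + r) * cos (INR n * t)).
pose M m := Rabs ((-1) ^ m / INR (fact (2 * m + r))) * Rabs z ^ (2 * m + r).
have hM : ex_series M.
  apply: ex_series_entire => m.
  have h1 := INR_fact_gt0 m; have h2 := INR_fact_gt0 (2 * m + r).
  rewrite Rabs_mult Rabs_sgn_pow Rmult_1_l Rabs_right.
    by apply: Rinv_le_contravar => //; apply: fact_le; lia.
  by apply: Rle_ge; apply: Rlt_le; apply: Rinv_0_lt_compat.
have hf m t : Rabs (f m t) <= M m.
  rewrite /f /M RPow_abs -Rabs_mult Rabs_mult (Rabs_mult (cos _ ^ _)) -RPow_abs.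
  have c1 : Rabs (cos t) <= 1 by apply: Rabs_le; apply: COS_bound.
  have c2 : Rabs (cos (INR n * t)) <= 1 by apply: Rabs_le; apply: COS_bound.
  have c3 : Rabs (cos t) ^ (2 * m + r) <= 1.
    by rewrite -(pow1 (2 * m + r)); apply: pow_incr; split => //; apply: Rabs_pos.
  have c4 : 0 <= Rabs (cos t) ^ (2 * m + r) by apply: pow_le; apply: Rabs_pos.
  rewrite -[X in _ <= X]Rmult_1_r; apply: Rmult_le_compat_l; first exact: Rabs_pos.
  have := Rabs_pos (cos (INR n * t)); nra.
have hc m t : continuous (f m) t.
  have hg (a b : R) (c : nat) : continuous (fun t => b * (cos t ^ c * cos (a * t))) t by cts.
  exact: hg.
have := @is_series_RInt f M 0 PI hf hM hc.
rewrite (_ : RInt (fun x => Series (fun m => f m x)) 0 PI = RInt (fun t => cos (INR n * t) * F (z * cos t)) 0 PI); last first.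
  apply: RInt_ext => t _; apply: is_series_unique.
  have := is_series_scal_l (cos (INR n * t)) _ _ (hF (z * cos t)).
  rewrite /scal /= /mult /=; apply: is_series_ext => m.
  rewrite /f Rpow_mult_distr /mult /=; toR; ring.
apply: is_series_ext => m.
exact: (RInt_scal _ _ _ _ (cosint_ex (2 * m + r) n)).
Qed.

Lemma besselJ_odd_int (j : nat) (z : R) :
  besselJ (2 * j + 1) z =
    (-1) ^ j / PI * RInt (fun t => cos (INR (2 * j + 1) * t) * sin (z * cos t)) 0 PI.
Proof.
have PI0 := PI_RGT_0.
have h := @is_series_trig_cosint _ z _ (2 * j + 1) is_series_sin.
(* The first [j] terms vanish by orthogonality; after the shift by [j], term [m] is [PI * (-1) ^ j]
   times term [m] of the Bessel series. *)
have h1 : is_series (fun m => (-1) ^ (j + m) / INR (fact (2 * (j + m) + 1)) * z ^ (2 * (j + m) + 1) * cosint (2 * (j + m) + 1) (2 * j + 1))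
    (RInt (fun t => cos (INR (2 * j + 1) * t) * sin (z * cos t)) 0 PI).
  case: j h => [//|j] h.
  apply: (is_series_incr_n (fun m => (-1) ^ m / INR (fact (2 * m + 1)) * z ^ (2 * m + 1) * cosint (2 * m + 1) (2 * j.+1 + 1))); first by lia.
  rewrite (_ : sum_n _ _ = 0); first by rewrite plus_zero_r.
  rewrite sum_n_big big1 // => i _.
  by rewrite cosint_lt ?Rmult_0_r //; case: i => /= i hi; lia.
have h2 := is_series_unique _ _ (is_series_scal_l ((-1) ^ j / PI) _ _ h1).
rewrite /scal /= /mult /= in h2; rewrite -h2.
apply: Series_ext => m; rewrite (@cosint_val _ _ m); last by lia.
have := @bin_fact (2 * (j + m) + 1) m _.
have -> : (2 * (j + m) + 1 - m = m + (2 * j + 1))%N by lia.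
have -> : (2 * (j + m) + 1 = 2 * m + (2 * j + 1))%N by lia.
rewrite -!fact_factorial => /(_ (ltac:(lia))) hb.
have {hb} hb : INR 'C(2 * m + (2 * j + 1), m) * (INR (fact m) * INR (fact (m + (2 * j + 1)))) = INR (fact (2 * m + (2 * j + 1))).
  by rewrite -hb -!mult_INR.
have f1 := INR_fact_gt0 m; have f2 := INR_fact_gt0 (m + (2 * j + 1)).
rewrite -hb.
have cb : INR 'C(2 * m + (2 * j + 1), m) <> 0.
  move=> e; have := INR_fact_gt0 (2 * m + (2 * j + 1)); rewrite -hb e; lra.
rewrite (pow_add (-1)) (_ : z / 2 = z * / 2) // Rpow_mult_distr pow_inv.
have s1 : (-1) ^ j * (-1) ^ j = 1 by rewrite -Rpow_mult_distr (_ : -1 * -1 = 1) ?pow1 //; lra.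
have p2 : 2 ^ (2 * m + (2 * j + 1)) <> 0 by apply: pow_nonzero; lra.
move: (INR 'C(_, _)) (INR (fact m)) (INR (fact (m + _))) f1 f2 cb (2 ^ _) p2 (z ^ _) => b u v u0 v0 b0 w w0 q.
rewrite /mult /=; toR.
transitivity (((-1) ^ j * (-1) ^ j) * ((-1) ^ m / (u * v) * (q * / w))); first by rewrite s1; ring.
by field; lra.
Qed.

(** Order 0 starts the induction of [besselJ_bound], which runs through all orders. *)
Lemma besselJ0_int (z : R) : besselJ 0 z = / PI * RInt (fun t => cos (z * cos t)) 0 PI.
Proof.
have PI0 := PI_RGT_0.
have h1 := @is_series_trig_cosint _ z _ 0 is_series_cos.
have h2 := is_series_unique _ _ (is_series_scal_l (/ PI) _ _ h1).
rewrite /scal /= /mult /= in h2.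
have -> : RInt (fun t => cos (z * cos t)) 0 PI = RInt (fun t => cos (0 * t) * cos (z * cos t)) 0 PI.
  by apply: RInt_ext => t _; rewrite Rmult_0_l cos_0 Rmult_1_l.
rewrite -h2.
apply: Series_ext => m; rewrite (@cosint_val _ _ m); last by lia.
have := @bin_fact (2 * m + 0) m _.
have -> : (2 * m + 0 - m = m + 0)%N by lia.
rewrite -!fact_factorial => /(_ (ltac:(lia))) hb.
have {hb} hb : INR 'C(2 * m + 0, m) * (INR (fact m) * INR (fact (m + 0))) = INR (fact (2 * m + 0)).
  by rewrite -hb -!mult_INR.
have f1 := INR_fact_gt0 m; have f2 := INR_fact_gt0 (m + 0).
rewrite -hb.
have cb : INR 'C(2 * m + 0, m) <> 0.
  move=> e; have := INR_fact_gt0 (2 * m + 0); rewrite -hb e; lra.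
rewrite (_ : z / 2 = z * / 2) // Rpow_mult_distr pow_inv.
have p2 : 2 ^ (2 * m + 0) <> 0 by apply: pow_nonzero; lra.
move: (INR 'C(_, _)) (INR (fact m)) (INR (fact (m + _))) f1 f2 cb (2 ^ _) p2 (z ^ _) => b u v u0 v0 b0 w w0 q.
by rewrite /mult /=; toR; field; lra.
Qed.

(** * Fresnel integrals *)

Lemma RInt_zero_is_derive (f : R -> R) (x : R) :
  (forall t, continuous f t) -> is_derive (fun u => RInt f 0 u : R) x (f x).
Proof.
move=> hf; apply: (is_derive_RInt (V := R_NormedModule) f (fun u => RInt f 0 u) 0 x) => //.
apply: filter_forall => b; apply: RInt_correct; exact: ex_RInt_cont.
Qed.

Lemma is_derive_RInt_smooth (f df : R -> R -> R) (a b x : R) :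
  (forall x t, is_derive (f^~ t) x (df x t)) ->
  (forall x t, continuity_2d_pt df x t) ->
  (forall x t, continuous (f x) t) ->
  is_derive (fun x => RInt (f x) a b : R) x (RInt (df x) a b).
Proof.
move=> hd hc hf.
have e y t : Derive (f^~ t) y = df y t by apply: is_derive_unique.
rewrite (RInt_ext (df x) (fun t => Derive (f^~ t) x)); last by move=> t _; rewrite e.
apply: (is_derive_RInt_param f a b x).
- by apply: filter_forall => y t _; exists (df y t).
- by move=> t _; apply: continuity_2d_pt_ext (hc x t) => u v; rewrite e.
- by apply: filter_forall => y; apply: ex_RInt_cont.
Qed.

(** The phase [c] covers the Fresnel cosine ([c = 0]) and sine ([c = - PI / 2]) integrals at once,
    together with the phases depending on [z] in the Bessel integrals; bounds have to be uniform in
    it. *)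
Definition fres (c x : R) : R := RInt (fun t => cos (t * t + c)) 0 x.

Lemma fres_continuous (c t : R) : continuous (fun t => cos (t * t + c)) t.
Proof. by cts. Qed.

Lemma is_derive_fres (c x : R) : is_derive (fres c) x (cos (x * x + c)).
Proof. by rewrite /fres; apply: (@RInt_zero_is_derive (fun t => cos (t * t + c))); exact: fres_continuous. Qed.

Lemma RInt_abs_le (f : R -> R) (a b M : R) : a <= b -> (forall x, continuous f x) ->
  (forall x, a <= x <= b -> Rabs (f x) <= M) -> Rabs (RInt f a b) <= (b - a) * M.
Proof. by move=> h1 h2 h3; apply: abs_RInt_le_const => //; apply: ex_RInt_cont. Qed.

Lemma Rabs_cos_le1 (x : R) : Rabs (cos x) <= 1.
Proof. by apply: Rabs_le; apply: COS_bound. Qed.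

Lemma Rabs_sin_le1 (x : R) : Rabs (sin x) <= 1.
Proof. by apply: Rabs_le; apply: SIN_bound. Qed.

Lemma fres_le (c x : R) : 0 <= x -> Rabs (fres c x) <= x.
Proof.
move=> x0; have := @RInt_abs_le (fun t => cos (t * t + c)) 0 x 1 x0 (@fres_continuous c) _.
rewrite Rminus_0_r Rmult_1_r; apply => t _; exact: Rabs_cos_le1.
Qed.

Lemma le_of_derive (f df : R -> R) (a b : R) : a <= b ->
  (forall x, a <= x <= b -> is_derive f x (df x)) ->
  (forall x, a <= x <= b -> 0 <= df x) -> f a <= f b.
Proof.
move=> hab hd hK.
case: (MVT_gen f a b df); rewrite (Rmin_left _ _ hab) (Rmax_right _ _ hab).
- by move=> x hx; apply: hd; lra.
- move=> x hx; apply/continuity_pt_filterlim.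
  by apply: ex_derive_cont; exists (df x); apply: hd.
by move=> c [hc e]; have := hK c hc; nra.
Qed.

(* Two integrations by parts: the derivative is [-3 cos (x^2 + c) / (4 x^4)]. *)
Definition fres_corr (c x : R) : R :=
  fres c x - sin (x * x + c) / (2 * x) + cos (x * x + c) / (4 * (x * x * x)).

(** The derivative of [fres_corr c] is at most [3 / (4 t ^ 4)] in absolute value, which is the
    derivative of [- 1 / (4 t ^ 3)]; so [e * fres_corr c t - 1 / (4 t ^ 3)] increases for both signs
    [e]. *)
Lemma fres_corr_cauchy (c x y : R) : 0 < x <= y ->
  Rabs (fres_corr c y - fres_corr c x) <= / (4 * (x * x * x)).
Proof.
move=> [x0 xy].
have d1 t : x <= t <= y -> is_derive (fres_corr c) t (- (3 * cos (t * t + c) / (4 * (t * t * t * t)))).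
  move=> ht; rewrite /fres_corr.
  have t3 : 4 * (t * t * t) <> 0 by apply: Rgt_not_eq; apply: Rmult_lt_0_compat; [lra|]; apply: Rmult_lt_0_compat; nra.
  auto_derive.
    by split; [exists (cos (t * t + c)); exact: is_derive_fres|split; [lra|split]].
  by rewrite (is_derive_unique _ _ _ (is_derive_fres c t)); field; lra.
have sgn e : (e = 1 \/ e = -1) -> e * fres_corr c x - / (4 * (x * x * x)) <= e * fres_corr c y - / (4 * (y * y * y)).
  move=> he.
  apply: (@le_of_derive (fun t => e * fres_corr c t - / (4 * (t * t * t)))
    (fun t => e * (- (3 * cos (t * t + c) / (4 * (t * t * t * t)))) + 3 / (4 * (t * t * t * t)))) => //.
  - move=> t ht.
    have t3 : 4 * (t * t * t) <> 0 by apply: Rgt_not_eq; apply: Rmult_lt_0_compat; [lra|]; apply: Rmult_lt_0_compat; nra.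
    auto_derive; first by split; [exists (- (3 * cos (t * t + c) / (4 * (t * t * t * t)))); exact: d1|split].
    by rewrite (is_derive_unique _ _ _ (d1 t ht)); field; lra.
  - move=> t ht; have := COS_bound (t * t + c).
    have : 0 < / (4 * (t * t * t * t)).
      have t2 : 0 < t * t by nra.
      apply: Rinv_0_lt_compat; nra.
    by case: he => ->; rewrite /Rdiv; nra.
have s1 := sgn 1 (or_introl erefl); have s2 := sgn (-1) (or_intror erefl).
have : 0 < / (4 * (y * y * y)).
  by apply: Rinv_0_lt_compat; apply: Rmult_lt_0_compat; [lra|]; apply: Rmult_lt_0_compat; nra.
by move=> ?; apply: Rabs_le; lra.
Qed.

Lemma fres_corr_dist (c x : R) : 0 < x ->
  Rabs (fres_corr c x - fres c x) <= / (2 * x) + / (4 * (x * x * x)).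
Proof.
move=> x0; rewrite /fres_corr.
have -> : forall a b d : R, a - b + d - a = - b + d by move=> *; ring.
apply: Rle_trans; first exact: Rabs_triang.
have p1 : 0 < / (2 * x) by apply: Rinv_0_lt_compat; lra.
have p2 : 0 < / (4 * (x * x * x)).
  by apply: Rinv_0_lt_compat; apply: Rmult_lt_0_compat; [lra|]; apply: Rmult_lt_0_compat; nra.
rewrite Rabs_Ropp /Rdiv !Rabs_mult (Rabs_right (/ (2 * x))) ?(Rabs_right (/ (4 * _))); try lra.
have := Rabs_cos_le1 (x * x + c); have := Rabs_sin_le1 (x * x + c); nra.
Qed.

Lemma fres_bounded (c x : R) : 0 <= x -> Rabs (fres c x) <= 3.
Proof.
(* Beyond 1, compare with [fres_corr] at [x] and at 1: the total is [3/4 + 1/4 + 3/4 + 1 < 3]. *)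
move=> x0; case: (Rle_dec x 1) => h; first by have := fres_le c x0; lra.
have x1 : 1 <= x by lra.
have h1 := @fres_corr_cauchy c 1 x (conj Rlt_0_1 x1).
have h2 := @fres_corr_dist c 1 Rlt_0_1.
have h3 := @fres_corr_dist c x (Rlt_le_trans _ _ _ Rlt_0_1 x1).
have h4 := @fres_le c 1 Rle_0_1.
have p1 : / (2 * x) <= / 2 by apply: Rinv_le_contravar; lra.
have p2 : / (4 * (x * x * x)) <= / 4.
  apply: Rinv_le_contravar; first lra.
  have : 1 <= x * x by nra.
  nra.
have e1 : / (4 * (1 * 1 * 1)) = / 4 by field.
have e2 : / (2 * 1) = / 2 by field.
rewrite e1 in h1 h2; rewrite e2 in h2.
have -> : fres c x = - (fres_corr c x - fres c x) + ((fres_corr c x - fres_corr c 1) + ((fres_corr c 1 - fres c 1) + fres c 1)) by ring.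
have t1 := Rabs_triang (- (fres_corr c x - fres c x)) ((fres_corr c x - fres_corr c 1) + ((fres_corr c 1 - fres c 1) + fres c 1)).
have t2 := Rabs_triang (fres_corr c x - fres_corr c 1) ((fres_corr c 1 - fres c 1) + fres c 1).
have t3 := Rabs_triang (fres_corr c 1 - fres c 1) (fres c 1).
rewrite Rabs_Ropp in t1; lra.
Qed.

Lemma fres_scale (c z u : R) : 0 < z ->
  RInt (fun t => cos (z * (t * t) + c)) 0 u = fres c (sqrt z * u) / sqrt z.
Proof.
move=> z0; have s0 := sqrt_lt_R0 _ z0; have ss := sqrt_sqrt _ (Rlt_le _ _ z0).
have h := RInt_comp_lin (fun t => cos (t * t + c)) (sqrt z) 0 0 u.
rewrite /fres -[in RHS](Rplus_0_r (sqrt z * u)).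
have -> : RInt (fun t => cos (t * t + c)) 0 (sqrt z * u + 0) =
  RInt (fun t => cos (t * t + c)) (sqrt z * 0 + 0) (sqrt z * u + 0).
  by rewrite Rmult_0_r (Rplus_0_r 0).
rewrite -h; last by exint.
have h2 := RInt_scal (fun t => cos (z * (t * t) + c)) 0 u (sqrt z).
rewrite [in RHS](RInt_ext _ (fun t => scal (sqrt z) (cos (z * (t * t) + c)))); last first.
  move=> t _.
  have -> // : (sqrt z * t + 0) * (sqrt z * t + 0) = z * (t * t).
  by rewrite -[z in RHS]ss; ring.
rewrite h2; last by exint.
by rewrite /scal /= /mult /=; toR; field; lra.
Qed.

(* Integrating by parts against the bounded function [fres]. *)
Lemma van_der_corput (g dg : R -> R) :
  (forall x, 0 <= x <= 1 -> is_derive g x (dg x)) ->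
  (forall x, 0 <= x <= 1 -> continuous dg x) ->
  exists K, 0 <= K /\ forall c z, 0 < z ->
    Rabs (RInt (fun t => g t * cos (z * (t * t) + c)) 0 1) <= K / sqrt z.
Proof.
move=> hd hc.
have [M [M0 hM]] := @continuous_bounded dg 0 1 Rle_0_1 hc.
exists (3 * (Rabs (g 1) + M)); split; first by have := Rabs_pos (g 1); lra.
move=> c z z0.
have s0 := sqrt_lt_R0 _ z0.
have i0 := Rinv_0_lt_compat _ s0.
pose F u := RInt (fun t => cos (z * (t * t) + c)) 0 u : R.
have Fb u : 0 <= u -> Rabs (F u) <= 3 / sqrt z.
  move=> u0; rewrite /F fres_scale // /Rdiv Rabs_mult (Rabs_right (/ _)); last lra.
  by have := @fres_bounded c (sqrt z * u); nra.
have hcc t : continuous (fun t => cos (z * (t * t) + c)) t by cts.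
rewrite (@RInt_by_parts F _ g dg); rewrite ?Rmin_left ?Rmax_right; try lra.
- have -> : F 0 = 0 by rewrite /F RInt_point.
  have F1 := Fb 1 Rle_0_1.
  have R1 : Rabs (RInt (fun x => dg x * F x) 0 1) <= (1 - 0) * (M * (3 / sqrt z)).
    apply: abs_RInt_le_const; first lra.
      apply: (ex_RInt_continuous (V := R_CompleteNormedModule)) => t; rewrite Rmin_left ?Rmax_right; try lra.
      move=> ht; apply: (continuous_mult (K := R_AbsRing)); first exact: hc.
      by apply: ex_derive_cont; exists (cos (z * (t * t) + c)); exact: RInt_zero_is_derive.
    move=> t ht; rewrite Rabs_mult.
    by apply: Rmult_le_compat; try exact: Rabs_pos; [exact: hM|apply: Fb; lra].
  have t1 := Rabs_triang (g 1 * F 1) (- RInt (fun x => dg x * F x) 0 1).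
  rewrite Rabs_Ropp Rabs_mult in t1.
  have -> : g 1 * F 1 - g 0 * 0 - RInt (fun x => dg x * F x) 0 1 = g 1 * F 1 + - RInt (fun x => dg x * F x) 0 1.
    by toR; ring.
  apply: Rle_trans t1 _.
  have : Rabs (g 1) * Rabs (F 1) <= Rabs (g 1) * (3 / sqrt z).
    by apply: Rmult_le_compat_l => //; exact: Rabs_pos.
  rewrite /Rdiv in R1 *; lra.
- by move=> x _; exact: RInt_zero_is_derive.
- by move=> x _; exact: hcc.
- exact: hd.
- exact: hc.
Qed.

(** * Fresnel integrals at infinity *)

Definition fsin (x : R) : R := RInt (fun t => sin (t * t)) 0 x.

Lemma fsin_fres (x : R) : fsin x = fres (- (PI / 2)) x.
Proof.
apply: RInt_ext => t _; rewrite cos_plus cos_neg sin_neg cos_PI2 sin_PI2.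
by toR; ring.
Qed.

Lemma RInt_lin (f g : R -> R) (p q a b : R) :
  (forall x, continuous f x) -> (forall x, continuous g x) ->
  RInt (fun x => p * f x + q * g x) a b = p * RInt f a b + q * RInt g a b.
Proof.
move=> hf hg; have ef := ex_RInt_cont a b hf; have eg := ex_RInt_cont a b hg.
have h1 := RInt_scal f a b p ef; have h2 := RInt_scal g a b q eg.
have := RInt_plus _ _ _ _ (ex_RInt_scal _ _ _ p ef) (ex_RInt_scal _ _ _ q eg).
by rewrite h1 h2.
Qed.

Lemma fres_split (c x : R) : fres c x = cos c * fres 0 x + - sin c * fsin x.
Proof.
rewrite /fres /fsin -(@RInt_lin (fun t => cos (t * t + 0)) (fun t => sin (t * t))); [|by move=> t; cts|by move=> t; cts].
by apply: RInt_ext => t _; rewrite cos_plus Rplus_0_r; toR; ring.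
Qed.

Lemma is_derive_fsin (x : R) : is_derive fsin x (sin (x * x)).
Proof. by rewrite /fsin; apply: (@RInt_zero_is_derive (fun t => sin (t * t))) => t; cts. Qed.

(* Integrating by parts with [1 - cos (t^2)], the boundary term and the new
   integrand are both nonnegative. *)
Lemma fsin_ge0 (x : R) : 0 < x -> 0 <= fsin x.
Proof.
move=> x0.
pose h t := fsin t - (1 - cos (t * t)) / (2 * t).
have dh t : 0 < t -> is_derive h t ((1 - cos (t * t)) / (2 * (t * t))).
  move=> t0; rewrite /h; auto_derive.
    by split; [exists (sin (t * t)); exact: is_derive_fsin|split => //; lra].
  by rewrite (is_derive_unique _ _ _ (is_derive_fsin t)); field; lra.
have hx : h x <= fsin x.
  rewrite /h; have := COS_bound (x * x) => ?.
  have : 0 <= (1 - cos (x * x)) / (2 * x) by apply: Rdiv_le_0_compat; lra.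
  lra.
apply: (Rle_trans _ (h x)) => //.
apply: le_epsilon => e e0.
(* The formula for [h] divides by zero at the origin, so monotonicity is applied from a small
   [t > 0], where [h t >= - 3 t / 2 >= - e]. *)
pose t := Rmin (e / 2) x.
have t0 : 0 < t by apply: Rmin_pos; lra.
have te : t <= e / 2 := Rmin_l _ _; have tx : t <= x := Rmin_r _ _.
have h1 : h t <= h x.
  apply: (le_of_derive tx (df := fun t => (1 - cos (t * t)) / (2 * (t * t)))).
    by move=> u hu; apply: dh; lra.
  move=> u hu; have := COS_bound (u * u) => ?.
  by apply: Rdiv_le_0_compat; [lra|nra].
have h2 : Rabs (fsin t) <= t by rewrite fsin_fres; apply: fres_le; lra.
have h3 : Rabs (- cos (t * t) - - cos 0) <= 1 * (t * t - 0).
  apply: (@mvt_bound (fun x => - cos x) sin); first nra.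
    by move=> u _; auto_derive => //; ring.
  by move=> u _; exact: Rabs_sin_le1.
rewrite cos_0 in h3.
have h4 : (1 - cos (t * t)) / (2 * t) <= t / 2.
  apply: (Rmult_le_reg_r (2 * t)); first lra.
  have -> : (1 - cos (t * t)) / (2 * t) * (2 * t) = 1 - cos (t * t) by field; lra.
  have := Rle_trans _ _ _ (Rle_abs _) h3; lra.
have h5 := Rle_abs (- fsin t); rewrite Rabs_Ropp in h5.
have h6 : h t = fsin t - (1 - cos (t * t)) / (2 * t) by [].
lra.
Qed.

Lemma derive0_const (f : R -> R) (a b : R) : a <= b ->
  (forall x, is_derive f x 0) -> f b = f a.
Proof.
move=> hab h.
have := @mvt_bound f (fun _ => 0) a b 0 hab (fun x _ => h x).
rewrite Rabs_R0 Rmult_0_l => /(_ (fun _ _ => Rle_refl 0)) h1.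
have := Rabs_pos (f b - f a) => ?.
have : f b - f a = 0 by apply: Rabs_eq_0; lra.
lra.
Qed.

Lemma continuity_2d_trig (F : R -> R) (x t : R) : continuity F ->
  continuity_2d_pt (fun x t => 2 * x * F (x * x * (1 + t * t))) x t.
Proof.
move=> hF; apply: continuity_2d_pt_mult.
  apply: continuity_2d_pt_mult; first exact: continuity_2d_pt_const.
  exact: continuity_2d_pt_id1.
apply: continuity_1d_2d_pt_comp; first exact: hF.
apply: continuity_2d_pt_mult.
  by apply: continuity_2d_pt_mult; exact: continuity_2d_pt_id1.
apply: continuity_2d_pt_plus; first exact: continuity_2d_pt_const.
by apply: continuity_2d_pt_mult; exact: continuity_2d_pt_id2.
Qed.

Lemma RInt_unit_scale (f : R -> R) (x : R) : (forall t, continuous f t) ->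
  RInt (fun t => x * f (x * t)) 0 1 = RInt f 0 x.
Proof.
move=> hf; have h := RInt_comp_lin f x 0 0 1.
rewrite Rmult_0_r Rmult_1_r !Rplus_0_r in h.
rewrite -h; last exact: ex_RInt_cont.
by apply: RInt_ext => t _; rewrite Rplus_0_r.
Qed.

(* The square of [int_0^x exp (i t^2) dt] differs from
   [- i int_0^1 exp (i x^2 (1 + t^2)) / (1 + t^2) dt] by the constant [i pi / 4]. *)
Lemma fres_square (x : R) : 0 <= x ->
  2 * fres 0 x * fsin x
    = PI / 4 - RInt (fun t => cos (x * x * (1 + t * t)) / (1 + t * t)) 0 1 /\
  fres 0 x * fres 0 x - fsin x * fsin x
    = RInt (fun t => sin (x * x * (1 + t * t)) / (1 + t * t)) 0 1.
Proof.
move=> x0.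
have pos t : 1 + t * t <> 0 by nra.
pose Gc x := RInt (fun t => cos (x * x * (1 + t * t)) / (1 + t * t)) 0 1 : R.
pose Gs x := RInt (fun t => sin (x * x * (1 + t * t)) / (1 + t * t)) 0 1 : R.
have dGc y : is_derive Gc y (RInt (fun t => 2 * y * - sin (y * y * (1 + t * t))) 0 1).
  apply: (@is_derive_RInt_smooth (fun x t => cos (x * x * (1 + t * t)) / (1 + t * t))
    (fun y t => 2 * y * - sin (y * y * (1 + t * t)))).
  - by move=> u t; auto_derive => //; field; exact: pos.
  - by move=> u t; apply: (@continuity_2d_trig (fun v => - sin v)) => v; apply: continuity_pt_opp; exact: continuity_sin.
  - by move=> u t; cts.
have dGs y : is_derive Gs y (RInt (fun t => 2 * y * cos (y * y * (1 + t * t))) 0 1).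
  apply: (@is_derive_RInt_smooth (fun x t => sin (x * x * (1 + t * t)) / (1 + t * t))
    (fun y t => 2 * y * cos (y * y * (1 + t * t)))).
  - by move=> u t; auto_derive => //; field; exact: pos.
  - by move=> u t; apply: continuity_2d_trig; exact: continuity_cos.
  - by move=> u t; cts.
(* Rescaling turns the derivatives of [Gc] and [Gs] into integrals of [F (y ^ 2 + t ^ 2)] over
   [[0, y]]; by the addition formulas these cancel the derivatives of the products of [fres 0] and
   [fsin]. *)
have sc (F : R -> R) y : (forall v, continuous F v) ->
    RInt (fun t => 2 * y * F (y * y * (1 + t * t))) 0 1 = 2 * RInt (fun t => F (y * y + t * t)) 0 y.
  move=> hF.
  have hc t : continuous (fun t => F (y * y + t * t)) t.
    by apply: (continuous_comp (fun t => y * y + t * t) F); [cts|exact: hF].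
  rewrite -(RInt_unit_scale y hc).
  have := RInt_scal (fun t => y * F (y * y + y * t * (y * t))) 0 1 2.
  rewrite /scal /= /mult /= => <-.
    apply: RInt_ext => t _; rewrite /mult /=.
    have -> : y * y * (1 + t * t) = y * y + y * t * (y * t) by ring.
    by toR; ring.
  apply: ex_RInt_cont => t; apply: (continuous_mult (K := R_AbsRing)); first exact: continuous_const.
  by apply: (continuous_comp (fun t => y * t) (fun t => F (y * y + t * t))); [cts|exact: hc].
have e1 y : RInt (fun t => - sin (y * y + t * t)) 0 y = - sin (y * y) * fres 0 y + - cos (y * y) * fsin y.
  rewrite /fres /fsin -(@RInt_lin (fun t => cos (t * t + 0)) (fun t => sin (t * t))); [|by move=> t; cts|by move=> t; cts].
  by apply: RInt_ext => t _; rewrite sin_plus Rplus_0_r; toR; ring.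
have e2 y : RInt (fun t => cos (y * y + t * t)) 0 y = cos (y * y) * fres 0 y + - sin (y * y) * fsin y.
  rewrite /fres /fsin -(@RInt_lin (fun t => cos (t * t + 0)) (fun t => sin (t * t))); [|by move=> t; cts|by move=> t; cts].
  by apply: RInt_ext => t _; rewrite cos_plus Rplus_0_r; toR; ring.
have z0 f : RInt f 0 0 = 0 :> R by rewrite RInt_point.
have exf y : ex_derive (fres 0) y by exists (cos (y * y + 0)); exact: is_derive_fres.
have exs y : ex_derive fsin y by exists (sin (y * y)); exact: is_derive_fsin.
have f00 : fres 0 0 = 0 by apply: z0.
have s00 : fsin 0 = 0 by apply: z0.
split.
- have h : 2 * fres 0 x * fsin x + Gc x = 2 * fres 0 0 * fsin 0 + Gc 0.
    apply: (@derive0_const (fun y => 2 * fres 0 y * fsin y + Gc y)) => // y.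
    have hG : ex_derive Gc y by eexists; exact: dGc.
    auto_derive; first by repeat split.
    rewrite (is_derive_unique _ _ _ (is_derive_fres 0 y)) (is_derive_unique _ _ _ (is_derive_fsin y)) (is_derive_unique _ _ _ (dGc y)).
    rewrite (sc (fun v => - sin v)); last by move=> v; cts.
    by rewrite e1 Rplus_0_r; toR; ring.
  have g0 : Gc 0 = PI / 4.
    rewrite /Gc (@RInt_FTC atan) => [|t _|t _].
    - by rewrite atan_1 atan_0; toR; ring.
    - by auto_derive => //; rewrite !Rmult_0_l cos_0; field; exact: pos.
    - by cts.
  rewrite f00 s00 g0 in h; rewrite -/(Gc x); lra.
- have h : fres 0 x * fres 0 x - fsin x * fsin x - Gs x = fres 0 0 * fres 0 0 - fsin 0 * fsin 0 - Gs 0.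
    apply: (@derive0_const (fun y => fres 0 y * fres 0 y - fsin y * fsin y - Gs y)) => // y.
    have hG : ex_derive Gs y by eexists; exact: dGs.
    auto_derive; first by repeat split.
    rewrite (is_derive_unique _ _ _ (is_derive_fres 0 y)) (is_derive_unique _ _ _ (is_derive_fsin y)) (is_derive_unique _ _ _ (dGs y)).
    rewrite (sc cos); last by move=> v; cts.
    by rewrite e2 Rplus_0_r; toR; ring.
  have g0 : Gs 0 = 0.
    rewrite /Gs (@RInt_FTC (fun _ => 0)) => [|t _|t _].
    - by toR; ring.
    - by auto_derive => //; rewrite !Rmult_0_l sin_0; field; exact: pos.
    - by cts.
  rewrite f00 s00 g0 in h; rewrite -/(Gs x); lra.
Qed.

(** A perturbation of [2 C S = PI / 4], [C ^ 2 = S ^ 2], whose solutions are [C = S] equal to plus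
    or minus [sqrt (PI / 8)]; [0 <= S] selects the sign. As [a = C + S] exceeds 1, dividing
    [(C - S) * a = Q] by it bounds [C - S], and then [a ^ 2 = (C - S) ^ 2 + 4 C S] determines
    [a]. *)
Lemma fres_limit_alg (C S P Q d : R) : 0 <= S -> 0 <= d -> d <= / 8 ->
  - d <= P <= d -> - d <= Q <= d -> 2 * C * S = PI / 4 - P -> C * C - S * S = Q ->
  Rabs (C - sqrt (PI / 8)) <= 4 * d /\ Rabs (S - sqrt (PI / 8)) <= 4 * d.
Proof.
move=> S0 d1 d0 hP hQ h1 h2.
have PI3 : 3 < PI by have := PI2_3_2; lra.
have PI4 := PI_4.
set k := sqrt (PI / 8).
have k0 : 0 < k by apply: sqrt_lt_R0; lra.
have kk : k * k = PI / 8 by apply: sqrt_sqrt; lra.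
have C0 : 0 < C.
  case: (Rlt_dec 0 C) => // hC; have : C * S <= 0 by nra.
  lra.
pose a := C + S.
have aa : a * a = (C - S) * (C - S) + 2 * (2 * C * S) by rewrite /a; ring.
have sq : 0 <= (C - S) * (C - S) by exact: Rle_0_sqr.
have a1 : 1 < a.
  case: (Rlt_dec 1 a) => // ha.
  have a0 : 0 < a by rewrite /a; lra.
  have : a * a <= 1 by nra.
  lra.
have hQa : (C - S) * a = Q by rewrite /a -h2; ring.
have dd : Rabs (C - S) <= d.
  by apply: Rabs_le; split; apply: Rnot_lt_le => hlt; nra.
have {}dd := proj1 (Rabs_le_between _ _) dd.
have ak : Rabs (a - 2 * k) <= 3 * d.
  have : (a - 2 * k) * (a + 2 * k) = (C - S) * (C - S) - 2 * P.
    transitivity (a * a - 4 * (k * k)); first ring.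
    rewrite aa kk h1; field.
  have : (C - S) * (C - S) <= d by nra.
  by move=> ? ?; apply: Rabs_le; split; apply: Rnot_lt_le => hlt; nra.
have {}ak := proj1 (Rabs_le_between _ _) ak.
by rewrite /a in ak; split; apply: Rabs_le; lra.
Qed.

Lemma fres_limit : exists K X, 0 < X /\ 0 <= K /\ forall x, X <= x ->
  Rabs (fres 0 x - sqrt (PI / 8)) <= K / x /\ Rabs (fsin x - sqrt (PI / 8)) <= K / x.
Proof.
have [K [K0 hK]] : exists K, 0 <= K /\ forall c z, 0 < z ->
    Rabs (RInt (fun t => / (1 + t * t) * cos (z * (t * t) + c)) 0 1) <= K / sqrt z.
  apply: (@van_der_corput (fun t => / (1 + t * t)) (fun t => - (2 * t) / ((1 + t * t) * (1 + t * t)))) => x _.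
    by auto_derive; [nra|field; nra].
  by cts; nra.
(* The threshold [8 * K + 1] gives [K / x <= / 8], as [fres_limit_alg] requires. *)
exists (4 * K), (8 * K + 1); split; first lra; split; first lra.
move=> x hx.
have x0 : 0 < x by lra.
have [h1 h2] := fres_square (Rlt_le _ _ x0).
have s2 : sqrt (x * x) = x by apply: sqrt_square; lra.
have hc : Rabs (RInt (fun t => cos (x * x * (1 + t * t)) / (1 + t * t)) 0 1) <= K / x.
  have := hK (x * x) (x * x) (Rmult_lt_0_compat _ _ x0 x0); rewrite s2.
  rewrite (RInt_ext _ (fun t => cos (x * x * (1 + t * t)) / (1 + t * t))) //.
  move=> t _; rewrite /Rdiv Rmult_comm; congr (cos _ * _); ring.
have hs : Rabs (RInt (fun t => sin (x * x * (1 + t * t)) / (1 + t * t)) 0 1) <= K / x.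
  have := hK (x * x - PI / 2) (x * x) (Rmult_lt_0_compat _ _ x0 x0); rewrite s2.
  rewrite (RInt_ext _ (fun t => sin (x * x * (1 + t * t)) / (1 + t * t))) //.
  move=> t _; rewrite /Rdiv Rmult_comm -cos_shift -cos_neg; congr (cos _ * _).
  rewrite /Rdiv; ring.
have S0 := fsin_ge0 x0.
have d0 : K / x <= / 8.
  apply: (Rmult_le_reg_r (8 * x)); first lra.
  have -> : K / x * (8 * x) = 8 * K by field; lra.
  have -> : / 8 * (8 * x) = x by field.
  lra.
have d1 : 0 <= K / x by apply: Rdiv_le_0_compat.
have e4 : 4 * K / x = 4 * (K / x) by rewrite /Rdiv; ring.
rewrite e4.
exact: (fres_limit_alg S0 d1 d0 (proj1 (Rabs_le_between _ _) hc) (proj1 (Rabs_le_between _ _) hs) h1 h2).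
Qed.

(** Letting [y] tend to infinity in [fres_corr_cauchy] identifies the limit of [fres_corr c] with an
    error [/ (4 x ^ 3)]; discarding the last term of [fres_corr] costs the same again. *)
Lemma fres_asym (c x : R) : 0 < x ->
  Rabs (fres c x - sqrt (PI / 8) * (cos c - sin c) - sin (x * x + c) / (2 * x))
    <= / (2 * (x * x * x)).
Proof.
move=> x0.
have [K [X [X0 [K0 hK]]]] := fres_limit.
have x3 : 0 < x * x * x by apply: Rmult_lt_0_compat; nra.
have main : Rabs (fres_corr c x - sqrt (PI / 8) * (cos c - sin c)) <= / (4 * (x * x * x)).
  apply: le_epsilon => e e0.
  (* The last entry makes the error at [y], at most [(2 * K + 1) / y], smaller than [e]. *)
  pose y := Rmax (Rmax x X) (Rmax 1 ((2 * K + 1) / e)).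
  have yx : x <= y by apply: Rle_trans (Rmax_l _ _); exact: Rmax_l.
  have yX : X <= y by apply: Rle_trans (Rmax_l _ _); exact: Rmax_r.
  have y1 : 1 <= y by apply: Rle_trans (Rmax_r _ _); exact: Rmax_l.
  have ye : (2 * K + 1) / e <= y by apply: Rle_trans (Rmax_r _ _); exact: Rmax_r.
  have [hC hS] := hK y yX.
  have h1 := @fres_corr_cauchy c x y (conj x0 yx).
  have y0 : 0 < y by lra.
  have h2 := fres_corr_dist c y0.
  have h3 : Rabs (fres c y - sqrt (PI / 8) * (cos c - sin c)) <= 2 * (K / y).
    rewrite fres_split.
    have -> : cos c * fres 0 y + - sin c * fsin y - sqrt (PI / 8) * (cos c - sin c) =
      cos c * (fres 0 y - sqrt (PI / 8)) + - sin c * (fsin y - sqrt (PI / 8)) by ring.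
    apply: Rle_trans; first exact: Rabs_triang.
    rewrite !Rabs_mult Rabs_Ropp.
    have := Rabs_cos_le1 c; have := Rabs_sin_le1 c; have := Rabs_pos (cos c); have := Rabs_pos (sin c).
    by have := Rabs_pos (fres 0 y - sqrt (PI / 8)); have := Rabs_pos (fsin y - sqrt (PI / 8)); nra.
  have h4 : / (2 * y) + / (4 * (y * y * y)) <= / y.
    have iy : 0 < / y by apply: Rinv_0_lt_compat.
    have iy1 : / y <= 1 by rewrite -Rinv_1; apply: Rinv_le_contravar; lra.
    have -> : / (2 * y) + / (4 * (y * y * y)) = / y / 2 + / y * (/ y * / y) / 4 by field; lra.
    have : / y * / y <= 1 by nra.
    nra.
  have h5 : 2 * (K / y) + / y <= e.
    have -> : 2 * (K / y) + / y = (2 * K + 1) / y by field; lra.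
    apply: (Rmult_le_reg_r y) => //.
    have -> : (2 * K + 1) / y * y = (2 * K + 1) / e * e by field; lra.
    nra.
  have -> : fres_corr c x - sqrt (PI / 8) * (cos c - sin c) =
    - (fres_corr c y - fres_corr c x) + ((fres_corr c y - fres c y) + (fres c y - sqrt (PI / 8) * (cos c - sin c))) by ring.
  have t1 := Rabs_triang (- (fres_corr c y - fres_corr c x)) ((fres_corr c y - fres c y) + (fres c y - sqrt (PI / 8) * (cos c - sin c))).
  have t2 := Rabs_triang (fres_corr c y - fres c y) (fres c y - sqrt (PI / 8) * (cos c - sin c)).
  rewrite Rabs_Ropp in t1; lra.
have -> : fres c x - sqrt (PI / 8) * (cos c - sin c) - sin (x * x + c) / (2 * x) =
  (fres_corr c x - sqrt (PI / 8) * (cos c - sin c)) + - (cos (x * x + c) / (4 * (x * x * x))).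
  by rewrite /fres_corr; ring.
apply: Rle_trans; first exact: Rabs_triang.
have i0 : 0 < / (4 * (x * x * x)) by apply: Rinv_0_lt_compat; lra.
rewrite Rabs_Ropp /Rdiv Rabs_mult (Rabs_right (/ (4 * _))); last lra.
have -> : / (2 * (x * x * x)) = / (4 * (x * x * x)) + / (4 * (x * x * x)) by field; lra.
by have := Rabs_cos_le1 (x * x + c); nra.
Qed.

(** * Asymptotics of Bessel functions of odd order *)

Lemma RInt_reflect (f : R -> R) : (forall t, continuous f t) ->
  (forall t, f (PI - t) = f t) -> RInt f 0 PI = 2 * RInt f 0 (PI / 2).
Proof.
move=> hf hs.
have h1 := RInt_Chasles f 0 (PI / 2) PI (ex_RInt_cont 0 (PI / 2) hf) (ex_RInt_cont (PI / 2) PI hf).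
have h2 := RInt_comp_lin f (-1) PI (PI / 2) 0 (ex_RInt_cont _ _ hf).
have e1 : -1 * (PI / 2) + PI = PI / 2 by field.
have e2 : -1 * 0 + PI = PI by ring.
rewrite e1 e2 in h2.
rewrite -h1 -h2.
rewrite (RInt_ext (fun y => scal (-1) (f (-1 * y + PI))) (fun y => scal (-1) (f y))); last first.
  by move=> t _; rewrite -(hs t) (_ : -1 * t + PI = PI - t) //; ring.
rewrite RInt_scal; last exact: ex_RInt_cont.
have h3 := opp_RInt_swap f 0 (PI / 2) (ex_RInt_cont 0 (PI / 2) hf).
rewrite -h3 /plus /scal /= /mult /= /opp /=.
by toR; ring.
Qed.

Lemma cos_odd_reflect (j : nat) (t : R) :
  cos (INR (2 * j + 1) * (PI - t)) = - cos (INR (2 * j + 1) * t).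
Proof.
have -> : INR (2 * j + 1) * (PI - t) = (PI - INR (2 * j + 1) * t) + 2 * INR j * PI.
  rewrite (_ : INR (2 * j + 1) = 2 * INR j + 1); first ring.
  by rewrite -[(2 * j + 1)%N]/((2 * j)%coq_nat + 1)%coq_nat plus_INR mult_INR.
rewrite cos_period cos_minus cos_PI sin_PI; ring.
Qed.

Lemma besselJ_odd_half (j : nat) (z : R) :
  besselJ (2 * j + 1) z = (-1) ^ j * (2 / PI) *
    RInt (fun t => cos (INR (2 * j + 1) * t) * sin (z * cos t)) 0 (PI / 2).
Proof.
have PI0 := PI_RGT_0.
rewrite besselJ_odd_int RInt_reflect.
- by toR; field; lra.
- by move=> t; move: (INR _) => c; cts.
move=> t; rewrite cos_odd_reflect cos_minus cos_PI sin_PI.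
have -> : z * (-1 * cos t + 0 * sin t) = - (z * cos t) by ring.
rewrite sin_neg; ring.
Qed.

Lemma besselJ_odd_le1 (j : nat) (z : R) : Rabs (besselJ (2 * j + 1) z) <= 1.
Proof.
have PI0 := PI_RGT_0.
rewrite besselJ_odd_int Rabs_mult /Rdiv Rabs_mult Rabs_sgn_pow.
have h : Rabs (RInt (fun t => cos (INR (2 * j + 1) * t) * sin (z * cos t)) 0 PI) <= (PI - 0) * 1.
  apply: RInt_abs_le; first lra.
    by move=> t; move: (INR _) => c; cts.
  move=> t _; rewrite Rabs_mult.
  have := Rabs_cos_le1 (INR (2 * j + 1) * t); have := Rabs_sin_le1 (z * cos t).
  by have := Rabs_pos (cos (INR (2 * j + 1) * t)); have := Rabs_pos (sin (z * cos t)); nra.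
have i0 := Rinv_0_lt_compat _ PI0.
rewrite Rabs_right; last lra.
apply: (Rle_trans _ (1 * / PI * ((PI - 0) * 1))).
  by apply: Rmult_le_compat_l => //; lra.
by right; field; lra.
Qed.

(* The substitution [u = sqrt 2 * sin (t / 2)], under which [cos t = 1 - u^2]. *)
Lemma RInt_cos_subst (F : R -> R) : (forall x, continuous F x) ->
  RInt (fun t => F (cos t)) 0 (PI / 2) = RInt (fun u => 2 / sqrt (2 - u * u) * F (1 - u * u)) 0 1.
Proof.
move=> hF; have PI0 := PI_RGT_0.
have s2 : sqrt 2 * sqrt 2 = 2 by apply: sqrt_sqrt; lra.
have s0 : 0 < sqrt 2 by apply: sqrt_lt_R0; lra.
pose f u := 2 / sqrt (2 - u * u) * F (1 - u * u).
pose g t := sqrt 2 * sin (t / 2).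
pose dg t := sqrt 2 * cos (t / 2) / 2.
have e0 : g 0 = 0 by rewrite /g /Rdiv Rmult_0_l sin_0 Rmult_0_r.
have e1 : g (PI / 2) = 1.
  rewrite /g (_ : PI / 2 / 2 = PI / 4); last by field.
  by rewrite sin_PI4; field; lra.
have hg t : 0 <= t <= PI / 2 -> 2 - g t * g t = 2 * (cos (t / 2) * cos (t / 2)) /\ 0 < cos (t / 2).
  move=> ht; split; last by apply: cos_gt_0; lra.
  rewrite /g; have := sin2_cos2 (t / 2); rewrite /Rsqr => hsc.
  transitivity (2 - (sqrt 2 * sqrt 2) * (sin (t / 2) * sin (t / 2))); first ring.
  by rewrite s2; nra.
have := RInt_comp f g dg 0 (PI / 2); rewrite e0 e1 Rmin_left ?Rmax_right; try lra.
move=> <-; last first.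
- move=> t ht; split; last by rewrite /dg; cts.
  rewrite /g /dg; by move: (sqrt 2) => s; auto_derive => //; rewrite /Rdiv; field.
- move=> t ht; have [h1 h2] := hg t ht.
  have h3 : 0 < 2 - g t * g t by rewrite h1; nra.
  rewrite /f; apply: (continuous_mult (K := R_AbsRing)).
    have h4 := sqrt_lt_R0 _ h3; rewrite /Rminus in h3 h4.
    by cts; repeat split; lra.
  by apply: (continuous_comp (fun u => 1 - u * u) F); [cts|exact: hF].
apply: RInt_ext => t; rewrite Rmin_left ?Rmax_right; try lra.
move=> ht; have [h1 h2] := hg t (conj (Rlt_le _ _ (proj1 ht)) (Rlt_le _ _ (proj2 ht))).
have hc : 1 - g t * g t = cos t.
  transitivity (cos (2 * (t / 2))); last by congr (cos _); field.
  by rewrite cos_2a_cos; lra.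
rewrite /f hc h1 sqrt_mult; [|lra|nra].
rewrite sqrt_square; last lra.
rewrite /scal /= /mult /= /dg; toR.
have -> : sqrt 2 * cos (t / 2) / 2 * (2 / (sqrt 2 * cos (t / 2)) * F (cos t)) = F (cos t); last by [].
by field; lra.
Qed.

(** [kern_b] comes from rationalising: [sqrt 2 - sqrt (2 - u * u) = u ^ 2 * kern_b u]. The
    derivatives of [kern_a] and [kern_b] are polynomials in [u], [kern_a] and [kern_b], so the
    higher derivatives below are verified by [ring]. *)
Definition kern_a (u : R) : R := / sqrt (2 - u * u).
Definition kern_b (u : R) : R := / (sqrt (2 - u * u) + sqrt 2).

Lemma is_derive_kern_a (u : R) : 0 <= u <= 1 -> is_derive kern_a u (u * kern_a u ^ 3).
Proof.
move=> hu; have h : 0 < 2 - u * u by nra.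
have s0 := sqrt_lt_R0 _ h.
rewrite /kern_a /Rminus in s0 h *; auto_derive; first by repeat split; lra.
by field; lra.
Qed.

Lemma is_derive_kern_b (u : R) : 0 <= u <= 1 -> is_derive kern_b u (u * kern_a u * kern_b u ^ 2).
Proof.
move=> hu; have h : 0 < 2 - u * u by nra.
have s0 := sqrt_lt_R0 _ h; have s2 : 0 < sqrt 2 by apply: sqrt_lt_R0; lra.
rewrite /kern_a /kern_b /Rminus in s0 h *; auto_derive; first by repeat split; lra.
by field; lra.
Qed.

(* [(g u - g 0) / u] for the amplitude [g u = 2 (1 - u^2) / sqrt (2 - u^2)] of [J_1]. *)
Definition kern_q (u : R) : R := - u * ((2 + sqrt 2 * kern_a u) * kern_b u).

(** [u * kern_r u] is the derivative of [(2 + sqrt 2 * kern_a u) * kern_b u]. The next two functions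
    are the first and second derivatives of [kern_q]; the second is what [van_der_corput] asks for
    when its amplitude is [kern_q1]. *)
Definition kern_r (u : R) : R :=
  sqrt 2 * kern_a u ^ 3 * kern_b u + (2 + sqrt 2 * kern_a u) * kern_a u * kern_b u ^ 2.

Definition kern_q1 (u : R) : R := - ((2 + sqrt 2 * kern_a u) * kern_b u) - u ^ 2 * kern_r u.

Definition kern_q2 (u : R) : R :=
  - (3 * u * kern_r u) - u ^ 3 * (3 * sqrt 2 * kern_a u ^ 5 * kern_b u
    + 2 * sqrt 2 * kern_a u ^ 4 * kern_b u ^ 2
    + (2 + sqrt 2 * kern_a u) * kern_a u ^ 3 * kern_b u ^ 2
    + 2 * (2 + sqrt 2 * kern_a u) * kern_a u ^ 2 * kern_b u ^ 3).

Lemma ex_derive_kern (u : R) : 0 <= u <= 1 -> ex_derive kern_a u /\ ex_derive kern_b u.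
Proof. by move=> h; split; eexists; [exact: is_derive_kern_a|exact: is_derive_kern_b]. Qed.

Lemma is_derive_kern_q (u : R) : 0 <= u <= 1 -> is_derive kern_q u (kern_q1 u).
Proof.
move=> hu; have [ea eb] := ex_derive_kern hu.
rewrite /kern_q /kern_q1 /kern_r; auto_derive; first by repeat split.
rewrite (is_derive_unique _ _ _ (is_derive_kern_a hu)) (is_derive_unique _ _ _ (is_derive_kern_b hu)).
ring.
Qed.

Lemma is_derive_kern_q1 (u : R) : 0 <= u <= 1 -> is_derive kern_q1 u (kern_q2 u).
Proof.
move=> hu; have [ea eb] := ex_derive_kern hu.
rewrite /kern_q1 /kern_q2 /kern_r; auto_derive; first by repeat split.
rewrite (is_derive_unique _ _ _ (is_derive_kern_a hu)) (is_derive_unique _ _ _ (is_derive_kern_b hu)).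
ring.
Qed.

Lemma continuous_kern_q2 (u : R) : 0 <= u <= 1 -> continuous kern_q2 u.
Proof.
by move=> hu; have [ea eb] := ex_derive_kern hu; rewrite /kern_q2 /kern_r; cts; repeat split.
Qed.

(** The constant [sqrt 2] leaves a pure Fresnel integral, and the factor [u] in the rest makes
    [u * cos (z * u ^ 2 + c)] an exact derivative, so that integration by parts gains [1 / z]. *)
Lemma kern_q_amplitude (u : R) : 0 <= u <= 1 ->
  2 / sqrt (2 - u * u) * (1 - u * u) = sqrt 2 + u * kern_q u.
Proof.
move=> hu; have h : 0 < 2 - u * u by nra.
have s0 := sqrt_lt_R0 _ h; have s2 : 0 < sqrt 2 by apply: sqrt_lt_R0; lra.
rewrite /kern_q /kern_a /kern_b.
have e1 := sqrt_sqrt _ (Rlt_le _ _ h); have e2 : sqrt 2 * sqrt 2 = 2 by apply: sqrt_sqrt; lra.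
move: (sqrt (2 - u * u)) s0 e1 => w w0 e1; move: (sqrt 2) s2 e2 => s s1 e2.
have uu : u * u = s * s - w * w by lra.
have -> : 1 - u * u = w * w - s * s / 2 by lra.
have -> : s + u * (- u * ((2 + s * / w) * / (w + s))) = s - (u * u) * ((2 + s * / w) * / (w + s)) by ring.
by rewrite uu; field; lra.
Qed.

Lemma besselJ0_bound : exists K, 0 <= K /\ forall z, 0 < z -> Rabs (besselJ 0 z) <= K / sqrt z.
Proof.
have PI0 := PI_RGT_0.
have [K [K0 hK]] : exists K, 0 <= K /\ forall c z, 0 < z ->
    Rabs (RInt (fun t => 2 * kern_a t * cos (z * (t * t) + c)) 0 1) <= K / sqrt z.
  apply: (@van_der_corput (fun u => 2 * kern_a u) (fun u => 2 * (u * kern_a u ^ 3))) => x hx;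
    have [ea eb] := ex_derive_kern hx.
    by auto_derive => //; rewrite (is_derive_unique _ _ _ (is_derive_kern_a hx)); ring.
  by cts.
exists (2 / PI * K); have p0 : 0 < 2 / PI by apply: Rdiv_lt_0_compat; lra.
split; first by apply: Rmult_le_pos; lra.
move=> z z0.
have -> : besselJ 0 z = 2 / PI * RInt (fun t => 2 * kern_a t * cos (z * (t * t) + - z)) 0 1.
  rewrite besselJ0_int RInt_reflect => [|t|t].
  - rewrite (@RInt_cos_subst (fun v => cos (z * v))); last by move=> x; cts.
    rewrite (RInt_ext _ (fun t => 2 * kern_a t * cos (z * (t * t) + - z))); first by toR; field; lra.
    move=> t _; rewrite -(cos_neg (z * (1 - _))) /kern_a; congr (_ * _ * cos _); ring.
  - by cts.
  - by rewrite cos_minus cos_PI sin_PI -cos_neg; congr (cos _); ring.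
rewrite Rabs_mult Rabs_right; last lra.
have := hK (- z) z z0; rewrite /Rdiv; nra.
Qed.

Lemma besselJ1_asym : exists K, 0 <= K /\ forall z, 1 <= z ->
  Rabs (besselJ 1 z - sqrt (2 / PI) / sqrt z * cos (z - 3 * PI / 4)) <= K / (z * sqrt z).
Proof.
have PI0 := PI_RGT_0.
have [K [K0 hK]] := van_der_corput is_derive_kern_q1 continuous_kern_q2.
(* [sqrt 2 / 2] comes from the error in [fres_asym], [K / 2] from van der Corput after the
   integration by parts. *)
exists (2 / PI * (sqrt 2 / 2 + K / 2)).
have p0 : 0 < 2 / PI by apply: Rdiv_lt_0_compat; lra.
have r0 : 0 < sqrt 2 by apply: sqrt_lt_R0; lra.
split; first by apply: Rmult_le_pos; lra.
move=> z z1; have z0 : 0 < z by lra.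
have s0 := sqrt_lt_R0 _ z0; have ss := sqrt_sqrt _ (Rlt_le _ _ z0).
pose c := PI / 2 - z.
have cq u : 0 <= u <= 1 -> continuous kern_q u.
  by move=> hu; apply: ex_derive_cont; eexists; exact: is_derive_kern_q.
have cq1 u : 0 <= u <= 1 -> continuous kern_q1 u.
  by move=> hu; apply: ex_derive_cont; eexists; exact: is_derive_kern_q1.
have e1 : besselJ 1 z = 2 / PI *
    (sqrt 2 * RInt (fun t => cos (z * (t * t) + c)) 0 1 + RInt (fun t => kern_q t * (t * cos (z * (t * t) + c))) 0 1).
  have := besselJ_odd_half 0 z; rewrite -[(2 * 0 + 1)%N]/1%N => ->.
  rewrite -[(-1) ^ 0]/1 -[INR 1]/1 Rmult_1_l; congr (_ * _).
  rewrite (RInt_ext _ (fun t => cos t * sin (z * cos t))); last by move=> t _; rewrite Rmult_1_l.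
  rewrite (@RInt_cos_subst (fun v => v * sin (z * v))); last by move=> x; cts.
  have ei1 : ex_RInt (fun t => cos (z * (t * t) + c)) 0 1 by exint.
  have ei2 : ex_RInt (fun t => kern_q t * (t * cos (z * (t * t) + c))) 0 1.
    apply: (ex_RInt_continuous (V := R_CompleteNormedModule)) => t; rewrite Rmin_left ?Rmax_right; try lra.
    by move=> ht; apply: (continuous_mult (K := R_AbsRing)); [exact: cq|cts].
  have h1 := RInt_scal _ _ _ (sqrt 2) ei1.
  have h2 := RInt_plus _ _ _ _ (ex_RInt_scal _ _ _ (sqrt 2) ei1) ei2.
  rewrite h1 in h2; rewrite -[RHS]h2.
  apply: RInt_ext => t; rewrite Rmin_left ?Rmax_right; try lra.
  move=> ht; rewrite /plus /scal /= /mult /=.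
  have -> : cos (z * (t * t) + c) = sin (z * (1 - t * t)).
    by rewrite -cos_shift /c; congr (cos _); ring.
  rewrite -Rmult_assoc kern_q_amplitude; last lra.
  by toR; ring.
(* The phase at [u = 1] is [z + c = PI / 2], where the sine is 1, and [kern_q 1 = - sqrt 2]: this is
   the boundary term. The sine left in the integral is a cosine of phase [c - PI / 2]. *)
have e2 : RInt (fun t => kern_q t * (t * cos (z * (t * t) + c))) 0 1 =
    - (sqrt 2 / (2 * z)) - / (2 * z) * RInt (fun t => kern_q1 t * cos (z * (t * t) + (c - PI / 2))) 0 1.
  rewrite (@RInt_by_parts (fun u => sin (z * (u * u) + c) / (2 * z)) _ kern_q kern_q1); rewrite ?Rmin_left ?Rmax_right; try lra; try by [].
  - have -> : sin (z * (1 * 1) + c) = 1.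
      by rewrite (_ : z * (1 * 1) + c = PI / 2) ?sin_PI2 // /c; ring.
    have -> : kern_q 0 = 0 by rewrite /kern_q; ring.
    have -> : kern_q 1 = - sqrt 2.
      rewrite /kern_q /kern_a /kern_b (_ : 2 - 1 * 1 = 1) ?sqrt_1; last by ring.
      have := sqrt_sqrt 2; move: (sqrt 2) r0 => s s1 hs.
      have {}hs : s * s = 2 by apply: hs; lra.
      apply: (Rmult_eq_reg_r (1 + s)); last lra.
      have -> : -1 * ((2 + s * / 1) * / (1 + s)) * (1 + s) = - (2 + s) by field; lra.
      by rewrite -hs; ring.
    have ei : ex_RInt (fun t => kern_q1 t * cos (z * (t * t) + (c - PI / 2))) 0 1.
      apply: (ex_RInt_continuous (V := R_CompleteNormedModule)) => t; rewrite Rmin_left ?Rmax_right; try lra.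
      by move=> ht; apply: (continuous_mult (K := R_AbsRing)); [exact: cq1|cts].
    have h3 := RInt_scal _ _ _ (/ (2 * z)) ei.
    have -> : RInt (fun x => kern_q1 x * (sin (z * (x * x) + c) / (2 * z))) 0 1 =
        / (2 * z) * RInt (fun t => kern_q1 t * cos (z * (t * t) + (c - PI / 2))) 0 1 :> R.
      rewrite -[RHS]h3; apply: RInt_ext => t _; rewrite /scal /= /mult /=.
      have -> : cos (z * (t * t) + (c - PI / 2)) = sin (z * (t * t) + c).
        by rewrite -cos_shift -cos_neg; congr (cos _); ring.
      by rewrite /Rdiv; toR; ring.
    by toR; field; lra.
  - by move=> t _; auto_derive => //; field; lra.
  - by move=> t _; cts.
  - exact: is_derive_kern_q.
rewrite e1 e2 fres_scale // Rmult_1_r.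
have A := fres_asym c s0; rewrite ss in A.
have B := hK (c - PI / 2) z z0.
have sin1 : sin (z + c) = 1 by rewrite (_ : z + c = PI / 2) ?sin_PI2 // /c; ring.
rewrite sin1 in A.
have cc : cos c - sin c = sqrt 2 * cos (z - 3 * PI / 4).
  rewrite /c cos_shift sin_shift (_ : z - 3 * PI / 4 = (z - PI / 4) - PI / 2); last by field.
  rewrite -(cos_neg (_ - PI / 2)) (_ : - (z - PI / 4 - PI / 2) = PI / 2 - (z - PI / 4)); last by ring.
  rewrite cos_shift sin_minus sin_PI4 cos_PI4; field; lra.
rewrite cc in A.
have k2 : sqrt 2 * (sqrt (PI / 8) * sqrt 2) * (2 / PI) = sqrt (2 / PI).
  have -> : sqrt 2 * (sqrt (PI / 8) * sqrt 2) = sqrt (PI / 2).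
    rewrite -!sqrt_mult; try lra; congr sqrt; field.
  have -> : sqrt (2 / PI) = sqrt (PI / 2 * (2 / PI * (2 / PI))).
    by congr sqrt; field; lra.
  rewrite sqrt_mult ?sqrt_square; try lra.
  by apply: Rmult_le_pos; lra.
move: (RInt _ _ _) B => v B; move: (fres c (sqrt z)) A => f A.
(* The boundary term [- sqrt 2 / (2 * z)] is cancelled by [sqrt 2 / sqrt z] times the second term
   [1 / (2 * sqrt z)] of the Fresnel expansion. *)
have -> : 2 / PI * (sqrt 2 * (f / sqrt z) + (- (sqrt 2 / (2 * z)) - / (2 * z) * v)) -
    sqrt (2 / PI) / sqrt z * cos (z - 3 * PI / 4) =
  2 / PI * (sqrt 2 / sqrt z * (f - sqrt (PI / 8) * (sqrt 2 * cos (z - 3 * PI / 4)) - 1 / (2 * sqrt z))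
     + - (/ (2 * z) * v)).
  have alg (f' D w v' s k p : R) : w <> 0 -> p <> 0 ->
    2 / p * (s * (f' / w) + (- (s / (2 * (w * w))) - / (2 * (w * w)) * v')) - (s * (k * s) * (2 / p)) / w * D =
    2 / p * (s / w * (f' - k * (s * D) - 1 / (2 * w)) + - (/ (2 * (w * w)) * v')) by move=> *; field.
  have := @alg f (cos (z - 3 * PI / 4)) (sqrt z) v (sqrt 2) (sqrt (PI / 8)) PI (Rgt_not_eq _ _ s0) (Rgt_not_eq _ _ PI0).
  by rewrite ss k2.
rewrite Rabs_mult (Rabs_right (2 / PI)); last lra.
rewrite [X in _ <= X](_ : _ = 2 / PI * ((sqrt 2 / 2 + K / 2) / (z * sqrt z))); last by rewrite /Rdiv; ring.
apply: Rmult_le_compat_l; first lra.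
apply: Rle_trans; first exact: Rabs_triang.
have i1 := Rinv_0_lt_compat _ s0; have i2 : 0 < / (2 * z) by apply: Rinv_0_lt_compat; lra.
rewrite Rabs_Ropp /Rdiv !Rabs_mult (Rabs_right (sqrt 2)) ?(Rabs_right (/ sqrt z)) ?(Rabs_right (/ (2 * z))); try lra.
have -> : (sqrt 2 * / 2 + K * / 2) * / (z * sqrt z) =
  sqrt 2 * (/ sqrt z * / (2 * (sqrt z * sqrt z * sqrt z))) * sqrt z + / (2 * z) * (K / sqrt z).
  rewrite ss; field; lra.
apply: Rplus_le_compat; last by apply: Rmult_le_compat_l; lra.
have sq1 : 1 <= sqrt z by rewrite -sqrt_1; apply: sqrt_le_1_alt; lra.
rewrite [X in _ <= X](_ : _ = sqrt 2 * (/ sqrt z * (/ (2 * (sqrt z * sqrt z * sqrt z)) * sqrt z))); last by ring.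
rewrite (Rmult_assoc (sqrt 2) (/ sqrt z) (Rabs _)).
do 2! (apply: Rmult_le_compat_l; first lra).
rewrite /Rdiv in A; apply: Rle_trans A _.
have : 0 < / (2 * (sqrt z * sqrt z * sqrt z)).
  by apply: Rinv_0_lt_compat; apply: Rmult_lt_0_compat; [lra|]; apply: Rmult_lt_0_compat; nra.
by rewrite ss => Y0; rewrite -[X in X <= _]Rmult_1_r; apply: Rmult_le_compat_l; lra.
Qed.

Lemma inv_sqrt_bounds (z : R) : 0 < z ->
  0 < / sqrt z /\ / (z * sqrt z) = / z * / sqrt z /\ 0 < / z.
Proof.
move=> z0; have s0 := sqrt_lt_R0 _ z0.
split; first exact: Rinv_0_lt_compat.
by split; [rewrite Rinv_mult|exact: Rinv_0_lt_compat].
Qed.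

Lemma Rinv_le1 (z : R) : 1 <= z -> / z <= 1.
Proof. by move=> h; rewrite -Rinv_1; apply: Rinv_le_contravar; lra. Qed.

Lemma Rinv_ge1 (z : R) : 0 < z <= 1 -> 1 <= / z.
Proof. by move=> h; rewrite -Rinv_1; apply: Rinv_le_contravar; lra. Qed.

(** The recurrence forces an induction on two consecutive orders; [1 <= z] absorbs its factor
    [/ z]. *)
Lemma besselJ_bound (n : nat) :
  exists K, 0 <= K /\ forall z, 1 <= z -> Rabs (besselJ n z) <= K / sqrt z.
Proof.
suff [] : (exists K, 0 <= K /\ forall z, 1 <= z -> Rabs (besselJ n z) <= K / sqrt z) /\
  (exists K, 0 <= K /\ forall z, 1 <= z -> Rabs (besselJ n.+1 z) <= K / sqrt z) by [].
elim: n => [|n [[K1 [K10 h1]] [K2 [K20 h2]]]].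
  split.
    by have [K [K0 hK]] := besselJ0_bound; exists K; split => // z z1; apply: hK; lra.
  have [K [K0 hK]] := besselJ1_asym.
  have q0 := sqrt_pos (2 / PI).
  exists (sqrt (2 / PI) + K); split; first lra.
  move=> z z1; have := hK z z1.
  have z0 : 0 < z by lra.
  have [i1 [i2 i3]] := inv_sqrt_bounds z0; have i4 := Rinv_le1 z1.
  rewrite /Rdiv i2.
  set m := sqrt (2 * / PI) * / sqrt z * cos _.
  have hm : Rabs m <= sqrt (2 * / PI) * / sqrt z.
    rewrite /m Rabs_mult Rabs_right; last by apply: Rle_ge; apply: Rmult_le_pos; [exact: sqrt_pos|lra].
    have : 0 <= sqrt (2 * / PI) * / sqrt z by apply: Rmult_le_pos; [exact: sqrt_pos|lra].
    by have := Rabs_cos_le1 (z - 3 * PI * / 4); nra.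
  have := Rabs_triang (besselJ 1 z - m) m; rewrite (_ : besselJ 1 z - m + m = besselJ 1 z); last by ring.
  have : K * (/ z * / sqrt z) <= K * / sqrt z by apply: Rmult_le_compat_l => //; nra.
  lra.
split; first by exists K2.
exists (2 * INR n.+1 * K2 + K1); split; first by have := INRS_gt0 n; nra.
move=> z z1; have z0 : 0 < z by lra.
rewrite besselJ_rec //.
have [i1 [i2 i3]] := inv_sqrt_bounds z0; have i4 := Rinv_le1 z1.
have := h1 z z1; have := h2 z z1; rewrite /Rdiv => b2 b1.
apply: Rle_trans; first exact: Rabs_triang.
rewrite Rabs_Ropp Rabs_mult (Rabs_right (2 * _ * _)); last first.
  by apply: Rle_ge; have := INRS_gt0 n; nra.
have := INRS_gt0 n; move: (INR n.+1) => c c0.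
have : c * (/ z * Rabs (besselJ n.+1 z)) <= c * (K2 * / sqrt z).
  apply: Rmult_le_compat_l; first lra.
  by have := Rabs_pos (besselJ n.+1 z); nra.
lra.
Qed.

(** In the recurrence the middle term [2 n / z * J_n] is already [O(z^(-3/2))] by [besselJ_bound],
    so the main term only changes sign when [j] increases. *)
Lemma besselJ_odd_asym (j : nat) :
  exists K, 0 <= K /\ forall z, 1 <= z ->
  Rabs (besselJ (2 * j + 1) z - (-1) ^ j * (sqrt (2 / PI) / sqrt z * cos (z - 3 * PI / 4)))
    <= K / (z * sqrt z).
Proof.
elim: j => [|j [K [K0 hK]]].
  have [K [K0 hK]] := besselJ1_asym; exists K; split => // z z1.
  by rewrite -[(-1) ^ 0]/1 Rmult_1_l; exact: hK.
have [K2 [K20 h2]] := besselJ_bound (2 * j + 1).+1.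
exists (2 * INR (2 * j + 1).+1 * K2 + K); split.
  by have := INRS_gt0 (2 * j + 1); nra.
move=> z z1; have z0 : 0 < z by lra.
have -> : (2 * j.+1 + 1 = (2 * j + 1).+2)%N by lia.
rewrite besselJ_rec // -tech_pow_Rmult.
have := hK z z1; set m := _ * (sqrt _ / _ * _) => hk.
have -> : -1 * (-1) ^ j * (sqrt (2 / PI) / sqrt z * cos (z - 3 * PI / 4)) = - m by rewrite /m; ring.
have -> : forall a b : R, a - b - - m = a + - (b - m) by move=> *; ring.
apply: Rle_trans; first exact: Rabs_triang.
have [i1 [i2 i3]] := inv_sqrt_bounds z0.
rewrite Rabs_Ropp Rabs_mult (Rabs_right (2 * _ / _)); last first.
  by apply: Rle_ge; have := INRS_gt0 (2 * j + 1); rewrite /Rdiv; nra.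
have := h2 z z1; move: hk; rewrite /Rdiv i2.
have := INRS_gt0 (2 * j + 1); move: (INR _) => c c0 hk b2.
have : c * (/ z * Rabs (besselJ (2 * j + 1).+1 z)) <= c * (/ z * (K2 * / sqrt z)).
  by apply: Rmult_le_compat_l; [lra|apply: Rmult_le_compat_l; lra].
lra.
Qed.

Definition bessel_main (j : nat) (z : R) : R :=
  (-1) ^ j * (sqrt (2 / PI) / sqrt z * cos (z - 3 * PI / 4)).

Lemma bessel_main_le (j : nat) (z : R) : 0 < z -> Rabs (bessel_main j z) <= sqrt (2 / PI) / sqrt z.
Proof.
move=> z0; have [i1 _] := inv_sqrt_bounds z0.
rewrite /bessel_main !Rabs_mult Rabs_sgn_pow Rmult_1_l (Rabs_right (/ _)); last lra.
rewrite Rabs_right; last by apply: Rle_ge; exact: sqrt_pos.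
have : 0 <= sqrt (2 / PI) / sqrt z by apply: Rmult_le_pos; [exact: sqrt_pos|lra].
by have := Rabs_cos_le1 (z - 3 * PI / 4); rewrite /Rdiv; nra.
Qed.

(** For large [d] the argument is small, so the bounds must reach down to 0: for [z < 1], [J] is at
    most 1 while [1 <= z^(-1/2) <= z^(-3/2)]. Both decays of the error are kept because neither
    alone gives a bounded total over [d]. *)
Lemma besselJ_odd_error (j : nat) : exists K, 0 <= K /\ forall z, 0 < z ->
  [/\ Rabs (besselJ (2 * j + 1) z) <= K / sqrt z,
      Rabs (besselJ (2 * j + 1) z - bessel_main j z) <= K / sqrt z &
      Rabs (besselJ (2 * j + 1) z - bessel_main j z) <= K / (z * sqrt z)].
Proof.
have [K1 [K10 h1]] := besselJ_bound (2 * j + 1).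
have [K2 [K20 h2]] := besselJ_odd_asym j.
have q0 := sqrt_pos (2 / PI).
exists (K1 + K2 + 1 + sqrt (2 / PI)); split; first lra.
move=> z z0; have [i1 [i2 i3]] := inv_sqrt_bounds z0.
have bm := bessel_main_le j z0.
rewrite /Rdiv i2 in bm *; rewrite -/(2 / PI) in bm *.
have tr := Rabs_triang (besselJ (2 * j + 1) z) (- bessel_main j z).
rewrite Rabs_Ropp in tr; rewrite /Rminus.
case: (Rle_dec 1 z) => hz.
- have b1 := h1 z hz; have b2 := h2 z hz.
  rewrite /Rdiv i2 -/(2 / PI) in b1 b2.
  have i4 := Rinv_le1 hz.
  have b3 : K2 * (/ z * / sqrt z) <= K2 * / sqrt z by apply: Rmult_le_compat_l => //; nra.
  have p1 : 0 <= K1 * / sqrt z by nra.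
  have p2 : 0 <= K2 * / sqrt z by nra.
  have p3 : 0 <= sqrt (2 / PI) * / sqrt z by nra.
  rewrite /bessel_main /Rdiv in b2 bm tr *; rewrite /Rminus in b2.
  split; try lra.
  apply: Rle_trans b2 _; apply: Rmult_le_compat_r; [nra|lra].
- have j1 : 1 <= / z by apply: Rinv_ge1; lra.
  have j2 : 1 <= / sqrt z.
    apply: Rinv_ge1; split; first exact: sqrt_lt_R0.
    by rewrite -sqrt_1; apply: sqrt_le_1_alt; lra.
  have b0 := besselJ_odd_le1 j z.
  have e1 : Rabs (besselJ (2 * j + 1) z + - bessel_main j z) <= (K1 + K2 + 1 + sqrt (2 / PI)) * / sqrt z.
    have p1 : 0 <= (K1 + K2) * / sqrt z by nra.
    lra.
  split => //; first by nra.
  apply: Rle_trans e1 _; apply: Rmult_le_compat_l; first lra.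
  nra.
Qed.

(** * The Schlomilch series *)

Lemma is_derive_big (I : Type) (r : seq I) (f df : I -> R -> R) (x : R) :
  (forall i, is_derive (f i) x (df i x)) ->
  is_derive (fun x => \big[Rplus/0]_(i <- r) f i x) x (\big[Rplus/0]_(i <- r) df i x).
Proof.
move=> h; elim: r => [|i r IH].
  rewrite big_nil; apply: (is_derive_ext (fun _ => 0)); first by move=> t; rewrite big_nil.
  exact: is_derive_const.
rewrite big_cons; apply: (is_derive_ext (fun x => f i x + \big[Rplus/0]_(i <- r) f i x)).
  by move=> t; rewrite big_cons.
exact: (is_derive_plus (V := R_NormedModule)).
Qed.

Lemma continuous_big (I : Type) (r : seq I) (f : I -> R -> R) (x : R) :
  (forall i, continuous (f i) x) ->
  continuous (fun x => \big[Rplus/0]_(i <- r) f i x) x.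
Proof.
move=> h; elim: r => [|i r IH].
  apply: (continuous_ext (fun _ => 0)); first by move=> t; rewrite big_nil.
  exact: continuous_const.
apply: (continuous_ext (fun x => f i x + \big[Rplus/0]_(i <- r) f i x)).
  by move=> t; rewrite big_cons.
exact: (continuous_plus (V := R_NormedModule)).
Qed.

Lemma RInt_big (I : Type) (r : seq I) (f : I -> R -> R) (a b : R) :
  (forall i x, continuous (f i) x) ->
  RInt (fun x => \big[Rplus/0]_(i <- r) f i x) a b = \big[Rplus/0]_(i <- r) RInt (f i) a b.
Proof.
move=> h; elim: r => [|i r IH].
  rewrite big_nil (RInt_ext _ (fun _ => 0)); last by move=> x _; rewrite big_nil.
  by rewrite RInt_const /scal /= /mult /=; toR; ring.
rewrite big_cons -IH.
have := @RInt_lin (f i) (fun x => \big[Rplus/0]_(i <- r) f i x) 1 1 a b (h i).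
rewrite !Rmult_1_l => <-; last by move=> x; apply: continuous_big.
by apply: RInt_ext => x _; rewrite big_cons !Rmult_1_l.
Qed.

(** The quotient [cos ((2 j + 1) t) / cos t], continued across [t = PI / 2]. Integrating
    [sin (z * cos t)] in [z] divides by [cos t], and for odd orders this is how the singularity
    disappears. *)
Fixpoint odd_ratio (j : nat) (t : R) : R :=
  match j with
  | 0%N => 1
  | i.+1 => 2 * cos (INR (2 * i + 2) * t) - odd_ratio i t
  end.

Lemma odd_ratioE (j : nat) (t : R) : cos (INR (2 * j + 1) * t) = cos t * odd_ratio j t.
Proof.
elim: j => [|j IH] /=; first by rewrite Rmult_1_l Rmult_1_r.
have -> : INR (2 * j.+1 + 1) * t = INR (2 * j + 2) * t + t.
  by rewrite (_ : 2 * j.+1 + 1 = (2 * j + 2).+1)%N ?S_INR; [ring|lia].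
have h : INR (2 * j + 1) * t = INR (2 * j + 2) * t - t.
  by rewrite (_ : 2 * j + 2 = (2 * j + 1).+1)%N ?S_INR; [ring|lia].
move: IH; rewrite h cos_plus cos_minus; lra.
Qed.

Lemma odd_ratio_le (j : nat) (t : R) : Rabs (odd_ratio j t) <= 2 * INR j + 1.
Proof.
elim: j => [|j IH]; first by rewrite /= Rabs_R1; lra.
rewrite S_INR [odd_ratio _ _]/=; apply: Rle_trans; first exact: Rabs_triang.
rewrite Rabs_Ropp Rabs_mult (Rabs_right 2); last lra.
by have := Rabs_cos_le1 (INR (2 * j + 2) * t); lra.
Qed.

Lemma odd_ratio_continuous (j : nat) (t : R) : continuous (odd_ratio j) t.
Proof.
apply: ex_derive_cont; elim: j => [|j IH]; first by rewrite /=; auto_derive.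
rewrite [odd_ratio _]/=; move: (INR _) => c; auto_derive; by [].
Qed.

(** The primitive of [J] that vanishes at 0; its [1 - cos] becomes [zeta(2)] minus [bern] after
    summation. *)
Definition bessel_prim (j : nat) (z : R) : R :=
  (-1) ^ j * (2 / PI) * RInt (fun t => odd_ratio j t * (1 - cos (z * cos t))) 0 (PI / 2).

Lemma is_derive_bessel_prim (j : nat) (z : R) :
  is_derive (bessel_prim j) z (besselJ (2 * j + 1) z).
Proof.
rewrite besselJ_odd_half /bessel_prim.
apply: is_derive_scal.
apply: (@is_derive_RInt_smooth (fun z t => odd_ratio j t * (1 - cos (z * cos t)))
  (fun z t => cos (INR (2 * j + 1) * t) * sin (z * cos t))).
- by move=> u t; rewrite odd_ratioE; auto_derive => //; ring.
- move=> u t; apply: continuity_2d_pt_mult.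
    apply: (continuity_1d_2d_pt_comp cos (fun _ t => INR (2 * j + 1) * t)); first exact: continuity_cos.
    apply: continuity_2d_pt_mult; first exact: continuity_2d_pt_const.
    exact: continuity_2d_pt_id2.
  apply: (continuity_1d_2d_pt_comp sin (fun z t => z * cos t)); first exact: continuity_sin.
  apply: continuity_2d_pt_mult; first exact: continuity_2d_pt_id1.
  apply: (continuity_1d_2d_pt_comp cos (fun _ t => t)); first exact: continuity_cos.
  exact: continuity_2d_pt_id2.
- move=> u t; apply: (continuous_mult (K := R_AbsRing)); first exact: odd_ratio_continuous.
  by cts.
Qed.

Lemma ex_series_inv_32 : ex_series (fun i => / (INR i.+1 * sqrt (INR i.+1))).
Proof.
apply: (proj1 (@ex_series_telescope _ (fun i => - (4 / sqrt (INR i.+1))) 0 _ _)) => n.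
  have h := INRS_gt0 n; rewrite (S_INR n.+1).
  have hx : 1 <= INR n.+1 by rewrite S_INR; have := pos_INR n; lra.
  move: (INR n.+1) hx {h} => x hx.
  have x0 : 0 < x by lra.
  have y0 : 0 < x + 1 by lra.
  have s0 := sqrt_lt_R0 _ x0; have r0 := sqrt_lt_R0 _ y0.
  have ss := sqrt_sqrt _ (Rlt_le _ _ x0); have rr := sqrt_sqrt _ (Rlt_le _ _ y0).
  split; first by apply: Rlt_le; apply: Rinv_0_lt_compat; nra.
  move: (sqrt x) (sqrt (x + 1)) s0 r0 ss rr => s r s0 r0 ss rr.
  have -> : - (4 / r) - - (4 / s) = / (x * s) * (4 * x / (r * (r + s))).
    have -> : - (4 / r) - - (4 / s) = 4 * (r - s) / (r * s) by field; lra.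
    have -> : r - s = / (r + s).
      by apply: (Rmult_eq_reg_r (r + s)); [field_simplify; nra|nra].
    by field; nra.
  (* From [r ^ 2 = x + 1 <= 2 x]. Hence [r * (r + s) <= 15 / 4 * x], which is why the constant 4 in
     the majorant suffices. *)
  have rs : r <= 3 / 2 * s by nra.
  have h1 : 0 < / (x * s) by apply: Rinv_0_lt_compat; nra.
  have h2 : 1 <= 4 * x / (r * (r + s)).
    apply: (Rmult_le_reg_r (r * (r + s))); first by nra.
    have -> : 4 * x / (r * (r + s)) * (r * (r + s)) = 4 * x by field; nra.
    nra.
  nra.
have : 0 < 4 / sqrt (INR n.+1) by apply: Rdiv_lt_0_compat; [lra|apply: sqrt_lt_R0; apply: INRS_gt0].
lra.
Qed.

Definition schlomilch (j : nat) (x : R) : R :=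
  Series (fun i => besselJ (2 * j + 1) (INR i.+1 * x) / INR i.+1).

Definition schlomilch_prim (j : nat) (x : R) : R :=
  Series (fun i => bessel_prim j (INR i.+1 * x) / INR i.+1 ^ 2).

Lemma bessel_prim_le (j : nat) (z : R) : Rabs (bessel_prim j z) <= 2 * (2 * INR j + 1).
Proof.
have PI0 := PI_RGT_0.
rewrite /bessel_prim !Rabs_mult Rabs_sgn_pow Rmult_1_l (Rabs_right 2) ?(Rabs_right (/ PI)); try lra; last first.
  by apply: Rle_ge; apply: Rlt_le; apply: Rinv_0_lt_compat.
have h : Rabs (RInt (fun t => odd_ratio j t * (1 - cos (z * cos t))) 0 (PI / 2)) <= (PI / 2 - 0) * ((2 * INR j + 1) * 2).
  apply: RInt_abs_le; first lra.
    move=> t; apply: (continuous_mult (K := R_AbsRing)); first exact: odd_ratio_continuous.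
    by cts.
  move=> t _; rewrite Rabs_mult; apply: Rmult_le_compat; try exact: Rabs_pos.
    exact: odd_ratio_le.
  by apply: Rabs_le; have := COS_bound (z * cos t); lra.
have i0 := Rinv_0_lt_compat _ PI0.
apply: (Rle_trans _ (2 * / PI * ((PI / 2 - 0) * ((2 * INR j + 1) * 2)))).
  by apply: Rmult_le_compat_l => //; lra.
by right; field; lra.
Qed.

Lemma ex_series_schlomilch_prim (j : nat) (x : R) :
  ex_series (fun i => bessel_prim j (INR i.+1 * x) / INR i.+1 ^ 2).
Proof.
apply: ex_series_le (ex_series_scal_l (2 * (2 * INR j + 1)) _ ex_series_inv_sqr) => n.
rewrite /norm /= /abs /= /scal /= /mult /= -/(INR n.+1).
have h : 0 < / (INR n.+1 * (INR n.+1 * 1)).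
  by have := INRS_gt0 n => ?; apply: Rinv_0_lt_compat; nra.
rewrite Rabs_mult (Rabs_right (/ _)); last lra.
by have := bessel_prim_le j (INR n.+1 * x); nra.
Qed.

(** The majorant [K / sqrt (s x) / s] is uniform only away from [x = 0], whereas the M-test lemmas
    want a bound on the whole line. Clamping the argument by [Rmax a] provides it and changes
    nothing for [x >= a]. *)
Lemma schlomilch_max (j : nat) (a : R) : 0 < a ->
  (forall x, continuous (fun t => schlomilch j (Rmax a t)) x) /\
  forall x, a <= x -> schlomilch_prim j x
    = schlomilch_prim j a + RInt (fun t => schlomilch j (Rmax a t)) a x.
Proof.
move=> a0.
have [K [K0 hK]] := besselJ_odd_error j.
pose f i t := besselJ (2 * j + 1) (INR i.+1 * Rmax a t) / INR i.+1.
pose M i := K / sqrt a * / (INR i.+1 * sqrt (INR i.+1)).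
have sa0 := sqrt_lt_R0 _ a0.
have hM : ex_series M by apply: (ex_series_scal_l (V := R_NormedModule)); exact: ex_series_inv_32.
have hf i t : Rabs (f i t) <= M i.
  have s0 := INRS_gt0 i; have m0 : a <= Rmax a t by exact: Rmax_l.
  have z0 : 0 < INR i.+1 * Rmax a t by nra.
  have [h1 _ _] := hK _ z0.
  have is0 := Rinv_0_lt_compat _ s0.
  rewrite /f /M Rabs_mult (Rabs_right (/ _)); last lra.
  have -> : K / sqrt a * / (INR i.+1 * sqrt (INR i.+1)) = K / (sqrt (INR i.+1) * sqrt a) * / INR i.+1.
    by have := sqrt_lt_R0 _ s0 => ?; field; lra.
  apply: Rmult_le_compat_r; first lra.
  apply: Rle_trans h1 _.
  rewrite -sqrt_mult; try lra.
  apply: Rmult_le_compat_l => //; apply: Rinv_le_contravar; first by apply: sqrt_lt_R0; nra.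
  by apply: sqrt_le_1_alt; nra.
have cJ z : continuous (besselJ (2 * j + 1)) z.
  apply: (continuous_ext (fun z => (-1) ^ j * (2 / PI) * RInt (fun t => cos (INR (2 * j + 1) * t) * sin (z * cos t)) 0 (PI / 2))).
    by move=> u; rewrite besselJ_odd_half.
  apply: ex_derive_cont; eexists; apply: is_derive_scal.
  apply: (@is_derive_RInt_smooth (fun z t => cos (INR (2 * j + 1) * t) * sin (z * cos t))
    (fun z t => cos (INR (2 * j + 1) * t) * (cos t * cos (z * cos t)))).
  - by move=> u t; move: (INR _) => c; auto_derive => //; ring.
  - move=> u t; apply: continuity_2d_pt_mult.
      apply: (continuity_1d_2d_pt_comp cos (fun _ t => INR (2 * j + 1) * t)); first exact: continuity_cos.
      apply: continuity_2d_pt_mult; first exact: continuity_2d_pt_const.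
      exact: continuity_2d_pt_id2.
    apply: continuity_2d_pt_mult.
      apply: (continuity_1d_2d_pt_comp cos (fun _ t => t)); first exact: continuity_cos.
      exact: continuity_2d_pt_id2.
    apply: (continuity_1d_2d_pt_comp cos (fun z t => z * cos t)); first exact: continuity_cos.
    apply: continuity_2d_pt_mult; first exact: continuity_2d_pt_id1.
    apply: (continuity_1d_2d_pt_comp cos (fun _ t => t)); first exact: continuity_cos.
    exact: continuity_2d_pt_id2.
  - by move=> u t; move: (INR _) => c; cts.
have cmax t : continuous (Rmax a) t.
  apply: (continuous_ext (fun t => (a + t + Rabs (a - t)) / 2)).
    move=> u; rewrite /Rmax; case: Rle_dec => h; [rewrite Rabs_left1|rewrite Rabs_right]; lra.
  apply: (continuous_mult (K := R_AbsRing)); last exact: continuous_const.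
  apply: (continuous_plus (V := R_NormedModule)); first by cts.
  by apply: (continuous_comp (fun u => a - u) Rabs); [cts|exact: continuous_Rabs].
have cf i t : continuous (f i) t.
  rewrite /f; apply: (continuous_mult (K := R_AbsRing)); last exact: continuous_const.
  apply: (continuous_comp (fun t => INR i.+1 * Rmax a t) (besselJ (2 * j + 1))); last exact: cJ.
  by apply: (continuous_mult (K := R_AbsRing)); [exact: continuous_const|exact: cmax].
split; first by move=> x; exact: (@continuous_Series f M x hf hM cf).
move=> x ax.
have h := is_series_unique _ _ (@is_series_RInt f M a x hf hM cf).
rewrite /schlomilch -h /schlomilch_prim.
have := Series_minus _ _ (ex_series_schlomilch_prim j x) (ex_series_schlomilch_prim j a).
rewrite (_ : Series (fun n => RInt (f n) a x) = Series (fun n => bessel_prim j (INR n.+1 * x) / INR n.+1 ^ 2 - bessel_prim j (INR n.+1 * a) / INR n.+1 ^ 2)).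
  by move=> ->; ring.
apply: Series_ext => n.
have s0 := INRS_gt0 n.
rewrite (RInt_ext _ (fun t => besselJ (2 * j + 1) (INR n.+1 * t) / INR n.+1)); last first.
  by move=> t; rewrite Rmin_left // => ht; rewrite /f Rmax_right //; lra.
move: (INR n.+1) s0 => c c0.
rewrite (@RInt_FTC (fun t => bessel_prim j (c * t) / c ^ 2)) // => t _.
  have hd := is_derive_bessel_prim j (c * t).
  auto_derive; first by exists (besselJ (2 * j + 1) (c * t)).
  by rewrite (is_derive_unique _ _ _ hd); field; lra.
apply: (continuous_mult (K := R_AbsRing)); last exact: continuous_const.
by apply: (continuous_comp (fun t => c * t) (besselJ (2 * j + 1))); [cts|exact: cJ].
Qed.

Lemma schlomilch_derive (j : nat) (x : R) : 0 < x ->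
  is_derive (schlomilch_prim j) x (schlomilch j x) /\ continuous (schlomilch j) x.
Proof.
move=> x0; have a0 : 0 < x / 2 by lra.
have [hc hp] := schlomilch_max j a0.
have loc : locally x (fun y => x / 2 <= y).
  exists (mkposreal _ a0) => y; rewrite /ball /= /AbsRing_ball /= /abs /minus /plus /opp /= => hy.
  by case: (Rabs_def2 _ _ hy) => ? ?; lra.
have em y : x / 2 <= y -> schlomilch j (Rmax (x / 2) y) = schlomilch j y.
  by move=> hy; rewrite Rmax_right.
split.
- apply: (is_derive_ext_loc (fun y => schlomilch_prim j (x / 2) + RInt (fun t => schlomilch j (Rmax (x / 2) t)) (x / 2) y)).
    by apply: filter_imp loc => y hy; rewrite (hp y).
  rewrite -[schlomilch j x]Rplus_0_l.
  apply: (is_derive_plus (V := R_NormedModule)); first exact: is_derive_const.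
  rewrite -em; last lra.
  apply: (is_derive_RInt (V := R_NormedModule) (fun t => schlomilch j (Rmax (x / 2) t)) _ (x / 2) x) => //.
  by apply: filter_forall => y; apply: RInt_correct; exact: ex_RInt_cont.
- by apply: continuous_ext_loc (hc x); apply: filter_imp loc => y hy; rewrite em.
Qed.

(** * Closed form of the Schlomilch series *)

Lemma schlomilch_prim_bern (j : nat) (x : R) :
  schlomilch_prim j x = (-1) ^ j * (2 / PI) *
    RInt (fun t => odd_ratio j t * (PI ^ 2 / 6 - bern (x * cos t))) 0 (PI / 2).
Proof.
pose f i t := odd_ratio j t * (1 - cos (INR i.+1 * x * cos t)) * / INR i.+1 ^ 2.
pose M i := (2 * INR j + 1) * 2 * / INR i.+1 ^ 2.
have hM : ex_series M by apply: (ex_series_scal_l (V := R_NormedModule)); exact: ex_series_inv_sqr.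
have i0 i : 0 < / INR i.+1 ^ 2 by apply: Rinv_0_lt_compat; apply: pow_lt; exact: INRS_gt0.
have hf i t : Rabs (f i t) <= M i.
  rewrite /f /M !Rabs_mult (Rabs_right (/ _)); last by have := i0 i; lra.
  apply: Rmult_le_compat_r; first by have := i0 i; lra.
  apply: Rmult_le_compat; try exact: Rabs_pos; first exact: odd_ratio_le.
  by apply: Rabs_le; have := COS_bound (INR i.+1 * x * cos t); lra.
have cf i t : continuous (f i) t.
  rewrite /f; apply: (continuous_mult (K := R_AbsRing)); last exact: continuous_const.
  apply: (continuous_mult (K := R_AbsRing)); first exact: odd_ratio_continuous.
  by move: (INR _) => c; cts.
have h := is_series_unique _ _ (@is_series_RInt f M 0 (PI / 2) hf hM cf).
rewrite (RInt_ext _ (fun t => Series (fun i => f i t))); last first.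
  move=> t _; rewrite -zeta2 /bern -Series_minus.
  - rewrite -Series_scal_l; apply: Series_ext => i; rewrite /f.
    by rewrite (Rmult_assoc (INR i.+1)) /Rdiv; ring.
  - exact: ex_series_inv_sqr.
  - by apply: ex_series_le ex_series_inv_sqr => i; exact: bern_term_le.
rewrite -h -Series_scal_l /schlomilch_prim; apply: Series_ext => i.
rewrite /bessel_prim /Rdiv Rmult_assoc; congr (_ * _).
have ei : ex_RInt (fun t => odd_ratio j t * (1 - cos (INR i.+1 * x * cos t))) 0 (PI * / 2).
  apply: ex_RInt_cont => t; apply: (continuous_mult (K := R_AbsRing)); first exact: odd_ratio_continuous.
  by move: (INR _) => c; cts.
have h3 := RInt_scal _ _ _ (/ INR i.+1 ^ 2) ei.
rewrite Rmult_comm -[LHS]h3; apply: RInt_ext => t _.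
by rewrite /f /scal /= /mult /=; toR; ring.
Qed.

(** The contribution of one kink of the parabola, located at [u = c]. *)
Definition hinge_int (j : nat) (c x : R) : R :=
  RInt (fun t => odd_ratio j t * Rmax 0 (x * cos t - c)) 0 (PI / 2).

Lemma sin_odd_PI2 (j : nat) : sin (INR (2 * j + 1) * (PI / 2)) = (-1) ^ j.
Proof.
elim: j => [|j IH]; first by rewrite /= Rmult_1_l sin_PI2.
rewrite -tech_pow_Rmult -IH.
have -> : INR (2 * j.+1 + 1) * (PI / 2) = INR (2 * j + 1) * (PI / 2) + PI.
  by rewrite (_ : 2 * j.+1 + 1 = (2 * j + 1).+2)%N ?S_INR; [field|lia].
by rewrite neg_sin; ring.
Qed.

Lemma hinge_continuous (j : nat) (c x t : R) :
  continuous (fun t => odd_ratio j t * Rmax 0 (x * cos t - c)) t.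
Proof.
apply: (continuous_mult (K := R_AbsRing)); first exact: odd_ratio_continuous.
apply: (continuous_ext (fun t => (x * cos t - c + Rabs (x * cos t - c)) / 2)).
  move=> u; rewrite /Rmax; case: Rle_dec => h; [rewrite Rabs_right|rewrite Rabs_left1]; lra.
apply: (continuous_mult (K := R_AbsRing)); last exact: continuous_const.
apply: (continuous_plus (V := R_NormedModule)); first by cts.
by apply: (continuous_comp (fun u => x * cos u - c) Rabs); [cts|exact: continuous_Rabs].
Qed.

Lemma INR_odd_gt0 (j : nat) : 0 < INR (2 * j + 1).
Proof. by rewrite addn1; exact: INRS_gt0. Qed.

(** The constant of the parabola cancels against [zeta(2)]. The linear term integrates [cos (n t)]
    and gives [x / n]; the quadratic term gives [cosint 1 n], nonzero only for [n = 1], which is the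
    origin of the term restricted to [k = 2]. *)
Lemma schlomilch_prim_formula (j M : nat) (x : R) : 0 <= x <= 2 * PI * INR M.+1 ->
  schlomilch_prim j x = x / INR (2 * j + 1)
    - (-1) ^ j * cosint 1 (2 * j + 1) / (4 * PI) * x ^ 2
    + 2 * (-1) ^ j * \big[Rplus/0]_(0 <= i < M) hinge_int j (2 * PI * INR i.+1) x.
Proof.
move=> hx; have PI0 := PI_RGT_0; have n0 := INR_odd_gt0 j.
rewrite schlomilch_prim_bern.
set N := INR (2 * j + 1) in n0 *.
have s1 : (-1) ^ j * (-1) ^ j = 1 by rewrite -Rpow_mult_distr (_ : -1 * -1 = 1) ?pow1 //; lra.
pose f1 t := PI * x / 2 * cos (N * t) + - (x ^ 2 / 4) * (cos t ^ 1 * cos (N * t)).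
pose f2 t := \big[Rplus/0]_(0 <= i < M) (odd_ratio j t * Rmax 0 (x * cos t - 2 * PI * INR i.+1)).
have cf1 t : continuous f1 t by rewrite /f1; cts.
have cf2 t : continuous f2 t by apply: continuous_big => i; exact: hinge_continuous.
have -> : RInt (fun t => odd_ratio j t * (PI ^ 2 / 6 - bern (x * cos t))) 0 (PI / 2) =
   1 * RInt f1 0 (PI / 2) + PI * RInt f2 0 (PI / 2).
  rewrite -RInt_lin //; apply: RInt_ext => t; rewrite Rmin_left ?Rmax_right; try lra.
  move=> ht.
  have c0 : 0 <= cos t by apply: cos_ge_0; lra.
  have c1 := COS_bound t.
  rewrite (@bern_formula M); last by nra.
  rewrite big_add1 /f1 /f2 /= -big_distrr /= odd_ratioE; toR.
  move: (\big[_/_]_(_ <= _ < _) _) => b; field.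
have e1 : RInt f1 0 (PI / 2) = PI * x / 2 * ((-1) ^ j / N) + - (x ^ 2 / 4) * (cosint 1 (2 * j + 1) / 2).
  rewrite /f1 (@RInt_lin (fun t => cos (N * t)) (fun t => cos t ^ 1 * cos (N * t))); [|by move=> t; cts|by move=> t; cts].
  have -> : cosint 1 (2 * j + 1) = 2 * RInt (fun t => cos t ^ 1 * cos (N * t)) 0 (PI / 2).
    rewrite /cosint -/N RInt_reflect //; first by move=> t; cts.
    by move=> t; rewrite cos_odd_reflect cos_minus cos_PI sin_PI -/N; ring.
  rewrite (@RInt_FTC (fun t => sin (N * t) / N)) => [|t _|t _].
  - by rewrite sin_odd_PI2 Rmult_0_r sin_0; toR; field; lra.
  - by auto_derive => //; field; lra.
  - by cts.
rewrite e1 /f2 RInt_big; last by move=> i t; exact: hinge_continuous.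
rewrite -/(hinge_int _ _ _); move: (\big[_/_]_(_ <= _ < _) _) => b.
move: (cosint _ _) => w.
transitivity (((-1) ^ j * (-1) ^ j) * (x / N) - (-1) ^ j * w / (4 * PI) * x ^ 2 + 2 * (-1) ^ j * b); last by rewrite s1; ring.
by field; lra.
Qed.

(** The function [sin ((2 j + 1) acos u)] inside [(-1, 1)]. Since [sqrt] is 0 on negative numbers it
    vanishes for [u >= 1], so kinks not yet reached contribute nothing and no case distinction is
    needed. *)
Definition cusp (j : nat) (u : R) : R := sqrt (1 - u * u) * chebyshevU (2 * j) u.

Lemma chebyshevU_ex_derive (n : nat) (x : R) : ex_derive (chebyshevU n) x.
Proof.
suff [] : ex_derive (chebyshevU n) x /\ ex_derive (chebyshevU n.+1) x by [].
elim: n => [|n [h1 h2]]; first by split; rewrite /=; auto_derive.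
split => //.
apply: (ex_derive_ext (fun x => 2 * x * chebyshevU n.+1 x - chebyshevU n x)); first by [].
move: (chebyshevU n.+1) (chebyshevU n) h1 h2 => f g h1 h2.
by auto_derive.
Qed.

Lemma cusp_continuous (j : nat) (c x : R) : 0 < x -> continuous (fun x => cusp j (c / x)) x.
Proof.
move=> x0.
have cd : continuous (fun x => c / x) x by cts; lra.
apply: (continuous_comp (fun x => c / x) (cusp j)) => //.
rewrite /cusp; apply: (continuous_mult (K := R_AbsRing)); last first.
  by apply: ex_derive_cont; exact: chebyshevU_ex_derive.
apply: (continuous_comp (fun u => 1 - u * u) sqrt); first by cts.
exact: continuous_sqrt.
Qed.

Lemma cusp_cos (j : nat) (t : R) : 0 < t < PI -> cusp j (cos t) = sin (INR (2 * j + 1) * t).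
Proof.
move=> ht; have s0 : 0 < sin t by apply: sin_gt_0; lra.
rewrite /cusp chebyshevU_cos; last lra.
have -> : 1 - cos t * cos t = sin t * sin t by have := sin2_cos2 t; rewrite /Rsqr; lra.
by rewrite sqrt_square ?addn1; [field|]; lra.
Qed.

(** This is [acos (c / x)] for [0 < c < x], written with [atan] so that its differentiability is
    immediate for [x > c]. *)
Definition hinge_angle (c x : R) : R := atan (sqrt (x * x - c * c) / c).

Lemma hinge_angleP (c x : R) : 0 < c < x ->
  0 < hinge_angle c x < PI / 2 /\ cos (hinge_angle c x) = c / x.
Proof.
move=> [c0 cx].
have d0 : 0 < x * x - c * c by nra.
have s0 := sqrt_lt_R0 _ d0.
have q0 : 0 < sqrt (x * x - c * c) / c by apply: Rdiv_lt_0_compat.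
rewrite /hinge_angle; split.
  split; first by rewrite -atan_0; exact: atan_increasing.
  by have := atan_bound (sqrt (x * x - c * c) / c); lra.
rewrite cos_atan.
have -> : 1 + Rsqr (sqrt (x * x - c * c) / c) = (x / c) * (x / c).
  rewrite /Rsqr; have := sqrt_sqrt _ (Rlt_le _ _ d0); move: (sqrt _) => s ss.
  have -> : 1 + s / c * (s / c) = (c * c + s * s) / (c * c) by field; lra.
  by rewrite ss; field; lra.
rewrite sqrt_square; last by apply: Rlt_le; apply: Rdiv_lt_0_compat; lra.
by field; lra.
Qed.

(** The hinge is active up to the angle where [x * cos t] falls to [c], and there [odd_ratio] times
    [cos t] is [cos ((2 j + 1) t)] again. *)
Lemma hinge_int_formula (j : nat) (c x : R) : 0 < c < x ->
  hinge_int j c x = x * (sin (INR (2 * j + 1) * hinge_angle c x) / INR (2 * j + 1))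
    - c * RInt (odd_ratio j) 0 (hinge_angle c x).
Proof.
move=> hcx; have [hp hcos] := hinge_angleP hcx; have PI0 := PI_RGT_0.
have n0 := INR_odd_gt0 j.
move: (hinge_angle c x) hp hcos => p hp hcos.
have xc : x * cos p = c by rewrite hcos; field; lra.
have hc := @hinge_continuous j c x.
have := RInt_Chasles _ 0 p (PI / 2) (ex_RInt_cont _ _ hc) (ex_RInt_cont _ _ hc).
rewrite /plus /= /hinge_int => <-.
have -> : RInt (fun t => odd_ratio j t * Rmax 0 (x * cos t - c)) p (PI / 2) = 0 :> R.
  rewrite (RInt_ext _ (fun _ => 0)); first by rewrite RInt_const /scal /= /mult /=; toR; ring.
  move=> t; rewrite (Rmin_left p (PI / 2)) ?(Rmax_right p (PI / 2)); try lra.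
  move=> ht; have : cos t <= cos p by apply: cos_decr_1; lra.
  by move=> h; rewrite Rmax_left ?Rmult_0_r //; nra.
rewrite (RInt_ext _ (fun t => x * cos (INR (2 * j + 1) * t) + - c * odd_ratio j t)); last first.
  move=> t; rewrite (Rmin_left 0 p) ?(Rmax_right 0 p); try lra.
  move=> ht; have : cos p <= cos t by apply: cos_decr_1; lra.
  by move=> h; rewrite Rmax_right ?odd_ratioE; [toR; ring|nra].
move: (INR _) n0 => N n0.
rewrite (@RInt_lin (fun t => cos (N * t))); [|by move=> t; cts|by move=> t; exact: odd_ratio_continuous].
rewrite (@RInt_FTC (fun t => sin (N * t) / N)) => [|t _|t _].
- by rewrite Rmult_0_r sin_0; toR; field; lra.
- by auto_derive => //; field; lra.
- by cts.
Qed.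

(* The angle is stationary: the two terms carrying its derivative cancel. *)
Lemma is_derive_hinge_int (j : nat) (c x : R) : 0 < c -> 0 < x -> x <> c ->
  is_derive (hinge_int j c) x (cusp j (c / x) / INR (2 * j + 1)).
Proof.
move=> c0 x0 xc; have PI0 := PI_RGT_0; have n0 := INR_odd_gt0 j.
case: (Rlt_dec x c) => h.
- have -> : cusp j (c / x) / INR (2 * j + 1) = 0.
    rewrite /cusp sqrt_neg_0; first by rewrite /Rdiv; ring.
    have : 1 <= c / x.
      apply: (Rmult_le_reg_r x) => //; rewrite /Rdiv Rmult_assoc Rinv_l; lra.
    nra.
  apply: (is_derive_ext_loc (fun _ => 0)); last exact: is_derive_const.
  have d0 : 0 < Rmin x (c - x) by apply: Rmin_pos; lra.
  exists (mkposreal _ d0) => y; rewrite /ball /= /AbsRing_ball /= /abs /minus /plus /opp /= => hy.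
  have m1 := Rmin_l x (c - x); have m2 := Rmin_r x (c - x).
  case: (Rabs_def2 _ _ hy) => y1 y2.
  rewrite /hinge_int (RInt_ext _ (fun _ => 0)); first by rewrite RInt_const /scal /= /mult /=; toR; ring.
  move=> t _; have := COS_bound t => ?.
  by rewrite Rmax_left ?Rmult_0_r //; nra.
- have hcx : 0 < c < x by lra.
  apply: (is_derive_ext_loc (fun x => x * (sin (INR (2 * j + 1) * hinge_angle c x) / INR (2 * j + 1))
    - c * RInt (odd_ratio j) 0 (hinge_angle c x))).
    have d0 : 0 < x - c by lra.
    exists (mkposreal _ d0) => y; rewrite /ball /= /AbsRing_ball /= /abs /minus /plus /opp /= => hy.
    case: (Rabs_def2 _ _ hy) => y1 y2.
    by rewrite hinge_int_formula //; lra.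
  have [hp hcos] := hinge_angleP hcx.
  rewrite -hcos cusp_cos; last lra.
  have exA : ex_derive (hinge_angle c) x.
    have d0 : 0 < x * x - c * c by nra.
    by rewrite /hinge_angle; auto_derive; repeat split; rewrite /Rminus in d0; lra.
  have dW := @RInt_zero_is_derive (odd_ratio j) (hinge_angle c x) (@odd_ratio_continuous j).
  have xcos : x * cos (hinge_angle c x) = c by rewrite hcos; field; lra.
  pose W u := RInt (odd_ratio j) 0 u : R.
  have dW' : is_derive W (hinge_angle c x) (odd_ratio j (hinge_angle c x)) := dW.
  apply: (is_derive_ext (fun x => x * (sin (INR (2 * j + 1) * hinge_angle c x) / INR (2 * j + 1)) - c * W (hinge_angle c x))) => //.
  have := odd_ratioE j (hinge_angle c x).
  move: (INR (2 * j + 1)) n0 => N n0 hV.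
  auto_derive.
    by repeat split => //; exists (odd_ratio j (hinge_angle c x)).
  rewrite (is_derive_unique _ _ _ dW') hV.
  have alg (sn D co V : R) : x * co = c ->
    1 * (sn * / N) + x * (N * (1 * D) * (co * V) * / N) + - (c * (1 * D * V)) = sn / N.
    by move=> <-; field; lra.
  exact: alg.
Qed.

Lemma schlomilch_formula (j M : nat) (x : R) : 0 < x < 2 * PI * INR M.+1 ->
  schlomilch j x = / INR (2 * j + 1) - (-1) ^ j * cosint 1 (2 * j + 1) / (2 * PI) * x
    + 2 * (-1) ^ j / INR (2 * j + 1) * \big[Rplus/0]_(0 <= i < M) cusp j (2 * PI * INR i.+1 / x).
Proof.
move=> [x0 xM]; have PI0 := PI_RGT_0; have n0 := INR_odd_gt0 j.
pose rhs x := / INR (2 * j + 1) - (-1) ^ j * cosint 1 (2 * j + 1) / (2 * PI) * x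
    + 2 * (-1) ^ j / INR (2 * j + 1) * \big[Rplus/0]_(0 <= i < M) cusp j (2 * PI * INR i.+1 / x).
have generic t : 0 < t < 2 * PI * INR M.+1 -> (forall i, t <> 2 * PI * INR i.+1) -> schlomilch j t = rhs t.
  move=> [t0 tM] ht.
  have [d1 _] := schlomilch_derive j t0.
  have d2 : is_derive (schlomilch_prim j) t (rhs t).
    apply: (is_derive_ext_loc (fun x => x / INR (2 * j + 1)
      - (-1) ^ j * cosint 1 (2 * j + 1) / (4 * PI) * x ^ 2
      + 2 * (-1) ^ j * \big[Rplus/0]_(0 <= i < M) hinge_int j (2 * PI * INR i.+1) x)).
      have e0 : 0 < Rmin t (2 * PI * INR M.+1 - t) by apply: Rmin_pos; lra.
      exists (mkposreal _ e0) => y; rewrite /ball /= /AbsRing_ball /= /abs /minus /plus /opp /= -/(INR M.+1) => hy.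
      have m1 := Rmin_l t (2 * PI * INR M.+1 - t); have m2 := Rmin_r t (2 * PI * INR M.+1 - t).
      case: (Rabs_def2 _ _ hy) => y1 y2.
      by rewrite (@schlomilch_prim_formula j M) //; rewrite -/(INR M.+1) in y1 y2 m1 m2; lra.
    pose B x := \big[Rplus/0]_(0 <= i < M) hinge_int j (2 * PI * INR i.+1) x.
    have dB : is_derive B t (\big[Rplus/0]_(0 <= i < M) (cusp j (2 * PI * INR i.+1 / t) * / INR (2 * j + 1))).
      apply: (@is_derive_big _ _ (fun i => hinge_int j (2 * PI * INR i.+1)) (fun i t => cusp j (2 * PI * INR i.+1 / t) * / INR (2 * j + 1))) => i.
      apply: is_derive_hinge_int => //.
      by have := INRS_gt0 i; nra.
    rewrite -big_distrl /= in dB.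
    rewrite /rhs -/(B _).
    apply: (is_derive_ext (fun x => x / INR (2 * j + 1)
      - (-1) ^ j * cosint 1 (2 * j + 1) / (4 * PI) * x ^ 2 + 2 * (-1) ^ j * B x)) => //.
    move: (INR (2 * j + 1)) n0 dB => N n0 dB; move: (cosint _ _) ((-1) ^ j) => w s.
    have exB : ex_derive B t by eexists; exact: dB.
    auto_derive; first by repeat split.
    by rewrite (is_derive_unique _ _ _ dB); move: (\big[_/_]_(_ <= _ < _) _) => b; field; lra.
  by rewrite -(is_derive_unique _ _ _ d1); exact: is_derive_unique.
have cR t : 0 < t -> continuous rhs t.
  move=> t0; rewrite /rhs; apply: (continuous_plus (V := R_NormedModule)); first by move: (cosint _ _) (INR _) => w N; cts.
  apply: (continuous_mult (K := R_AbsRing)); first exact: continuous_const.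
  by apply: continuous_big => i; exact: cusp_continuous.
case: (Classical_Prop.classic (exists i, x = 2 * PI * INR i.+1)) => [[m hm]|hne]; last first.
  by apply: generic => // i hi; apply: hne; exists i.
apply: (@continuous_eq_of_dense (schlomilch j) rhs) => //.
- by case: (schlomilch_derive j x0).
- exact: cR.
move=> e e0.
(* Kinks are [2 PI] apart, so [d <= PI] puts [x + d] strictly between two of them; the last bound
   keeps it inside the range covered by [M]. *)
pose d := Rmin (e / 2) (Rmin PI ((2 * PI * INR M.+1 - x) / 2)).
have d0 : 0 < d by apply: Rmin_pos; [|apply: Rmin_pos]; lra.
have d1 : d <= e / 2 := Rmin_l _ _.
have d2 : d <= PI by apply: Rle_trans (Rmin_r _ _) (Rmin_l _ _).
have d3 : d <= (2 * PI * INR M.+1 - x) / 2 by apply: Rle_trans (Rmin_r _ _) (Rmin_r _ _).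
exists (x + d); split.
  by rewrite (_ : x + d - x = d); [rewrite Rabs_right; lra|ring].
apply: generic; first lra.
move=> i hi; rewrite hm in hi.
have lo : INR m.+1 < INR i.+1 by nra.
have hi2 : INR i.+1 < INR m.+2 by rewrite (S_INR m.+1); nra.
have l1 := INR_lt _ _ lo; have l2 := INR_lt _ _ hi2.
lia.
Qed.

(** * Squarefree sums and Euler products *)

Definition sqfree (d : nat) : bool :=
  (0 < d)%N && all (fun p => ~~ (p ^ 2 %| d)%N) (primes d).

Lemma sqfreeP (d : nat) :
  reflect ((0 < d)%N /\ forall p, prime p -> ~~ (p ^ 2 %| d)%N) (sqfree d).
Proof.
apply: (iffP andP) => [[d0 /allP h]|[d0 h]]; split => //.
  move=> p pp; apply/negP => hp.
  have /h : p \in primes d by rewrite mem_primes pp d0 (dvdn_trans _ hp) // expnS dvdn_mulr.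
  by rewrite hp.
by apply/allP => p; rewrite mem_primes => /andP [pp _]; exact: h.
Qed.

Lemma mobius_sqr (d : nat) : IZR (mobius d) ^ 2 = if sqfree d then 1 else 0.
Proof.
rewrite /mobius /sqfree; case: ifP => _; last by rewrite /=; ring.
rewrite -pow_IZR -pow_mult Nat.mul_comm pow_mult (_ : IZR (-1) ^ 2 = 1) ?pow1 //.
by rewrite /=; ring.
Qed.

Lemma QfE (d : nat) : Qf d = if sqfree d then \big[Rmult/1]_(p <- primes d) local_weight p else 0.
Proof. by rewrite /Qf mobius_sqr; case: ifP => _; ring. Qed.

Lemma sqfree_mul (p d : nat) : prime p -> ~~ (p %| d)%N -> sqfree (p * d) = sqfree d.
Proof.
move=> pp pd; have p0 := prime_gt0 pp.
apply/sqfreeP/sqfreeP => [[d0 h]|[d0 h]].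
  split; first by move: d0; rewrite muln_gt0 => /andP [].
  by move=> q qp; apply: contra (h q qp) => hq; rewrite dvdn_mull.
split; first by rewrite muln_gt0 p0.
move=> q qp; case: (eqVneq q p) => [->|qnp].
  by rewrite expnS expn1 dvdn_pmul2l.
rewrite Gauss_dvdr; first exact: h.
by rewrite coprimeXl // prime_coprime // dvdn_prime2.
Qed.

Lemma perm_primes_mul (p d : nat) : prime p -> (0 < d)%N -> ~~ (p %| d)%N ->
  perm_eq (primes (p * d)) (p :: primes d).
Proof.
move=> pp d0 pd; apply: uniq_perm; first exact: primes_uniq.
  by rewrite /= primes_uniq mem_primes pp d0 (negbTE pd).
by move=> q; rewrite (primesM _ (prime_gt0 pp) d0) primes_prime // !inE.
Qed.

Lemma Qf_mul (p d : nat) : prime p -> (0 < d)%N -> ~~ (p %| d)%N ->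
  Qf (p * d) = local_weight p * Qf d.
Proof.
move=> pp d0 pd; rewrite !QfE sqfree_mul //; case: ifP => _; last by ring.
by rewrite (perm_big _ (perm_primes_mul pp d0 pd)) big_cons.
Qed.

Lemma Qf1 : Qf 1 = 1.
Proof. by rewrite QfE /= big_nil. Qed.

(** The products over all subsets of [ps], in the order in which [(1 + x_p)] factors expand; for
    distinct primes these are the squarefree numbers supported on [ps]. *)
Fixpoint sqfree_list (ps : seq nat) : seq nat :=
  match ps with
  | [::] => [:: 1%N]
  | p :: qs => sqfree_list qs ++ [seq (p * d)%N | d <- sqfree_list qs]
  end.

Lemma sqfree_list_mem (ps : seq nat) : uniq ps -> all prime ps ->
  forall d, d \in sqfree_list ps -> sqfree d /\ {subset primes d <= ps}.
Proof.
elim: ps => [|p ps IH] /=; first by move=> _ _ d; rewrite inE => /eqP ->.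
move=> /andP [pps ups] /andP [pp aps] d; rewrite mem_cat => /orP [hd|/mapP [e he ->]].
  have [h1 h2] := IH ups aps d hd; split => // q /h2 hq; by rewrite inE hq orbT.
have [h1 h2] := IH ups aps e he.
have e0 : (0 < e)%N by case/sqfreeP: h1.
have pe : ~~ (p %| e)%N.
  by apply: contra pps => h; apply: h2; rewrite mem_primes pp e0 h.
split; first by rewrite sqfree_mul.
move=> q; rewrite (perm_mem (perm_primes_mul pp e0 pe)) !inE => /orP [->//|/h2 ->].
by rewrite orbT.
Qed.

Lemma sqfree_list_coprime (p : nat) (ps : seq nat) (d : nat) :
  uniq (p :: ps) -> all prime (p :: ps) -> d \in sqfree_list ps ->
  (0 < d)%N /\ ~~ (p %| d)%N.
Proof.
move=> /= /andP [pps ups] /andP [pp aps] hd.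
have [h1 h2] := sqfree_list_mem ups aps hd.
have d0 : (0 < d)%N by case/sqfreeP: h1.
split => //; apply: contra pps => h; apply: h2; by rewrite mem_primes pp d0 h.
Qed.

Lemma sqfree_list_uniq (ps : seq nat) : uniq ps -> all prime ps -> uniq (sqfree_list ps).
Proof.
elim: ps => [//|p ps IH] hu ha.
have /= /andP [pps ups] := hu; have /= /andP [pp aps] := ha.
rewrite cat_uniq IH // map_inj_uniq ?IH //; last first.
  by move=> a b /eqP; rewrite eqn_pmul2l ?prime_gt0 // => /eqP.
rewrite andbT; apply/hasPn => x /mapP [e he ->]; apply/negP => hx.
by have [_] := sqfree_list_coprime hu ha hx; rewrite dvdn_mulr.
Qed.

Lemma sqfree_list_complete (ps : seq nat) (d : nat) : uniq ps -> all prime ps ->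
  sqfree d -> {subset primes d <= ps} -> d \in sqfree_list ps.
Proof.
elim: ps d => [|p ps IH] d.
  move=> _ _ hd hs; have d0 : (0 < d)%N by case/sqfreeP: hd.
  rewrite inE; apply/eqP; apply/eqP; rewrite eqn_leq d0 andbT leqNgt; apply/negP => d1.
  by have /hs : pdiv d \in primes d by rewrite pi_pdiv.
move=> /= /andP [pps ups] /andP [pp aps] hd hs.
have d0 : (0 < d)%N by case/sqfreeP: hd.
rewrite mem_cat; case: (boolP (p %| d)%N) => hp; last first.
  rewrite IH // => q hq; have := hs q hq; rewrite inE => /orP [/eqP e|//].
  by move: hq; rewrite e mem_primes (negbTE hp) !andbF.
apply/orP; right; apply/mapP.
case/dvdnP: hp => e he; rewrite mulnC in he; exists e => //.
have e0 : (0 < e)%N by move: d0; rewrite he muln_gt0 => /andP [].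
have pe : ~~ (p %| e)%N.
  have /sqfreeP [_ /(_ p pp)] := hd; apply: contra => h.
  by rewrite he expnS expn1 dvdn_pmul2l ?prime_gt0.
apply: IH => //; first by rewrite he sqfree_mul in hd.
move=> q hq; have := hs q; rewrite he (perm_mem (perm_primes_mul pp e0 pe)) !inE hq orbT => /(_ erefl).
move=> /orP [/eqP e1|//]; move: hq; by rewrite e1 mem_primes (negbTE pe) !andbF.
Qed.

Lemma sum_sqfree_list (h : nat -> R) (ps : seq nat) : uniq ps -> all prime ps ->
  h 1%N = 1 -> (forall a b, h (a * b)%N = h a * h b) ->
  \big[Rplus/0]_(d <- sqfree_list ps) (Qf d * h d) = \big[Rmult/1]_(p <- ps) (1 + local_weight p * h p).
Proof.
move=> hu ha h1 hM; elim: ps hu ha => [|p ps IH] hu ha.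
  by rewrite /= big_nil big_seq1 Qf1 h1 Rmult_1_l.
have /= /andP [pps ups] := hu; have /= /andP [pp aps] := ha.
rewrite big_cat big_map big_cons -IH //=.
rewrite [X in _ + X](_ : _ = local_weight p * h p * \big[Rplus/0]_(d <- sqfree_list ps) (Qf d * h d)).
  by ring.
rewrite big_distrr /= big_seq [in RHS]big_seq; apply: eq_bigr => d hd.
have [d0 pd] := sqfree_list_coprime hu ha hd.
by rewrite Qf_mul // hM; ring.
Qed.

Lemma sqfree_list_dvd (ps : seq nat) (r : nat) : uniq ps -> all prime ps ->
  all (fun p => p %| r)%N ps -> forall d, d \in sqfree_list ps -> (d %| r)%N.
Proof.
elim: ps => [|p ps IH] hu ha hr d; first by rewrite inE => /eqP ->; exact: dvd1n.
have /= /andP [pps ups] := hu; have /= /andP [pp aps] := ha; have /= /andP [pr apr] := hr.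
rewrite /= mem_cat => /orP [hd|/mapP [e he ->]]; first exact: IH.
have [e0 pe] := sqfree_list_coprime hu ha he.
by rewrite Gauss_dvd ?prime_coprime // pr IH.
Qed.

(** The squarefree divisors of [r] are exactly the entries of [sqfree_list (primes r)], and [Qf]
    vanishes at its other divisors; the expanded product with weight 1 is [nuf r]. *)
Lemma nuf_sum (r : nat) : (0 < r)%N ->
  nuf r = \big[Rplus/0]_(1 <= d < r.+1 | (d %| r)%N) Qf d.
Proof.
move=> r0.
have ap : all prime (primes r) by apply/allP => p; rewrite mem_primes => /andP [].
have hp : perm_eq (sqfree_list (primes r)) [seq d <- index_iota 1 r.+1 | (d %| r)%N && sqfree d].
  apply: uniq_perm; first by apply: sqfree_list_uniq => //; exact: primes_uniq.
    by apply: filter_uniq; exact: iota_uniq.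
  move=> d; rewrite mem_filter mem_index_iota; apply/idP/idP.
    move=> hd; have [h1 h2] := sqfree_list_mem (primes_uniq r) ap hd.
    have dr : (d %| r)%N.
      apply: (sqfree_list_dvd (primes_uniq r) ap _ hd).
      by apply/allP => p; rewrite mem_primes => /and3P [].
    have d0 : (0 < d)%N by case/sqfreeP: h1.
    by rewrite dr h1 d0 ltnS dvdn_leq.
  move=> /andP [/andP [dr sd] _]; apply: sqfree_list_complete => //; first exact: primes_uniq.
  by move=> p; rewrite !mem_primes r0 => /and3P [-> _ /dvdn_trans /(_ dr) ->].
transitivity (\big[Rplus/0]_(d <- sqfree_list (primes r)) (Qf d * 1)).
  rewrite (sum_sqfree_list (h := fun _ => 1)) ?primes_uniq //; last by move=> *; ring.
  by apply: eq_bigr => p _; rewrite Rmult_1_r.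
rewrite (perm_big _ hp) big_filter [in RHS]big_mkcond [LHS]big_mkcond /=.
by apply: eq_bigr => d _; rewrite QfE; case: (d %| r)%N; case: (sqfree d) => //=; ring.
Qed.

Lemma big_nonneg (I : Type) (s : seq I) (g : I -> R) : (forall i, 0 <= g i) ->
  0 <= \big[Rplus/0]_(i <- s) g i.
Proof.
move=> hg; elim: s => [|x s IH]; first by rewrite big_nil; lra.
by rewrite big_cons; have := hg x; lra.
Qed.

Lemma big_subset_le (s t : seq nat) (g : nat -> R) : (forall d, 0 <= g d) ->
  uniq s -> {subset s <= t} -> \big[Rplus/0]_(d <- s) g d <= \big[Rplus/0]_(d <- t) g d.
Proof.
move=> hg; elim: s t => [|x s IH] t; first by rewrite big_nil => _ _; exact: big_nonneg.
move=> /= /andP [xs us] hst.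
have xt : x \in t by apply: hst; rewrite inE eqxx.
rewrite (perm_big _ (perm_to_rem xt)) !big_cons /=.
have := IH (rem x t) us.
have hs : {subset s <= rem x t}.
  move=> y ys; have yt : y \in t by apply: hst; rewrite inE ys orbT.
  move: yt; rewrite (perm_mem (perm_to_rem xt)) inE => /orP [/eqP e|//].
  by move: xs; rewrite -e ys.
by move=> /(_ hs); lra.
Qed.

Lemma sum_uniq_le_Series (s : seq nat) (g : nat -> R) : (forall d, 0 <= g d) ->
  uniq s -> all (fun d => 0 < d)%N s -> ex_series (fun i => g i.+1) ->
  \big[Rplus/0]_(d <- s) g d <= Series (fun i => g i.+1).
Proof.
move=> hg us hs ex.
have h1 : \big[Rplus/0]_(d <- s) g d <= \big[Rplus/0]_(1 <= d < (sumn s).+2) g d.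
  apply: big_subset_le => // d hd; rewrite mem_index_iota (allP hs d hd) /=.
  rewrite ltnS leqW //.
  elim: s hd {us hs} => [//|x s IH]; rewrite inE /= => /orP [/eqP ->|/IH h]; first exact: leq_addr.
  by apply: leq_trans h _; exact: leq_addl.
apply: Rle_trans h1 _.
rewrite big_add1 /= big_mkord -(sum_n_big (fun i => g i.+1)).
have := @Series_tail_le (fun i => g i.+1) (fun i => g i.+1) (sumn s) _ ex.
have h0 i : Rabs (g i.+1) <= g i.+1 by rewrite Rabs_right; [lra|apply: Rle_ge].
by move=> /(_ h0); have := Rabs_pos (Series (fun i => g i.+1) - sum_n (fun i => g i.+1) (sumn s)); lra.
Qed.

(** * Size of Q and Euler products *)

Definition quartic (x : R) : R := x ^ 4 - 2 * x ^ 2 - x + 1.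

(** [7 / 16] is the value of [quartic x / x ^ 4] at the smallest prime, [x = 2]. *)
Lemma quartic_ge (x : R) : 2 <= x -> 7 / 16 * x ^ 4 <= quartic x.
Proof.
move=> hx; rewrite /quartic.
have h2 : 4 <= x * x by nra.
have -> : x ^ 4 = (x * x) * (x * x) by ring.
have -> : x ^ 2 = x * x by ring.
nra.
Qed.

Lemma quartic_gt0 (x : R) : 2 <= x -> 0 < quartic x.
Proof.
move=> hx; have := quartic_ge hx; have : 0 < x ^ 4 by apply: pow_lt; lra.
lra.
Qed.

Lemma INR_prime_ge2 (p : nat) : prime p -> 2 <= INR p.
Proof. by move=> /prime_gt1 h; apply: (le_INR 2); lia. Qed.

Lemma local_weight_gt0 (p : nat) : prime p -> 0 < local_weight p.
Proof.
move=> /INR_prime_ge2 h; apply: Rdiv_lt_0_compat; last exact: quartic_gt0.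
by apply: pow_lt; lra.
Qed.

Lemma Qf_ge0 (d : nat) : 0 <= Qf d.
Proof.
rewrite QfE; case: ifP => _; last lra.
have : all prime (primes d) by apply/allP => p; rewrite mem_primes => /andP [].
elim: (primes d) => [|p s IH] /=; first by rewrite big_nil; lra.
by move=> /andP [/local_weight_gt0 h1 /IH h2]; rewrite big_cons; nra.
Qed.

(** The excess over 1 is [(2 x ^ 2 + x - 1) / quartic x], at most [7 / x ^ 2] because
    [2 x ^ 2 + x - 1 <= 7 * 7 / 16 * x ^ 2]. The exponential form turns the product over [p]
    dividing [d] into a sum of [1 / p ^ 2]. *)
Lemma local_ratio_bounds (p : nat) : prime p ->
  1 <= INR p ^ 2 * local_weight p <= exp (7 * / INR p ^ 2).
Proof.
move=> /INR_prime_ge2; rewrite /local_weight -/(quartic (INR p)); move: (INR p) => x hx.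
have q0 := quartic_gt0 hx; have q1 := quartic_ge hx.
have i0 := Rinv_0_lt_compat _ q0.
have x2 : 0 < x ^ 2 by apply: pow_lt; lra.
have e1 : x ^ 2 * (x ^ 2 / quartic x) = 1 + (2 * x ^ 2 + x - 1) / quartic x.
  have -> : x ^ 2 * (x ^ 2 / quartic x) = x ^ 4 / quartic x by field; lra.
  have -> : x ^ 4 = quartic x + (2 * x ^ 2 + x - 1) by rewrite /quartic; ring.
  by field; lra.
rewrite e1.
have p1 : 0 <= (2 * x ^ 2 + x - 1) / quartic x by apply: Rdiv_le_0_compat => //; nra.
split; first lra.
apply: Rle_trans; last exact: exp_ineq1_le.
apply: Rplus_le_compat_l.
apply: (Rmult_le_reg_r (quartic x)) => //.
have -> : (2 * x ^ 2 + x - 1) / quartic x * quartic x = 2 * x ^ 2 + x - 1 by field; lra.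
apply: (Rle_trans _ (7 * / x ^ 2 * (7 / 16 * x ^ 4))).
  have -> : 7 * / x ^ 2 * (7 / 16 * x ^ 4) = 49 / 16 * x ^ 2 by field; lra.
  nra.
apply: Rmult_le_compat_l => //; have := Rinv_0_lt_compat _ x2; lra.
Qed.

Lemma sqfree_list_bounds (ps : seq nat) (d : nat) : uniq ps -> all prime ps ->
  d \in sqfree_list ps ->
  1 <= INR d ^ 2 * Qf d <= exp (7 * \big[Rplus/0]_(p <- ps) / INR p ^ 2).
Proof.
elim: ps d => [|p ps IH] d hu ha.
  rewrite inE => /eqP ->; rewrite Qf1 big_nil Rmult_0_r exp_0 /=; lra.
have /= /andP [pps ups] := hu; have /= /andP [pp aps] := ha.
have [w1 w2] := local_ratio_bounds pp.
rewrite big_cons Rmult_plus_distr_l exp_plus.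
rewrite mem_cat => /orP [hd|/mapP [e he ->]].
  have := IH d ups aps hd; move: (exp _) (exp _) w2 => a b; nra.
have [e0 pe] := sqfree_list_coprime hu ha he.
rewrite Qf_mul // (_ : INR (p * e) = INR p * INR e); last exact: mult_INR.
have := IH e ups aps he.
have -> : (INR p * INR e) ^ 2 * (local_weight p * Qf e) = (INR p ^ 2 * local_weight p) * (INR e ^ 2 * Qf e) by ring.
move: (exp _) (exp _) w2 => a b; nra.
Qed.

(** The primes dividing [d] are distinct, so their inverse squares add up to at most [zeta(2)]. *)
Lemma Qf_bounds (d : nat) : sqfree d ->
  1 <= INR d ^ 2 * Qf d <= exp (7 * (PI ^ 2 / 6)).
Proof.
move=> sd.
have ap : all prime (primes d) by apply/allP => p; rewrite mem_primes => /andP [].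
have hd : d \in sqfree_list (primes d) by apply: sqfree_list_complete => //; exact: primes_uniq.
have [h1 h2] := sqfree_list_bounds (primes_uniq d) ap hd.
split => //; apply: Rle_trans h2 _.
have : \big[Rplus/0]_(p <- primes d) / INR p ^ 2 <= PI ^ 2 / 6.
  rewrite -zeta2; apply: (@sum_uniq_le_Series _ (fun d => / INR d ^ 2)).
  - move=> [|n]; last by apply: Rlt_le; apply: Rinv_0_lt_compat; apply: pow_lt; exact: INRS_gt0.
    by rewrite /= Rmult_0_l Rinv_0; lra.
  - exact: primes_uniq.
  - by apply/allP => p /(allP ap) /prime_gt0.
  - exact: ex_series_inv_sqr.
move=> h; case: (Rle_lt_or_eq_dec _ _ h) => [h'|->]; last lra.
by apply: Rlt_le; apply: exp_increasing; lra.
Qed.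

Lemma Qf_upper : exists C, 0 < C /\ forall d, (0 < d)%N -> Qf d <= C / INR d ^ 2.
Proof.
exists (exp (7 * (PI ^ 2 / 6))); split; first exact: exp_pos.
move=> d d0; have x0 : 0 < INR d by apply: lt_0_INR; lia.
have x2 : 0 < INR d ^ 2 by apply: pow_lt.
case: (boolP (sqfree d)) => sd; last first.
  by rewrite QfE (negbTE sd); apply: Rdiv_le_0_compat => //; apply: Rlt_le; exact: exp_pos.
have [_ h] := Qf_bounds sd.
apply: (Rmult_le_reg_l (INR d ^ 2)) => //.
by have -> : INR d ^ 2 * (exp (7 * (PI ^ 2 / 6)) / INR d ^ 2) = exp (7 * (PI ^ 2 / 6)) by field; lra.
Qed.

Lemma ex_series_Qf : ex_series (fun i => Qf i.+1).
Proof.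
have [C [C0 hC]] := Qf_upper.
apply: ex_series_le (ex_series_scal_l C _ ex_series_inv_sqr) => n.
rewrite /norm [X in X <= _]/= /abs [X in X <= _]/= /scal /= /mult /= -/(INR n.+1).
rewrite Rabs_right; last by apply: Rle_ge; exact: Qf_ge0.
exact: (hC n.+1).
Qed.

(** The product over primes below [N] is the sum over squarefree [d] with all prime factors below
    [N]. As the terms are nonnegative, it lies between the sum over [d < N] and the full series. *)
Lemma Euler_product (h : nat -> R) :
  (forall d, 0 <= h d) -> h 1%N = 1 -> (forall a b, h (a * b)%N = h a * h b) ->
  ex_series (fun i => Qf i.+1 * h i.+1) ->
  is_lim_seq (fun N => \big[Rmult/1]_(0 <= p < N | prime p) (1 + local_weight p * h p))
    (Series (fun i => Qf i.+1 * h i.+1)).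
Proof.
move=> h0 h1 hM ex.
pose g d := Qf d * h d.
have g0 d : 0 <= g d by apply: Rmult_le_pos => //; exact: Qf_ge0.
pose ps N := [seq p <- index_iota 0 N | prime p].
have ups N : uniq (ps N) by apply: filter_uniq; exact: iota_uniq.
have aps N : all prime (ps N) by apply: filter_all.
have e N : \big[Rmult/1]_(0 <= p < N | prime p) (1 + local_weight p * h p) = \big[Rplus/0]_(d <- sqfree_list (ps N)) g d.
  by rewrite sum_sqfree_list // big_filter.
apply/(is_lim_seq_incr_n _ 2).
apply: (is_lim_seq_le_le (sum_n (fun i => g i.+1)) _ (fun _ => Series (fun i => g i.+1))).
- move=> N; rewrite (_ : (N + 2)%coq_nat = N.+2); last by lia.
  rewrite e; split; last first.
    apply: sum_uniq_le_Series => //; first exact: sqfree_list_uniq.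
    by apply/allP => d hd; have [/sqfreeP []] := sqfree_list_mem (ups _) (aps _) hd.
  have -> : sum_n (fun i => g i.+1) N = \big[Rplus/0]_(1 <= d < N.+2) g d.
    by rewrite sum_n_big big_add1 /= big_mkord.
  rewrite (bigID sqfree) /= [X in _ + X]big1 ?Rplus_0_r; last first.
    by move=> i /negbTE hi; rewrite /g QfE hi Rmult_0_l.
  rewrite -big_filter; apply: big_subset_le => //; first by apply: filter_uniq; exact: iota_uniq.
  move=> d; rewrite mem_filter mem_index_iota => /andP [sd /andP [d0 dN]].
  apply: sqfree_list_complete => // p; rewrite mem_primes mem_filter mem_index_iota => /and3P [-> _ pd] /=.
  exact: leq_ltn_trans (dvdn_leq d0 pd) dN.
- exact: Series_correct.
- exact: is_lim_seq_const.
Qed.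

(** * The Euler product of zeta(2) by sieving *)

Lemma big_dvdn (p J : nat) (g : nat -> R) : (0 < p)%N ->
  \big[Rplus/0]_(0 <= i < p * J) (if (p %| i.+1)%N then g i.+1 else 0)
    = \big[Rplus/0]_(0 <= i < J) g (p * i.+1)%N.
Proof.
move=> p0; elim: J => [|J IH]; first by rewrite muln0 !big_nil.
rewrite [RHS]big_nat_recr //= -IH mulnS addnC.
rewrite (big_cat_nat (leq0n (p * J)) (leq_addr p (p * J))) /=; congr (_ + _).
case: p p0 {IH} => [//|q] _.
rewrite addnS big_nat_recr ?leq_addr //= big_nat_cond big1 ?Rplus_0_l.
  by rewrite (_ : (q.+1 * J + q).+1 = q.+1 * J.+1)%N ?dvdn_mulr //; lia.
move=> i /andP [/andP [i1 i2] _]; case: ifP => // hd.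
have : (q.+1 %| i.+1 - q.+1 * J)%N by apply: dvdn_sub => //; exact: dvdn_mulr.
by move=> /dvdn_leq h; exfalso; have := h _; lia.
Qed.

Lemma is_series_dvdn (p : nat) (g : nat -> R) : (0 < p)%N ->
  ex_series (fun i => if (p %| i.+1)%N then g i.+1 else 0) ->
  is_series (fun i => g (p * i.+1)%N) (Series (fun i => if (p %| i.+1)%N then g i.+1 else 0)).
Proof.
move=> p0 ex.
pose a i := if (p %| i.+1)%N then g i.+1 else 0.
have h1 : is_lim_seq (sum_n a) (Series a) by apply: (Series_correct a).
change (is_lim_seq (sum_n (fun i => g (p * i.+1)%N)) (Series a)).
(* Index [i] stands for the integer [i + 1], so the first [J + 1] multiples of [p] are exhausted at
   index [p * (J + 1) - 1]. *)
apply: (is_lim_seq_ext (fun J => sum_n a (p * J.+1).-1)).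
  move=> J; rewrite !sum_n_big.
  rewrite -(big_mkord xpredT a) -(big_mkord xpredT (fun i => g (p * i.+1)%N)) prednK; last by rewrite muln_gt0 p0.
  exact: big_dvdn.
apply: (is_lim_seq_subseq (sum_n a) (Series a) (fun J => (p * J.+1).-1)) => //.
apply: eventually_subseq => n; rewrite -/(n.+2).
by apply/ltP; have := p0; nia.
Qed.

(** The sieve of Eratosthenes. The series for [zeta(2)] runs over all integers, so the squarefree
    expansion does not apply; instead the primes are removed one at a time. *)
Definition sifted (N n : nat) : bool := all (fun p => ~~ ((prime p) && (p %| n)%N)) (seq.iota 0 N).

Lemma siftedS (N n : nat) : sifted N.+1 n = sifted N n && ~~ (prime N && (N %| n)%N).
Proof. by rewrite /sifted -addn1 iotaD all_cat /= add0n andbT. Qed.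

Lemma sifted_mul (N n : nat) : prime N -> sifted N (N * n) = sifted N n.
Proof.
move=> pN; rewrite /sifted; apply: eq_in_all => p; rewrite mem_iota add0n => /andP [_ pN'].
case: (boolP (prime p)) => //= pp; rewrite Euclid_dvdM // dvdn_prime2 //.
by rewrite (ltn_eqF pN').
Qed.

Definition sift_sum (N : nat) : R := Series (fun i => if sifted N i.+1 then / INR i.+1 ^ 2 else 0).

Lemma inv_sqr_gt0 (i : nat) : 0 < / INR i.+1 ^ 2.
Proof. by apply: Rinv_0_lt_compat; apply: pow_lt; exact: INRS_gt0. Qed.

Lemma inv_sqr_if_le (b : bool) (i : nat) : Rabs (if b then / INR i.+1 ^ 2 else 0) <= / INR i.+1 ^ 2.
Proof.
have h := inv_sqr_gt0 i; case: b; first by rewrite Rabs_right; lra.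
by rewrite Rabs_R0; lra.
Qed.

Lemma ex_series_inv_sqr_if (P : nat -> bool) :
  ex_series (fun i => if P i.+1 then / INR i.+1 ^ 2 else 0).
Proof. by apply: ex_series_le ex_series_inv_sqr => n; exact: inv_sqr_if_le. Qed.

(** The multiples of a prime [N] that survive the smaller primes are [N] times such survivors, so
    removing them subtracts the fraction [/ N ^ 2]. *)
Lemma sift_sumS (N : nat) :
  sift_sum N.+1 = if prime N then (1 - / INR N ^ 2) * sift_sum N else sift_sum N.
Proof.
case: ifP => pN; last first.
  by apply: Series_ext => i; rewrite siftedS pN /= andbT.
have p0 := prime_gt0 pN.
have N0 : 0 < INR N by apply: lt_0_INR; lia.
pose g n := if sifted N n then / INR n ^ 2 else 0.
have ex1 : ex_series (fun i => if (N %| i.+1)%N then g i.+1 else 0).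
  apply: ex_series_ext (ex_series_inv_sqr_if (fun n => (N %| n)%N && sifted N n)) => i.
  by rewrite /g; case: (N %| _)%N.
have h1 := is_series_unique _ _ (is_series_dvdn p0 ex1).
have h2 : Series (fun i => g (N * i.+1)%N) = / INR N ^ 2 * sift_sum N.
  rewrite /sift_sum -Series_scal_l; apply: Series_ext => i; rewrite /g sifted_mul //.
  case: ifP => _; last by ring.
  rewrite (_ : INR (N * i.+1) = INR N * INR i.+1); last exact: mult_INR.
  by have := INRS_gt0 i => ?; field; lra.
have -> : (1 - / INR N ^ 2) * sift_sum N = sift_sum N - / INR N ^ 2 * sift_sum N by ring.
rewrite -h2 h1 /sift_sum -Series_minus //; last exact: ex_series_inv_sqr_if.
apply: Series_ext => i; rewrite siftedS pN /= /g.
by case: (sifted N i.+1); case: (N %| i.+1)%N => /=; ring.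
Qed.

Lemma big_prime_recr (F : nat -> R) (N : nat) :
  \big[Rmult/1]_(0 <= p < N.+1 | prime p) F p =
  \big[Rmult/1]_(0 <= p < N | prime p) F p * (if prime N then F N else 1).
Proof. by rewrite big_mkcond big_nat_recr //= -big_mkcond. Qed.

Lemma sift_sum_prod (N : nat) :
  sift_sum N = \big[Rmult/1]_(0 <= p < N | prime p) (1 - / INR p ^ 2) * (PI ^ 2 / 6).
Proof.
elim: N => [|N IH]; first by rewrite big_nil Rmult_1_l -zeta2.
by rewrite sift_sumS big_prime_recr IH; case: ifP => _; ring.
Qed.

(** Every integer from 2 to [m + 1] has a prime factor below [m + 2], so among the first [m + 1]
    terms only [n = 1] survives; the rest is at most a tail of [zeta(2)]. *)
Lemma sift_sum_lim : is_lim_seq sift_sum 1.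
Proof.
apply/(is_lim_seq_incr_n _ 2).
apply: (is_lim_seq_le_le (fun m => 1 - (PI ^ 2 / 6 - sum_n (fun i => / INR i.+1 ^ 2) m)) _
   (fun m => 1 + (PI ^ 2 / 6 - sum_n (fun i => / INR i.+1 ^ 2) m))).
- move=> m; rewrite (_ : (m + 2)%coq_nat = m.+2); last by lia.
  have := @Series_tail_le (fun i => if sifted m.+2 i.+1 then / INR i.+1 ^ 2 else 0) _ m (fun i => inv_sqr_if_le _ i) ex_series_inv_sqr.
  rewrite -/(sift_sum _) zeta2.
  rewrite [X in Rabs (_ - X)](_ : _ = 1).
    by move=> /Rabs_le_between; lra.
  rewrite sum_n_big big_ord_recl big1 /=.
    rewrite (_ : sifted m.+2 1 = true); first by rewrite Rplus_0_r !Rmult_1_l Rinv_1.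
    by apply/allP => p _; rewrite dvdn1; case: eqP => [->|]; rewrite ?andbF.
  move=> [i hi] _ /=; case: ifP => // /allP h.
  have hm : pdiv i.+2 \in seq.iota 0 m.+2.
    by rewrite mem_iota add0n leq0n /= ltnS; apply: leq_trans (pdiv_leq _) _.
  by have := h _ hm; rewrite pdiv_prime // pdiv_dvd.
- rewrite [X in is_lim_seq _ X](_ : _ = Finite (1 - (PI ^ 2 / 6 - PI ^ 2 / 6))); last by congr Finite; ring.
  apply: is_lim_seq_minus'; first exact: is_lim_seq_const.
  apply: is_lim_seq_minus'; first exact: is_lim_seq_const.
  by rewrite -zeta2; apply: (Series_correct (fun i => / INR i.+1 ^ 2)); exact: ex_series_inv_sqr.
- rewrite [X in is_lim_seq _ X](_ : _ = Finite (1 + (PI ^ 2 / 6 - PI ^ 2 / 6))); last by congr Finite; ring.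
  apply: is_lim_seq_plus'; first exact: is_lim_seq_const.
  apply: is_lim_seq_minus'; first exact: is_lim_seq_const.
  by rewrite -zeta2; apply: (Series_correct (fun i => / INR i.+1 ^ 2)); exact: ex_series_inv_sqr.
Qed.

Lemma zeta_Euler :
  is_lim_seq (fun N => \big[Rmult/1]_(0 <= p < N | prime p) (1 - / INR p ^ 2)) (6 / PI ^ 2).
Proof.
have PI0 := PI_RGT_0.
apply: (is_lim_seq_ext (fun N => sift_sum N * (6 / PI ^ 2))).
  by move=> N; rewrite sift_sum_prod; field; lra.
rewrite [X in is_lim_seq _ X](_ : _ = Finite (1 * (6 / PI ^ 2))); last by rewrite Rmult_1_l.
by apply: is_lim_seq_mult'; [exact: sift_sum_lim|exact: is_lim_seq_const].
Qed.

(** * The constants alpha, beta and gamma *)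

Definition alpha_factor (p : R) : R := (1 - p - 2 * p ^ 2 + p ^ 4) / (p ^ 4 - 2 * p ^ 2 + p).

Lemma alphaC_eq : alphaC = 2 * PI * prime_product alpha_factor.
Proof. by []. Qed.

Lemma alpha_factor_bounds (x : R) : 2 <= x -> 0 < alpha_factor x <= 1.
Proof.
move=> hx; have q0 := quartic_gt0 hx; rewrite /quartic in q0.
have d0 : 0 < x ^ 4 - 2 * x ^ 2 + x by lra.
split; first by apply: Rdiv_lt_0_compat; lra.
apply: (Rmult_le_reg_r (x ^ 4 - 2 * x ^ 2 + x)) => //.
rewrite /alpha_factor /Rdiv Rmult_assoc Rinv_l; lra.
Qed.

(** With factors in [(0, 1]] the partial products decrease and stay nonnegative, hence converge. The
    limits for beta and gamma are derived from this one. *)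
Lemma alpha_lim :
  is_lim_seq (fun N => \big[Rmult/1]_(0 <= p < N | prime p) alpha_factor (INR p))
    (prime_product alpha_factor).
Proof.
pose u N := \big[Rmult/1]_(0 <= p < N | prime p) alpha_factor (INR p).
have u0 N : 0 <= u N.
  elim: N => [|N IH]; first by rewrite /u big_nil; lra.
  rewrite /u big_prime_recr -/(u N); case: ifP => pN; last lra.
  by have := alpha_factor_bounds (INR_prime_ge2 pN); nra.
have ex : ex_finite_lim_seq u.
  apply: (ex_finite_lim_seq_decr _ 0) => // N.
  rewrite /u big_prime_recr -/(u N); case: ifP => pN; last lra.
  by have := alpha_factor_bounds (INR_prime_ge2 pN); have := u0 N; nra.
by have := Lim_seq_correct' _ ex.
Qed.

Lemma prod_prime_split (F G H : nat -> R) (N : nat) :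
  (forall p, prime p -> F p = G p * H p) ->
  \big[Rmult/1]_(0 <= p < N | prime p) F p =
  \big[Rmult/1]_(0 <= p < N | prime p) G p * \big[Rmult/1]_(0 <= p < N | prime p) H p.
Proof. by move=> h; rewrite -big_split; apply: eq_bigr => p; exact: h. Qed.

Lemma quartic_factor_neq0 (x : R) : 2 <= x ->
  x <> 0 /\ -1 + x + x ^ 2 <> 0 /\ x ^ 4 - 2 * x ^ 2 - x + 1 <> 0 /\ x ^ 4 - 2 * x ^ 2 + x <> 0.
Proof.
move=> hx; have := quartic_gt0 hx; rewrite /quartic => q0.
by repeat split; nra.
Qed.

(** Factor by factor, beta is alpha times [1 + local_weight p]: cancel [p - 1] using [p^4 - 2 p^2 +
    p = p (p - 1) (p^2 + p - 1)] and [p^4 - p^2 - p + 1 = (p - 1) (p^3 + p^2 - 1)]. *)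
Lemma betaC_eq : betaC = alphaC * Series (fun i => Qf i.+1).
Proof.
have e1 : Series (fun i => Qf i.+1) = Series (fun i => Qf i.+1 * 1).
  by apply: Series_ext => i; rewrite Rmult_1_r.
have hE := @Euler_product (fun _ => 1) (fun _ => Rle_0_1) erefl (fun _ _ => esym (Rmult_1_r 1)) _.
have {}hE := hE (ex_series_ext _ _ (fun i => esym (Rmult_1_r _)) ex_series_Qf).
rewrite -e1 in hE.
rewrite /betaC alphaC_eq.
have -> : prime_product (fun p => (-1 + p ^ 2 + p ^ 3) / (p * (-1 + p + p ^ 2)))
   = prime_product alpha_factor * Series (fun i => Qf i.+1).
  rewrite {1}/prime_product (Lim_seq_ext _ (fun N =>
    \big[Rmult/1]_(0 <= p < N | prime p) alpha_factor (INR p) *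
    \big[Rmult/1]_(0 <= p < N | prime p) (1 + local_weight p * 1))).
    by rewrite (is_lim_seq_unique _ _ (is_lim_seq_mult' _ _ _ _ alpha_lim hE)).
  move=> N; apply: prod_prime_split => p pp.
  have := quartic_factor_neq0 (INR_prime_ge2 pp).
  rewrite /alpha_factor /local_weight; move: (INR p) => x [x1 [x2 [x3 x4]]].
  by field; repeat split; lra.
by ring.
Qed.

Lemma ex_series_Qf_div : ex_series (fun i => Qf i.+1 * / INR i.+1).
Proof.
apply: ex_series_le ex_series_Qf => i; rewrite /norm [X in X <= _]/= /abs [X in X <= _]/=.
have h := Qf_ge0 i.+1.
have i0 := Rinv_0_lt_compat _ (INRS_gt0 i).
have i1 : / INR i.+1 <= 1 by apply: Rinv_le1; rewrite S_INR; have := pos_INR i; lra.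
rewrite -/(INR i.+1) Rabs_right; nra.
Qed.

(** Factor by factor, gamma times [1 - 1 / p^2] is alpha times [1 + local_weight p / p], the
    numerator of the latter being [(p^2 - 1)^2]. Dividing by the Euler product of [1 / zeta(2)]
    gives [12 * PI ^ 2 / 6 = 2 * PI * PI]. *)
Lemma gammaC_eq : gammaC = alphaC * PI * Series (fun i => Qf i.+1 * / INR i.+1).
Proof.
have PI0 := PI_RGT_0.
have hE := @Euler_product (fun d => / INR d) _ _ _ ex_series_Qf_div.
have {}hE := hE _ Rinv_1 _.
have h1 d : 0 <= / INR d.
  case: d => [|d]; first by rewrite /= Rinv_0; lra.
  by apply: Rlt_le; apply: Rinv_0_lt_compat; exact: INRS_gt0.
have h2 a b : / INR (a * b)%N = / INR a * / INR b.
  by rewrite -Rinv_mult; congr (/ _); exact: mult_INR.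
have {}hE := hE h1 h2.
pose z N := \big[Rmult/1]_(0 <= p < N | prime p) (1 - / INR p ^ 2).
have z0 N : z N <> 0.
  elim: N => [|N IH]; first by rewrite /z big_nil; lra.
  rewrite /z big_prime_recr -/(z N); case: ifP => pN; last by rewrite Rmult_1_r.
  apply: Rmult_integral_contrapositive_currified => //.
  have hx := INR_prime_ge2 pN.
  have : / INR N ^ 2 <= / 4 by apply: Rinv_le_contravar; nra.
  lra.
have -> : gammaC = 12 * (prime_product alpha_factor * Series (fun i => Qf i.+1 * / INR i.+1) * (PI ^ 2 / 6)).
  rewrite /gammaC; congr (_ * _).
  rewrite {1}/prime_product (Lim_seq_ext _ (fun N =>
    \big[Rmult/1]_(0 <= p < N | prime p) alpha_factor (INR p) *
    \big[Rmult/1]_(0 <= p < N | prime p) (1 + local_weight p * / INR p) * / z N)).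
    have li : is_lim_seq (fun N => / z N) (PI ^ 2 / 6).
      have := is_lim_seq_inv _ _ zeta_Euler.
      rewrite (_ : Rbar_inv _ = Finite (PI ^ 2 / 6)); last by rewrite /=; congr Finite; field; lra.
      apply; move=> [] h; have : 0 < 6 / PI ^ 2 by apply: Rdiv_lt_0_compat; [lra|apply: pow_lt].
      by rewrite h; lra.
    by rewrite (is_lim_seq_unique _ _ (is_lim_seq_mult' _ _ _ _ (is_lim_seq_mult' _ _ _ _ alpha_lim hE) li)).
  move=> N; apply: (Rmult_eq_reg_r (z N)); last exact: z0.
  rewrite [RHS]Rmult_assoc Rinv_l ?Rmult_1_r; last exact: z0.
  rewrite /z -!big_split; apply: eq_bigr => p pp.
  have := quartic_factor_neq0 (INR_prime_ge2 pp).
  rewrite /alpha_factor /local_weight /=; move: (INR p) => x [x1 [x2 [x3 x4]]].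
  by field; repeat split; lra.
by rewrite alphaC_eq; field.
Qed.

(** * Double series *)

Definition inv_32 (d : nat) : R := / (INR d * sqrt (INR d)).

Definition sum_32 : R := Series (fun i => inv_32 i.+1).

Lemma inv_32_ge0 (d : nat) : 0 <= inv_32 d.
Proof.
rewrite /inv_32; case: d => [|d]; first by rewrite /= Rmult_0_l Rinv_0; lra.
have := INRS_gt0 d => h; have := sqrt_lt_R0 _ h => h2.
by apply: Rlt_le; apply: Rinv_0_lt_compat; nra.
Qed.

Lemma sum_32_ge (N : nat) : \big[Rplus/0]_(1 <= d < N) inv_32 d <= sum_32.
Proof.
apply: sum_uniq_le_Series; [exact: inv_32_ge0|exact: iota_uniq| |exact: ex_series_inv_32].
by apply/allP => d; rewrite mem_index_iota => /andP [].
Qed.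

Lemma sum_32_ge0 : 0 <= sum_32.
Proof. by have := sum_32_ge 0; rewrite big_geq. Qed.

(** Bessel and oscillating terms share this product majorant: [Q(d)] is [O(d^(-2))], and the decay
    [z^(-1/2)] turns it into [d^(-3/2)] and the factor [1 / s] into [s^(-3/2)]. *)
Definition dominated (a : nat -> nat -> R) (C : R) : Prop :=
  0 <= C /\ forall d s, (0 < d)%N -> (0 < s)%N -> Rabs (a d s) <= C * inv_32 d * inv_32 s.

Lemma dominated_inner (a : nat -> nat -> R) (C : R) (i : nat) : dominated a C ->
  ex_series (fun j => a i.+1 j.+1) /\
  Rabs (Series (fun j => a i.+1 j.+1)) <= C * inv_32 i.+1 * sum_32.
Proof.
move=> [C0 h].
have hM : ex_series (fun j => C * inv_32 i.+1 * inv_32 j.+1).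
  by apply: (ex_series_scal_l (V := R_NormedModule)); exact: ex_series_inv_32.
have ex : ex_series (fun j => Rabs (a i.+1 j.+1)).
  by apply: ex_series_le hM => n; rewrite /norm /= /abs /= Rabs_Rabsolu; exact: h.
split; first exact: ex_series_Rabs.
apply: Rle_trans (Series_Rabs _ ex) _.
rewrite /sum_32 -Series_scal_l; apply: Series_le => // n.
by split; [exact: Rabs_pos|exact: h].
Qed.

Lemma dominated_outer (a : nat -> nat -> R) (C : R) : dominated a C ->
  ex_series (fun i => Series (fun j => a i.+1 j.+1)) /\ Rabs (dsum a) <= C * sum_32 * sum_32.
Proof.
move=> h.
have hM : ex_series (fun i => C * sum_32 * inv_32 i.+1).
  by apply: (ex_series_scal_l (V := R_NormedModule)); exact: ex_series_inv_32.
have hb i : Rabs (Series (fun j => a i.+1 j.+1)) <= C * sum_32 * inv_32 i.+1.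
  by have [_] := dominated_inner i h; lra.
have ex : ex_series (fun i => Rabs (Series (fun j => a i.+1 j.+1))).
  by apply: ex_series_le hM => n; rewrite /norm /= /abs /= Rabs_Rabsolu; exact: hb.
split; first exact: ex_series_Rabs.
apply: Rle_trans (Series_Rabs _ ex) _.
rewrite {2}/sum_32 -Series_scal_l; apply: Series_le => // n.
by split; [exact: Rabs_pos|exact: hb].
Qed.

Lemma big_le_nat (F G : nat -> R) (N : nat) : (forall d, (0 < d)%N -> F d <= G d) ->
  \big[Rplus/0]_(1 <= d < N) F d <= \big[Rplus/0]_(1 <= d < N) G d.
Proof.
move=> h; rewrite !big_add1; elim: N.-1 => [|n IH]; first by rewrite !big_nil; lra.
by rewrite !big_nat_recr //=; have := h n.+1 isT; lra.
Qed.

Lemma dominated_abs (a : nat -> nat -> R) (C : R) : dominated a C -> abs_dsummable a.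
Proof.
move=> [C0 h]; have S0 := sum_32_ge0; exists (C * sum_32 * sum_32) => M N.
apply: (Rle_trans _ (\big[Rplus/0]_(1 <= d < M) (C * sum_32 * inv_32 d))).
  apply: big_le_nat => d d0.
  apply: (Rle_trans _ (\big[Rplus/0]_(1 <= s < N) (C * inv_32 d * inv_32 s))).
    by apply: big_le_nat => s s0; exact: h.
  rewrite -big_distrr /=; have := sum_32_ge N; have := inv_32_ge0 d => h1 h2.
  have : 0 <= C * inv_32 d by nra.
  nra.
by rewrite -big_distrr /=; apply: Rmult_le_compat_l; [nra|exact: sum_32_ge].
Qed.

Lemma dsum_minus (a b : nat -> nat -> R) (C1 C2 : R) : dominated a C1 -> dominated b C2 ->
  dsum (fun d s => a d s - b d s) = dsum a - dsum b.
Proof.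
move=> ha hb; rewrite /dsum -Series_minus.
- by apply: Series_ext => i; rewrite Series_minus //; [case: (dominated_inner i ha)|case: (dominated_inner i hb)].
- by case: (dominated_outer ha).
- by case: (dominated_outer hb).
Qed.

Lemma dsum_scal (a : nat -> nat -> R) (c : R) : dsum (fun d s => c * a d s) = c * dsum a.
Proof. by rewrite /dsum -Series_scal_l; apply: Series_ext => i; rewrite Series_scal_l. Qed.

(** * Majorants and error terms for the Bessel double series *)

Definition bessel_arg (y : R) (d s : nat) : R := 4 * PI * INR s * sqrt y / INR d.

Lemma INR_gt0 (d : nat) : (0 < d)%N -> 0 < INR d.
Proof. by move=> h; apply: lt_0_INR; lia. Qed.

Lemma bessel_arg_sqrt (y : R) (d s : nat) : 0 < y -> (0 < d)%N -> (0 < s)%N ->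
  0 < bessel_arg y d s /\
  sqrt (bessel_arg y d s) = sqrt (4 * PI * sqrt y) * sqrt (INR s) / sqrt (INR d).
Proof.
move=> y0 /INR_gt0 d0 /INR_gt0 s0; have q0 := sqrt_lt_R0 _ y0; have PI0 := PI_RGT_0.
have p0 : 0 < 4 * PI * sqrt y by nra.
split; first by apply: Rdiv_lt_0_compat => //; nra.
rewrite -sqrt_mult; try lra.
rewrite -sqrt_div; try nra.
by congr sqrt; rewrite /bessel_arg; field; lra.
Qed.

Lemma inv_32_sqrt (d : nat) : (0 < d)%N -> inv_32 d = sqrt (INR d) / INR d ^ 2.
Proof.
move=> /INR_gt0 d0; have s0 := sqrt_lt_R0 _ d0; have ss := sqrt_sqrt _ (Rlt_le _ _ d0).
rewrite /inv_32; apply: (Rmult_eq_reg_r (sqrt (INR d) * INR d ^ 2)); last by apply: Rgt_not_eq; apply: Rmult_lt_0_compat => //; exact: pow_lt.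
transitivity (INR d); first by field; lra.
rewrite -[LHS]ss; field; lra.
Qed.

Lemma kernel_dominated (F : R -> R) (K y : R) : 0 < y -> 0 <= K ->
  (forall z, 0 < z -> Rabs (F z) <= K / sqrt z) ->
  exists C, dominated (fun d s => Qf d * (F (bessel_arg y d s) / INR s)) C.
Proof.
move=> y0 K0 hF; have [C [C0 hC]] := Qf_upper.
have PI0 := PI_RGT_0; have q0 := sqrt_lt_R0 _ y0.
have p0 : 0 < sqrt (4 * PI * sqrt y) by apply: sqrt_lt_R0; nra.
exists (C * K / sqrt (4 * PI * sqrt y)); split.
  by apply: Rdiv_le_0_compat => //; nra.
move=> d s d0 s0; have [z0 hz] := bessel_arg_sqrt y0 d0 s0.
have h1 := hF _ z0; have h2 := hC d d0; have h3 := Qf_ge0 d.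
have D0 := INR_gt0 d0; have S0 := INR_gt0 s0.
have sD := sqrt_lt_R0 _ D0; have sS := sqrt_lt_R0 _ S0.
have iS := Rinv_0_lt_compat _ S0.
rewrite (Rabs_mult (Qf d)) (Rabs_mult (F _)) (Rabs_right (Qf d)) ?(Rabs_right (/ INR s)); try lra.
rewrite hz in h1.
have -> : C * K / sqrt (4 * PI * sqrt y) * inv_32 d * inv_32 s =
  (C / INR d ^ 2) * (K / (sqrt (4 * PI * sqrt y) * sqrt (INR s) / sqrt (INR d)) * / INR s).
  by rewrite inv_32_sqrt // /inv_32; field; lra.
apply: Rmult_le_compat => //; first by apply: Rmult_le_pos; [exact: Rabs_pos|lra].
by apply: Rmult_le_compat_r; lra.
Qed.

Lemma osc_dominated : exists C, forall y, dominated (osc_term y) C.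
Proof.
have [C [C0 hC]] := Qf_upper.
exists C => y; split; first lra.
move=> d s d0 s0; have h2 := hC d d0; have h3 := Qf_ge0 d.
have D0 := INR_gt0 d0; have S0 := INR_gt0 s0.
have sD := sqrt_lt_R0 _ D0; have sS := sqrt_lt_R0 _ S0.
have e : Rpower (INR s) (3 / 2) = INR s * sqrt (INR s).
  by rewrite (_ : 3 / 2 = 1 + / 2) ?Rpower_plus ?Rpower_1 ?Rpower_sqrt //; field.
have i0 := inv_32_ge0 s; have j0 := inv_32_ge0 d.
have -> : osc_term y d s = Qf d * sqrt (INR d) * inv_32 s * cos (4 * PI * INR s * sqrt y / INR d - 3 * PI / 4).
  by rewrite /osc_term e.
have p0 : 0 <= Qf d * sqrt (INR d) * inv_32 s by apply: Rmult_le_pos => //; nra.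
rewrite Rabs_mult Rabs_right; last lra.
have h4 : Qf d * sqrt (INR d) * inv_32 s <= C * inv_32 d * inv_32 s.
  apply: Rmult_le_compat_r => //; rewrite inv_32_sqrt //.
  have -> : C * (sqrt (INR d) / INR d ^ 2) = C / INR d ^ 2 * sqrt (INR d) by field; lra.
  by apply: Rmult_le_compat_r; lra.
by have := Rabs_cos_le1 (4 * PI * INR s * sqrt y / INR d - 3 * PI / 4); nra.
Qed.

Lemma osc_main (j : nat) (y : R) (d s : nat) : 0 < y -> (0 < d)%N -> (0 < s)%N ->
  Qf d * (bessel_main j (bessel_arg y d s) / INR s) =
  (-1) ^ j * (sqrt (2 / PI) / sqrt (4 * PI)) / sqrt (sqrt y) * osc_term y d s.
Proof.
move=> y0 d0 s0; have [z0 hz] := bessel_arg_sqrt y0 d0 s0.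
have D0 := INR_gt0 d0; have S0 := INR_gt0 s0.
have sD := sqrt_lt_R0 _ D0; have sS := sqrt_lt_R0 _ S0.
have PI0 := PI_RGT_0; have q0 := sqrt_lt_R0 _ y0; have qq0 := sqrt_lt_R0 _ q0.
have p0 : 0 < sqrt (4 * PI) by apply: sqrt_lt_R0; lra.
have e : Rpower (INR s) (3 / 2) = INR s * sqrt (INR s).
  by rewrite (_ : 3 / 2 = 1 + / 2) ?Rpower_plus ?Rpower_1 ?Rpower_sqrt //; field.
rewrite /bessel_main /osc_term hz e sqrt_mult; try lra.
rewrite -/(bessel_arg y d s); field; lra.
Qed.

(** Here [t = sqrt d] and [t' = sqrt (d - 1)]. The derivative in [d] of [8 / w^2 * t / (w + t)] is
    [4 / (w t (w + t)^2)], which dominates the minimum because [w + t] is at most twice the larger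
    of [w] and [t]; as it decreases in [d], the increment dominates too. *)
Lemma min_le_telescope (w t t' : R) : 0 < w -> 0 < t -> 0 <= t' -> t * t = t' * t' + 1 ->
  Rmin (/ (w * (t * t * t))) (/ (t * (w * w * w)))
    <= 8 / (w * w) * (t / (w + t)) - 8 / (w * w) * (t' / (w + t')).
Proof.
move=> w0 t0 t'0 e.
have tt : t' <= t by nra.
have h1 : 4 / (w * t * ((w + t) * (w + t))) <= 8 / (w * w) * (t / (w + t)) - 8 / (w * w) * (t' / (w + t')).
  have -> : 8 / (w * w) * (t / (w + t)) - 8 / (w * w) * (t' / (w + t')) = 8 * (t - t') / (w * ((w + t) * (w + t'))) by field; lra.
  have -> : t - t' = / (t + t').
    by apply: (Rmult_eq_reg_r (t + t')); [field_simplify; lra|lra].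
  have -> : 8 * / (t + t') / (w * ((w + t) * (w + t'))) = / w * (8 * / ((t + t') * ((w + t) * (w + t')))) by field; lra.
  have -> : 4 / (w * t * ((w + t) * (w + t))) = / w * (8 * / ((t + t) * ((w + t) * (w + t)))) by field; lra.
  apply: Rmult_le_compat_l; first by apply: Rlt_le; exact: Rinv_0_lt_compat.
  apply: Rmult_le_compat_l; first lra.
  apply: Rinv_le_contravar; first by apply: Rmult_lt_0_compat; nra.
  by apply: Rmult_le_compat; nra.
apply: Rle_trans h1.
case: (Rle_dec w t) => h.
- apply: Rle_trans (Rmin_l _ _) _.
  have -> : 4 / (w * t * ((w + t) * (w + t))) = / (w * t * ((w + t) * (w + t)) / 4) by field; lra.
  apply: Rinv_le_contravar; first by have : 0 < w * t; nra.
  have : (w + t) * (w + t) <= 4 * (t * t) by nra.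
  have : 0 < w * t by nra.
  nra.
- apply: Rle_trans (Rmin_r _ _) _.
  have -> : 4 / (w * t * ((w + t) * (w + t))) = / (w * t * ((w + t) * (w + t)) / 4) by field; lra.
  apply: Rinv_le_contravar; first by have : 0 < w * t; nra.
  have : (w + t) * (w + t) <= 4 * (w * w) by nra.
  have : 0 < w * t by nra.
  nra.
Qed.

(** With [w = sqrt (4 PI sqrt y)] and [t = sqrt d], [sqrt z] is [w * sqrt s / t]. The two decays of
    [F] give the two entries of the minimum, and either way the sum over [s] is at most a multiple
    of [sum_32]. The telescoped sum over [d] is bounded by a multiple of [8 / w ^ 2], whence
    [1 / sqrt y]. *)
Lemma kernel_error (F : R -> R) (K : R) : 0 <= K ->
  (forall z, 0 < z -> Rabs (F z) <= K / sqrt z /\ Rabs (F z) <= K / (z * sqrt z)) ->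
  exists C, 0 <= C /\ forall y, 0 < y ->
    Rabs (dsum (fun d s => Qf d * (F (bessel_arg y d s) / INR s))) <= C / sqrt y.
Proof.
move=> K0 hF; have [C [C0 hC]] := Qf_upper.
have PI0 := PI_RGT_0; have S320 := sum_32_ge0.
exists (C * K * sum_32 * (8 / (4 * PI))); split.
  by apply: Rmult_le_pos; [apply: Rmult_le_pos => //; nra|apply: Rdiv_le_0_compat; lra].
move=> y y0; have q0 := sqrt_lt_R0 _ y0.
pose a d s := Qf d * (F (bessel_arg y d s) / INR s).
have Y0 : 0 < 4 * PI * sqrt y by nra.
pose w := sqrt (4 * PI * sqrt y).
have w0 : 0 < w by exact: sqrt_lt_R0.
have ww : w * w = 4 * PI * sqrt y by apply: sqrt_sqrt; lra.
have [Cd hd] : exists C, dominated a C by apply: (kernel_dominated y0 K0) => z z0; case: (hF z z0).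
have inner i : Rabs (Series (fun j => a i.+1 j.+1)) <=
   C * K * sum_32 * Rmin (/ (w * (sqrt (INR i.+1) * sqrt (INR i.+1) * sqrt (INR i.+1)))) (/ (sqrt (INR i.+1) * (w * w * w))).
  have D0 := INRS_gt0 i; have sD := sqrt_lt_R0 _ D0; have ss := sqrt_sqrt _ (Rlt_le _ _ D0).
  set t := sqrt (INR i.+1) in sD ss *; set m := Rmin _ _.
  have ptw j : Rabs (a i.+1 j.+1) <= C * K * m * inv_32 j.+1.
    have S0 := INRS_gt0 j; have sS := sqrt_lt_R0 _ S0; have sss := sqrt_sqrt _ (Rlt_le _ _ S0).
    have S1 : 1 <= INR j.+1 by rewrite S_INR; have := pos_INR j; lra.
    have [z0 hz] := @bessel_arg_sqrt y i.+1 j.+1 y0 isT isT.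
    have [b1 b2] := hF _ z0.
    have iS := Rinv_0_lt_compat _ S0; have iS1 := Rinv_le1 S1.
    have h2 := hC i.+1 isT; have h3 := Qf_ge0 i.+1.
    have i320 := inv_32_ge0 j.+1.
    have ez : bessel_arg y i.+1 j.+1 = (w * sqrt (INR j.+1) / t) * (w * sqrt (INR j.+1) / t).
      by rewrite -(sqrt_sqrt _ (Rlt_le _ _ z0)) hz.
    rewrite hz -/w -/t in b1 b2.
    rewrite {2}ez in b2.
    have fb : Rabs (F (bessel_arg y i.+1 j.+1)) * / INR j.+1 <= K * (t * t * t * t) * m * inv_32 j.+1.
      have r1 : K / (w * sqrt (INR j.+1) / t) * / INR j.+1 = K * (t * t * t * t) * (/ (w * (t * t * t))) * inv_32 j.+1.
        by rewrite /inv_32; field; lra.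
      have r2 : K / (w * sqrt (INR j.+1) / t * (w * sqrt (INR j.+1) / t) * (w * sqrt (INR j.+1) / t)) * / INR j.+1
          <= K * (t * t * t * t) * (/ (t * (w * w * w))) * inv_32 j.+1.
        have -> : K / (w * sqrt (INR j.+1) / t * (w * sqrt (INR j.+1) / t) * (w * sqrt (INR j.+1) / t)) * / INR j.+1
          = K * (t * t * t * t) * (/ (t * (w * w * w))) * inv_32 j.+1 * / INR j.+1.
          by rewrite /inv_32 -[X in _ = _ * / (X * _) * _]sss; field; lra.
        have : 0 <= K * (t * t * t * t) * (/ (t * (w * w * w))) * inv_32 j.+1.
          apply: Rmult_le_pos => //; apply: Rmult_le_pos.
            by apply: Rmult_le_pos => //; apply: Rlt_le; do 3! (apply: Rmult_lt_0_compat => //).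
          by apply: Rlt_le; apply: Rinv_0_lt_compat; do 3! (apply: Rmult_lt_0_compat => //).
        by nra.
      rewrite /m; case: (Rmin_case_strong (/ (w * (t * t * t))) (/ (t * (w * w * w)))
        (fun v => v = / (w * (t * t * t)) \/ v = / (t * (w * w * w)))) => [_|_|->|->]; [by left|by right| |].
        by rewrite -r1; apply: Rmult_le_compat_r; lra.
      by apply: Rle_trans r2; apply: Rmult_le_compat_r; lra.
    rewrite /a (Rabs_mult (Qf _)) (Rabs_mult (F _)) (Rabs_right (Qf _)) ?(Rabs_right (/ INR j.+1)); try lra.
    apply: (Rle_trans _ (C / INR i.+1 ^ 2 * (K * (t * t * t * t) * m * inv_32 j.+1))).
      apply: Rmult_le_compat; [exact: h3| |exact: h2|exact: fb].
      by apply: Rmult_le_pos; [exact: Rabs_pos|lra].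
    by right; rewrite -ss; field; lra.
  have hM : ex_series (fun j => C * K * m * inv_32 j.+1).
    by apply: (ex_series_scal_l (V := R_NormedModule)); exact: ex_series_inv_32.
  have ex : ex_series (fun j => Rabs (a i.+1 j.+1)).
    by apply: ex_series_le hM => n; rewrite /norm /= /abs /= Rabs_Rabsolu; exact: ptw.
  apply: Rle_trans (Series_Rabs _ ex) _.
  have -> : C * K * sum_32 * m = C * K * m * sum_32 by ring.
  rewrite /sum_32 -Series_scal_l; apply: Series_le => // n.
  by split; [exact: Rabs_pos|exact: ptw].
pose h n := C * K * sum_32 * (8 / (w * w) * (sqrt (INR n) / (w + sqrt (INR n)))).
have cks : 0 <= C * K * sum_32 by apply: Rmult_le_pos => //; nra.
have hA n : 0 <= Rabs (Series (fun j => a n.+1 j.+1)) <= h n.+1 - h n.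
  split; first exact: Rabs_pos.
  apply: Rle_trans (inner n) _.
  rewrite /h -Rmult_minus_distr_l; apply: Rmult_le_compat_l => //.
  apply: min_le_telescope => //.
  - by apply: sqrt_lt_R0; exact: INRS_gt0.
  - exact: sqrt_pos.
  - by rewrite !sqrt_sqrt ?S_INR //; have := pos_INR n; lra.
have hB n : h n <= C * K * sum_32 * (8 / (w * w)).
  rewrite /h; apply: Rmult_le_compat_l => //.
  have hn := sqrt_pos (INR n).
  have h8 : 0 <= 8 / (w * w) by apply: Rdiv_le_0_compat; nra.
  rewrite -[X in _ <= X]Rmult_1_r; apply: Rmult_le_compat_l => //.
  apply: (Rmult_le_reg_r (w + sqrt (INR n))); first lra.
  rewrite /Rdiv Rmult_assoc Rinv_l; lra.
have [ex hb] := ex_series_telescope hA hB.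
apply: Rle_trans (Series_Rabs _ ex) _.
apply: Rle_trans hb _.
by rewrite /h sqrt_0 ww; right; field; lra.
Qed.

(** * The murmuration function *)

Lemma floor_natP (x : R) : 0 <= x -> INR (floor_nat x) <= x < INR (floor_nat x).+1.
Proof.
move=> x0; have [h1 h2] := base_Int_part x.
have z0 : (0 <= Int_part x)%Z.
  by have : (-1 < Int_part x)%Z; [apply: lt_IZR|]; lra || lia.
have e : INR (floor_nat x) = IZR (Int_part x) by rewrite /floor_nat INR_IZR_INZ Z2Nat.id.
by rewrite S_INR e; lra.
Qed.

Lemma is_series_finite (a : nat -> R) (M : nat) : (forall i, (M <= i)%N -> a i = 0) ->
  is_series a (\big[Rplus/0]_(0 <= i < M) a i).
Proof.
move=> h; change (is_lim_seq (sum_n a) (\big[Rplus/0]_(0 <= i < M) a i)).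
apply: (is_lim_seq_ext_loc (fun _ => \big[Rplus/0]_(0 <= i < M) a i)); last exact: is_lim_seq_const.
exists M => n hn; rewrite sum_n_big -(big_mkord xpredT a).
have hM : (M <= n.+1)%N by apply/leP; lia.
rewrite (big_cat_nat (leq0n M) hM) /= [X in _ + X]big_nat_cond [X in _ + X]big1 ?Rplus_0_r //.
by move=> i /andP [/andP [i1 _] _]; exact: h.
Qed.

(* Dirichlet regrouping [r = d m] of a finite double sum. *)
Lemma sum_nuf (M : nat) (G : nat -> R) : (forall r, (M < r)%N -> G r = 0) ->
  \big[Rplus/0]_(0 <= i < M) (Qf i.+1 * \big[Rplus/0]_(0 <= m < M) G (i.+1 * m.+1)%N)
    = \big[Rplus/0]_(1 <= r < M.+1) (nuf r * G r).
Proof.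
move=> hG.
have inner i : \big[Rplus/0]_(0 <= m < M) G (i.+1 * m.+1)%N =
    \big[Rplus/0]_(0 <= r < M) (if (i.+1 %| r.+1)%N then G r.+1 else 0).
  rewrite -big_dvdn // (big_cat_nat (leq0n M) (leq_pmull M (ltn0Sn i))) /=.
  rewrite [X in _ + X]big_nat_cond [X in _ + X]big1 ?Rplus_0_r //.
  by move=> r /andP [/andP [r1 _] _]; case: ifP => // _; exact: hG.
transitivity (\big[Rplus/0]_(0 <= i < M) \big[Rplus/0]_(0 <= r < M)
    (if (i.+1 %| r.+1)%N then Qf i.+1 * G r.+1 else 0)).
  apply: eq_bigr => i _; rewrite inner big_distrr; apply: eq_bigr => r _ /=.
  by case: ifP => _ //; rewrite Rmult_0_r.
rewrite exchange_big big_add1 /= big_nat_cond [RHS]big_nat_cond; apply: eq_bigr => r /andP [/andP [_ rM] _].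
rewrite nuf_sum // big_distrl /= big_add1 /= (big_nat_widen 0 r.+1 M) //.
rewrite -big_mkcond [RHS]big_mkcond [LHS]big_mkcond /=; apply: eq_bigr => d _.
case: (boolP (d.+1 %| r.+1)%N) => //= hd.
by rewrite (_ : (d < r.+1)%N = true) //; exact: dvdn_leq.
Qed.

Lemma cusp_gt1 (j : nat) (u : R) : 1 <= u -> cusp j u = 0.
Proof. by move=> h; rewrite /cusp sqrt_neg_0 ?Rmult_0_l //; nra. Qed.

Lemma murmur_terms (j : nat) (y : R) (r : nat) : 0 < y -> INR r <= 2 * sqrt y ->
  sqrt (4 * y - INR r ^ 2) * chebyshevU (2 * j) (INR r / (2 * sqrt y))
    = 2 * sqrt y * cusp j (INR r / (2 * sqrt y)).
Proof.
move=> y0 hr; have q0 := sqrt_lt_R0 _ y0; have qq := sqrt_sqrt _ (Rlt_le _ _ y0).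
have r0 := pos_INR r.
set u := INR r / (2 * sqrt y).
have eu : INR r = 2 * sqrt y * u by rewrite /u; field; lra.
have u0 : 0 <= u by apply: Rdiv_le_0_compat; lra.
have u1 : u <= 1 by apply: (Rmult_le_reg_l (2 * sqrt y)); lra.
have -> : 4 * y - INR r ^ 2 = (2 * sqrt y) * (2 * sqrt y) * (1 - u * u).
  by rewrite eu -{1}qq; ring.
rewrite sqrt_mult; [|nra|nra].
by rewrite sqrt_square /cusp; [ring|lra].
Qed.

Lemma cosint_odd (j : nat) : (-1) ^ j * cosint 1 (2 * j + 1) = if j == 0%N then PI / 2 else 0.
Proof.
case: j => [|j]; last by rewrite cosint_lt ?Rmult_0_r //; lia.
by rewrite (@cosint_val 1 _ 0) // bin0 /=; field.
Qed.

Lemma dsum_bessel_term (j : nat) (y : R) : 0 < y ->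
  dsum (bessel_term (2 * j + 2) y) =
  Series (fun i => Qf i.+1) / INR (2 * j + 1)
  - 2 * sqrt y * (if j == 0%N then PI / 2 else 0) * Series (fun i => Qf i.+1 * / INR i.+1)
  + 2 * (-1) ^ j / INR (2 * j + 1) *
    \big[Rplus/0]_(1 <= r < (floor_nat (2 * sqrt y)).+1) (nuf r * cusp j (INR r / (2 * sqrt y))).
Proof.
move=> y0; have q0 := sqrt_lt_R0 _ y0; have PI0 := PI_RGT_0; have n0 := INR_odd_gt0 j.
set M := floor_nat (2 * sqrt y).
have [hM1 hM2] : INR M <= 2 * sqrt y < INR M.+1 by apply: floor_natP; lra.
pose G r := cusp j (INR r / (2 * sqrt y)).
have G0 r : (M < r)%N -> G r = 0.
  move=> hr; apply: cusp_gt1.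
  have : INR M.+1 <= INR r by apply: le_INR; lia.
  move=> h; apply: (Rmult_le_reg_r (2 * sqrt y)); first lra.
  by rewrite /Rdiv Rmult_assoc Rinv_l; lra.
pose inner i := \big[Rplus/0]_(0 <= m < M) G (i.+1 * m.+1)%N.
have term i : Series (fun s => bessel_term (2 * j + 2) y i.+1 s.+1) =
   / INR (2 * j + 1) * Qf i.+1
   + (- (2 * sqrt y * (if j == 0%N then PI / 2 else 0)) * (Qf i.+1 * / INR i.+1)
   + 2 * (-1) ^ j / INR (2 * j + 1) * (Qf i.+1 * inner i)).
  have D0 := INRS_gt0 i.
  pose x := 4 * PI * sqrt y / INR i.+1.
  have x0 : 0 < x by apply: Rdiv_lt_0_compat => //; nra.
  (* As [d >= 1], the same [M] serves every [d]; kinks beyond [x] contribute a zero [cusp]. *)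
  have xM : x < 2 * PI * INR M.+1.
    apply: (Rle_lt_trans _ (4 * PI * sqrt y)); last by nra.
    apply: (Rmult_le_reg_r (INR i.+1)) => //.
    have -> : x * INR i.+1 = 4 * PI * sqrt y by rewrite /x; field; lra.
    have : 1 <= INR i.+1 by rewrite S_INR; have := pos_INR i; lra.
    have : 0 < 4 * PI * sqrt y by nra.
    nra.
  have -> : Series (fun s => bessel_term (2 * j + 2) y i.+1 s.+1) = Qf i.+1 * schlomilch j x.
    rewrite /schlomilch -Series_scal_l; apply: Series_ext => s.
    rewrite /bessel_term (_ : (2 * j + 2 - 1 = 2 * j + 1)%N); last by lia.
    by congr (_ * (besselJ _ _ / _)); rewrite /x; field; lra.
  rewrite (@schlomilch_formula j M x) // cosint_odd.
  have -> : \big[Rplus/0]_(0 <= m < M) cusp j (2 * PI * INR m.+1 / x) = inner i.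
    apply: eq_bigr => m _; rewrite /G; congr (cusp j _).
    rewrite (_ : INR (i.+1 * m.+1) = INR i.+1 * INR m.+1); last exact: mult_INR.
    by rewrite /x; field; lra.
  by rewrite /x; field; lra.
(* For [d > M] every product [d * m] exceeds [M], where [G] vanishes, so the outer series is a
   finite sum. *)
have fin : is_series (fun i => Qf i.+1 * inner i) (\big[Rplus/0]_(1 <= r < M.+1) (nuf r * G r)).
  rewrite -sum_nuf //; apply: is_series_finite => i Mi.
  rewrite /inner big1 ?Rmult_0_r // => m _; apply: G0.
  by apply: leq_trans (leq_pmulr i.+1 (ltn0Sn m)).
have S1 := is_series_scal_l (/ INR (2 * j + 1)) _ _ (Series_correct _ ex_series_Qf).
have S2 := is_series_scal_l (- (2 * sqrt y * (if j == 0%N then PI / 2 else 0))) _ _ (Series_correct _ ex_series_Qf_div).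
have S3 := is_series_scal_l (2 * (-1) ^ j / INR (2 * j + 1)) _ _ fin.
have S4 := is_series_plus _ _ _ _ S1 (is_series_plus _ _ _ _ S2 S3).
rewrite /dsum (Series_ext _ _ term).
have := is_series_unique _ _ S4; rewrite /plus /scal /= /mult /= => ->.
by rewrite /G; toR; rewrite /Rdiv; ring.
Qed.

Lemma murmur_eq (j : nat) (y : R) : 0 < y ->
  murmur (2 * j + 2) y = alphaC * sqrt y * dsum (bessel_term (2 * j + 2) y).
Proof.
move=> y0; have q0 := sqrt_lt_R0 _ y0; have qq := sqrt_sqrt _ (Rlt_le _ _ y0).
have PI0 := PI_RGT_0; have n0 := INR_odd_gt0 j.
rewrite dsum_bessel_term // /murmur betaC_eq gammaC_eq.
have -> : ((2 * j + 2)./2 - 1 = j)%N by lia.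
have -> : (2 * j + 2 - 2 = 2 * j)%N by lia.
have -> : (2 * j + 2 == 2)%N = (j == 0%N) by lia.
have -> : INR (2 * j + 2) - 1 = INR (2 * j + 1).
  by rewrite (_ : (2 * j + 2 = (2 * j + 1).+1)%N) ?S_INR; [ring|lia].
set M := floor_nat (2 * sqrt y).
have [hM1 hM2] : INR M <= 2 * sqrt y < INR M.+1 by apply: floor_natP; lra.
have -> : \big[Rplus/0]_(1 <= r < M.+1)
      (nuf r * sqrt (4 * y - INR r ^ 2) * chebyshevU (2 * j) (INR r / (2 * sqrt y))) =
   2 * sqrt y * \big[Rplus/0]_(1 <= r < M.+1) (nuf r * cusp j (INR r / (2 * sqrt y))).
  rewrite big_distrr /= big_nat_cond [RHS]big_nat_cond; apply: eq_bigr => r /andP [/andP [_ rM] _].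
  have hr : INR r <= 2 * sqrt y.
    by apply: Rle_trans hM1; apply: le_INR; lia.
  by rewrite Rmult_assoc murmur_terms //; ring.
move: (\big[_/_]_(_ <= _ < _) _) (Series _) (Series _) => b s1 s2.
rewrite [X in _ - _ * X = _](esym qq); move: (sqrt y) q0 => q q0 {qq}.
by case: (j == 0%N); field; lra.
Qed.

Lemma bessel_term_dominated (j : nat) (y : R) : 0 < y ->
  exists C, dominated (bessel_term (2 * j + 2) y) C.
Proof.
move=> y0; have [K [K0 hK]] := besselJ_odd_error j.
have [C [C0 hC]] := @kernel_dominated (besselJ (2 * j + 1)) K y y0 K0 (fun z z0 => let: And3 h _ _ := hK z z0 in h).
exists C; split => // d s d0 s0; rewrite /bessel_term (_ : (2 * j + 2 - 1 = 2 * j + 1)%N); last by lia.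
exact: hC.
Qed.

(** The double sum of the errors is [O(1 / sqrt y)], which the prefactor [alphaC * sqrt y] turns
    into a constant; the bound is thus uniform in [y > 0]. *)
Lemma murmur_asym (j : nat) : exists C, forall y, 0 < y ->
  Rabs (murmur (2 * j + 2) y - Rpower y (1 / 4) * osc_const (2 * j + 2) * dsum (osc_term y)) <= C.
Proof.
have PI0 := PI_RGT_0.
have [K [K0 hK]] := besselJ_odd_error j.
have [C [C0 hC]] := @kernel_error (fun z => besselJ (2 * j + 1) z - bessel_main j z) K K0
  (fun z z0 => let: And3 _ h1 h2 := hK z z0 in conj h1 h2).
exists (Rabs alphaC * C) => y y0.
have q0 := sqrt_lt_R0 _ y0; have qq0 := sqrt_lt_R0 _ q0; have qqq := sqrt_sqrt _ (Rlt_le _ _ q0).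
have [C1 h1] := bessel_term_dominated j y0.
have [C2 h2] := osc_dominated.
pose c := (-1) ^ j * (sqrt (2 / PI) / sqrt (4 * PI)) / sqrt (sqrt y).
have h3 : dominated (fun d s => c * osc_term y d s) (Rabs c * C2).
  have [C20 hb] := h2 y; split; first by apply: Rmult_le_pos => //; exact: Rabs_pos.
  move=> d s d0 s0; rewrite Rabs_mult.
  have := hb d s d0 s0; have := Rabs_pos c => p h.
  have : Rabs c * Rabs (osc_term y d s) <= Rabs c * (C2 * inv_32 d * inv_32 s) by apply: Rmult_le_compat_l.
  lra.
have e1 : dsum (fun d s => Qf d * ((besselJ (2 * j + 1) (bessel_arg y d s) - bessel_main j (bessel_arg y d s)) / INR s)) =
   dsum (bessel_term (2 * j + 2) y) - c * dsum (osc_term y).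
  rewrite -dsum_scal -(dsum_minus h1 h3) /dsum; apply: Series_ext => d; apply: Series_ext => s.
  rewrite /c -(@osc_main j y d.+1 s.+1) // /bessel_term (_ : (2 * j + 2 - 1 = 2 * j + 1)%N); last by lia.
  by rewrite -/(bessel_arg y d.+1 s.+1) /Rdiv; ring.
have e2 : Rpower y (1 / 4) = sqrt (sqrt y).
  rewrite -(Rpower_sqrt _ q0) -(Rpower_sqrt _ y0) Rpower_mult; congr (Rpower y _); field.
have -> : murmur (2 * j + 2) y - Rpower y (1 / 4) * osc_const (2 * j + 2) * dsum (osc_term y) =
  alphaC * sqrt y * (dsum (bessel_term (2 * j + 2) y) - c * dsum (osc_term y)).
  rewrite murmur_eq // e2 /osc_const /c (_ : ((2 * j + 2)./2 - 1 = j)%N); last by lia.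
  move: (dsum (osc_term y)) (dsum (bessel_term _ y)) => B A.
  have alg (al e c0 w : R) : w <> 0 ->
    al * (w * w) * A - w * (e * c0 * al) * B = al * (w * w) * (A - e * c0 / w * B) by move=> *; field.
  by have := alg alphaC ((-1) ^ j) (sqrt (2 / PI) / sqrt (4 * PI)) _ (Rgt_not_eq _ _ qq0); rewrite qqq.
rewrite -e1 Rabs_mult Rabs_mult (Rabs_right (sqrt y)); last lra.
have := hC y y0; move=> hh.
rewrite Rmult_assoc; apply: Rmult_le_compat_l; first exact: Rabs_pos.
apply: (Rle_trans _ (sqrt y * (C / sqrt y))); first by apply: Rmult_le_compat_l; lra.
by right; field; lra.
Qed.

Theorem theorem3 (k : nat) (k_pos : (0 < k)%N) (k_even : ~~ odd k) :
  (forall y : R, 0 < y ->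
     abs_dsummable (bessel_term k y) /\
     murmur k y = alphaC * sqrt y * dsum (bessel_term k y))
  /\
  (exists c1 c2 : R, 0 < c1 /\ 0 < c2 /\
     forall d : nat, (0 < d)%N ->
       c1 * (IZR (mobius d) ^ 2 / INR d ^ 2) <= Qf d /\
       Qf d <= c2 * (IZR (mobius d) ^ 2 / INR d ^ 2))
  /\
  (exists C : R, Rbar_locally p_infty (fun y : R =>
     Rabs (murmur k y - Rpower y (1 / 4) * osc_const k * dsum (osc_term y)) <= C))
  /\
  (forall y : R, 0 < y -> abs_dsummable (osc_term y))
  /\
  (exists B : R, forall y : R, 0 < y -> Rabs (dsum (osc_term y)) <= B).
Proof.
(* With [j = k / 2 - 1] the Bessel order [k - 1] is [2 j + 1]. *)
have -> : k = (2 * (k./2).-1 + 2)%N by lia.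
move: (k./2).-1 => j {k k_pos k_even}.
split; [|split; [|split; [|split]]].
- move=> y y0; split; last exact: murmur_eq.
  by have [C hC] := bessel_term_dominated j y0; exact: dominated_abs hC.
- exists 1, (exp (7 * (PI ^ 2 / 6))); split; first lra; split; first exact: exp_pos.
  move=> d d0; have D0 := INR_gt0 d0; have D2 : 0 < INR d ^ 2 by apply: pow_lt.
  rewrite mobius_sqr; case: (boolP (sqfree d)) => sd; last first.
    by rewrite QfE (negbTE sd) /Rdiv Rmult_0_l !Rmult_0_r; lra.
  have [h1 h2] := Qf_bounds sd.
  by split; apply: (Rmult_le_reg_l (INR d ^ 2)) => //; field_simplify; lra.
(* The neighbourhood of infinity can be all of [y > 0]. *)
- by have [C hC] := murmur_asym j; exists C, 0 => y y0; exact: hC.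
- by move=> y _; have [C hC] := osc_dominated; exact: dominated_abs (hC y).
- have [C hC] := osc_dominated; exists (C * sum_32 * sum_32) => y _.
  by have [] := dominated_outer (hC y).
Qed.
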